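(* Let $\hbar\ge0$. Then there exists a faithful (i.e. injective) continuous representation of the Fréchet $*$-algebra $(\mathcal{A}(D_n),\star_\hbar,{}^* )$.
   Context: Fix $n\ge1$; multi-index conventions $|P|=\sum P_i$, $P!=\prod P_i!$, $\binom PT=\prod\binom{P_i}{T_i}$, componentwise $\le,\min$. $D_n=Z/U(1)$, $Z=\{r\in\mathbb{C}^{1+n}:-|r^0|^2+\sum_{i\ge1}|r^i|^2=-1\}$. $\hat D_n=\hat Z/\mathbb{C}^*$, $\hat Z=\{(p,q):-p^0q^0+\sum_{i\ge1}p^iq^i=-1\}$, $z\cdot(p,q)=(zp,q/z)$; $\Delta_D([r])=[r,\bar r]$. $\mathcal{A}(D_n)=\{\hat a\circ\Delta_D:\hat a\in\mathcal{O}(\hat D_n)\}$ with Fréchet seminorms $\|a\|_{D_n,K}=\sup_K|\hat a|$ and involution $a^*=\bar a$ (pointwise complex conjugation). $f_{P,Q}([r])=r^P\bar r^Q$ ($P,Q\in\mathbb{N}_0^{1+n}$, $|P|=|Q|$); $\mathcal{P}(D_n)$ their span, dense in $\mathcal{A}(D_n)$. $\star_0$ is the pointwise product. For $\hbar>0$, with $(z)_m=\prod_{k=0}^{m-1}(z+k)$, $\star_\hbar$ is the associative product on $\mathcal{P}(D_n)$ given by $f_{P,Q}\star_\hbar f_{R,S}=\sum_{T\in\mathbb{N}_0^{1+n},T\le\min\{P,S\}}(-1)^{T_0}\frac{(\frac1{2\hbar})_{|P+S-T|}T!}{(\frac1{2\hbar})_{|P|}(\frac1{2\hbar})_{|S|}}\binom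 PT\binom ST f_{P+R-T,Q+S-T}$ (reduced Wick product), extended (as is known) continuously to $\mathcal{A}(D_n)$; for real $\hbar$ this is a Fréchet $*$-algebra with involution $^*$. A continuous representation of $(\mathcal{A}(D_n),\star_\hbar,{}^* )$ is a pair $(\mathcal{H},\pi)$ of a pre-Hilbert space $\mathcal{H}$ and a unital $*$-homomorphism $\pi:\mathcal{A}(D_n)\to\mathcal{L}^*(\mathcal{H})$ that is continuous for the weak topology on $\mathcal{L}^*(\mathcal{H})$ (seminorms $A\mapsto|\langle\phi|A\psi\rangle|$, $\phi,\psi\in\mathcal{H}$); here $\mathcal{L}^*(\mathcal{H})$ is the $*$-algebra of all linear maps $A:\mathcal{H}\to\mathcal{H}$ admitting a linear $A^*:\mathcal{H}\to\mathcal{H}$ with $\langle\phi|A\psi\rangle=\langle A^*\phi|\psi\rangle$ for all $\phi,\psi$. *)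

(* Defs.v *)
From HB Require Import structures.
From mathcomp Require Import all_boot all_order all_algebra.
From mathcomp Require Import reals.
From mathcomp Require Import complex.

Set Implicit Arguments.
Unset Strict Implicit.
Unset Printing Implicit Defensive.

Import Order.TTheory GRing.Theory Num.Theory.
Local Open Scope ring_scope.

Section Defs.
Variable R : realType.
Local Notation C := (R[i]).
Variable n : nat.

(* vectors in C^{1+n}, entries r 0 i, i : 'I_n.+1 (index 0 is the "time" index) *)
Local Notation vec := 'rV[C]_n.+1.

(* ---------- D_n = Z / U(1) ---------- *)
Definition in_Z (r : vec) : bool :=
  - (`|r 0 ord0| ^+ 2) + \sum_(i < n.+1 | i != ord0) `|r 0 i| ^+ 2 == -1.

(* the manifold Z; functions on D_n are the U(1)-invariant functions on Z *)
Definition Zpt := {r : vec | in_Z r}.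
Definition Fn := Zpt -> C.

Definition conjv (r : vec) : vec := map_mx Num.conj r.

(* ---------- \hat D_n = \hat Z / C^* ---------- *)
Definition in_Zhat (z : vec * vec) : Prop :=
  - (z.1 0 ord0 * z.2 0 ord0) + \sum_(i < n.+1 | i != ord0) z.1 0 i * z.2 0 i = -1.

Definition nrm (z : vec * vec) : C := \sum_i `|z.1 0 i| + \sum_i `|z.2 0 i|.
Definition subp (w z : vec * vec) : vec * vec := (w.1 - z.1, w.2 - z.2).

Definition cdiff (g : vec * vec -> C) (z : vec * vec) : Prop :=
  exists c d : vec, forall e : C, 0 < e -> exists delta : C, 0 < delta /\
    forall h k : vec, nrm (h, k) < delta ->
      `|g (z.1 + h, z.2 + k) - g z
         - (\sum_i c 0 i * h 0 i + \sum_i d 0 i * k 0 i)| <= e * nrm (h, k).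

(* holomorphic on the complex submanifold \hat Z: locally the restriction
   of a function holomorphic on an open ball of the ambient space *)
Definition holo_on_Zhat (f : vec * vec -> C) : Prop :=
  forall z, in_Zhat z -> exists delta : C, 0 < delta /\
    exists g : vec * vec -> C,
      (forall w, nrm (subp w z) < delta -> cdiff g w) /\
      (forall w, in_Zhat w -> nrm (subp w z) < delta -> f w = g w).

Definition Cstar_inv (f : vec * vec -> C) : Prop :=
  forall (l : C) (z : vec * vec), l != 0 -> in_Zhat z ->
    f (l *: z.1, l^-1 *: z.2) = f z.

(* O(\hat D_n), realised as C^*-invariant holomorphic functions on \hat Z *)
Definition Ohat (f : vec * vec -> C) : Prop := holo_on_Zhat f /\ Cstar_inv f.

Definition represents (a : Fn) (ahat : vec * vec -> C) : Prop :=
  Ohat ahat /\ forall r : Zpt, a r = ahat (val r, conjv (val r)).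

Definition inA (a : Fn) : Prop := exists ahat, represents a ahat.

(* compact subsets of \hat D_n, lifted to \hat Z (closed and bounded in C^{2(1+n)}) *)
Definition compactZhat (K : vec * vec -> Prop) : Prop :=
  (forall z, K z -> in_Zhat z) /\
  (exists M : C, forall z, K z -> nrm z <= M) /\
  (forall z, (forall e : C, 0 < e -> exists w, K w /\ nrm (subp w z) < e) -> K z).

Definition bnd (ahat : vec * vec -> C) (K : vec * vec -> Prop) (M : C) : Prop :=
  forall z, K z -> `|ahat z| <= M.

(* continuity of a linear functional A(D_n) -> C w.r.t. the seminorms ||.||_{D_n,K} *)
Definition contA (L : Fn -> C) : Prop :=
  exists K, compactZhat K /\ exists Cc : C, 0 <= Cc /\
    forall a ahat M, represents a ahat -> 0 <= M -> bnd ahat K M -> `|L a| <= Cc * M.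

Definition mabs (P : 'I_n.+1 -> nat) : nat := (\sum_i P i)%N.

Definition fPQ (P Q : 'I_n.+1 -> nat) : Fn :=
  fun r => \prod_i ((val r) 0 i ^+ P i * (Num.conj ((val r) 0 i)) ^+ Q i).

Definition poch (z : C) (m : nat) : C := \prod_(k < m) (z + k%:R).

Definition wick_coef (hbar : R) (P S T : 'I_n.+1 -> nat) : C :=
  let x := real_complex R ((2 * hbar)^-1) in
  (-1) ^+ (T ord0) * poch x (mabs (fun i => P i + S i - T i)%N)
  * (\prod_i ((T i)`!)%:R) / (poch x (mabs P) * poch x (mabs S))
  * (\prod_i ('C(P i, T i))%:R) * (\prod_i ('C(S i, T i))%:R).

(* f_{P,Q} star_hbar f_{R,S}; T ranges over multi-indices T <= min{P,S}
   (encoded as finite functions into 'I_(|P|+1), which contains all T_i <= P_i) *)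
Definition wick_prod (hbar : R) (P Q P' Q' : 'I_n.+1 -> nat) : Fn :=
  fun r =>
  \sum_(T : {ffun 'I_n.+1 -> 'I_(mabs P).+1}
          | [forall i, (val (T i) <= minn (P i) (Q' i))%N])
    wick_coef hbar P Q' (fun i => val (T i))
    * fPQ (fun i => P i + P' i - val (T i))%N (fun i => Q i + Q' i - val (T i))%N r.

(* star : Fn -> Fn -> Fn is the product star_hbar on A(D_n):
   pointwise for hbar = 0; for hbar > 0 the (unique) continuous bilinear
   extension of the reduced Wick product from P(D_n). *)
Definition is_star_hbar (hbar : R) (star : Fn -> Fn -> Fn) : Prop :=
  (hbar = 0 -> forall a b, inA a -> inA b -> star a b = (fun r => a r * b r)) /\
  (0 < hbar ->
    (forall a b, inA a -> inA b -> inA (star a b)) /\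
    (forall (l : C) a b c, inA a -> inA b -> inA c ->
       star (fun r => l * a r + b r) c = (fun r => l * star a c r + star b c r) /\
       star c (fun r => l * a r + b r) = (fun r => l * star c a r + star c b r)) /\
    (forall K, compactZhat K -> exists K', compactZhat K' /\
       exists Cc : C, 0 <= Cc /\
       forall a b fa fb fab Ma Mb,
         represents a fa -> represents b fb -> represents (star a b) fab ->
         0 <= Ma -> 0 <= Mb -> bnd fa K' Ma -> bnd fb K' Mb ->
         bnd fab K (Cc * Ma * Mb)) /\
    (forall P Q P' Q' : 'I_n.+1 -> nat, mabs P = mabs Q -> mabs P' = mabs Q' ->
       star (fPQ P Q) (fPQ P' Q') = wick_prod hbar P Q P' Q')).

Definition inner_product (H : lmodType C) (ip : H -> H -> C) : Prop :=
  (forall (l : C) (phi psi1 psi2 : H), ip phi (l *: psi1 + psi2) = l * ip phi psi1 + ip phi psi2) /\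
  (forall phi psi : H, ip psi phi = Num.conj (ip phi psi)) /\
  (forall phi : H, 0 <= ip phi phi) /\
  (forall phi : H, ip phi phi = 0 -> phi = 0).

Definition lin_map (H : lmodType C) (A : H -> H) : Prop :=
  forall (l : C) (psi1 psi2 : H), A (l *: psi1 + psi2) = l *: A psi1 + A psi2.

Definition adjointable (H : lmodType C) (ip : H -> H -> C) (A : H -> H) : Prop :=
  lin_map A /\ exists B : H -> H, lin_map B /\ forall phi psi, ip phi (A psi) = ip (B phi) psi.

Definition cont_rep (star : Fn -> Fn -> Fn) (H : lmodType C) (ip : H -> H -> C)
    (pi : Fn -> H -> H) : Prop :=
  (forall a, inA a -> adjointable ip (pi a)) /\
  (forall (l : C) a b, inA a -> inA b ->
     pi (fun r => l * a r + b r) = (fun psi => l *: pi a psi + pi b psi)) /\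
  (forall a b, inA a -> inA b -> pi (star a b) = (fun psi => pi a (pi b psi))) /\
  (pi (fun _ => 1) = (fun psi => psi)) /\
  (forall a, inA a -> forall phi psi,
     ip phi (pi a psi) = ip (pi (fun r => Num.conj (a r)) phi) psi) /\
  (forall phi psi, contA (fun a => ip phi (pi a psi))).


End Defs.

(* Main.v *)
Require Import Defs.
From HB Require Import structures.
From mathcomp Require Import all_boot all_order all_algebra.
From mathcomp Require Import all_classical all_reals all_analysis.
From mathcomp Require Import complex.
From mathcomp Require Import ring lra zify.

(** Every evaluation a |-> a(r), r in Z, is a positive functional for the star
    product, and the direct sum of the corresponding GNS representations is
    faithful because the cyclic vector 1_r satisfies <1_r | pi(a) 1_r> = a(r).

    Positivity on polynomials: with x = 1/(2 hbar), the numbers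
    (conj f_{P,Q} * f_{P',Q'})(r), |Q| = m, |Q'| = k, are coefficients at u^Q v^Q' of
      sum_j (x)_{m+k-j} eta^j/j! (r.u)^{m-j}/(m-j)! (conj r.v)^{k-j}/(k-j)!
    where eta = - u_0 v_0 + sum_{i>0} u_i v_i. A Vandermonde summation rewrites this as
      sum_l (x)_m (x)_k/((x)_l l!) h^l (r.u)^{m-l}/(m-l)! (conj r.v)^{k-l}/(k-l)!
    with h = eta + (r.u)(conj r.v), and for r in Z the form h is a sum of squares
    sum_{i>0} conj(L_i)(u) L_i(v), so the matrix is a Gram matrix.

    Associativity, compatibility with the involution and positivity pass from
    polynomials to A(D_n) by continuity, once the C^*-invariant polynomials are
    known to be dense: f on the quadric is approximated by an entire function
    (Fejer sums of its Laurent expansion along the curves (t p_0, q_0/t), controlled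
    near p_0 q_0 = 0 by the maximum principle), entire functions by polynomials,
    and these are averaged over the C^*-action. *)

Set Implicit Arguments.
Unset Strict Implicit.
Unset Printing Implicit Defensive.

Import Order.TTheory GRing.Theory Num.Theory.
Import numFieldNormedType.Exports.
Local Open Scope complex_scope.
Local Open Scope ring_scope.

(** All complex analysis here rests on Goursat's theorem for rectangles. Through the exponential map
    it shows that means over circles about 0 do not depend on the radius, and this replaces Cauchy's
    formula in the Taylor and Laurent expansions. Coefficients are averages over roots of unity
    instead of integrals: each is a finite combination of values of f, so it stays entire in the
    remaining variables, and orthogonality is exact; the price is that independence of the radius
    holds only up to an error, for M large. Negative powers of p_0 are absorbed by q_0, because on
    the quadric p_0 q_0 = 1 + sum_{i>0} p_i q_i is a polynomial in the other coordinates. The form h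
    is a sum of squares because r is a unit timelike vector: up to the sign of the time coordinate,
    h is the Minkowski form on its orthogonal complement, and the L_i are the spatial components
    after a boost that brings r to rest. The GNS spaces are realised as spaces of functions, where
    definiteness of the inner product follows from the reproducing property instead of a quotient by
    null vectors. *)

Section ComplexModulus.
Variable R : realType.
Local Notation C := (R[i]).

(** The norm of [R[i]] takes its values in [R[i]]; estimates are carried out with this real-valued
    copy, where the order is total and linear arithmetic applies. *)
Definition nm (z : C) : R := complex.Re `|z|.

Lemma nmE z : `|z| = (nm z)%:C.
Proof. by rewrite /nm normc_def. Qed.

Lemma nm_ge0 z : 0 <= nm z.
Proof. by rewrite -lecR -nmE normr_ge0. Qed.

Lemma nmD x y : nm (x + y) <= nm x + nm y.
Proof. by rewrite -lecR rmorphD /= -!nmE ler_normD. Qed.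

Lemma nmM x y : nm (x * y) = nm x * nm y.
Proof. by apply: complexI; rewrite rmorphM /= -!nmE normrM. Qed.

Lemma nmN x : nm (- x) = nm x.
Proof. by rewrite /nm normrN. Qed.

Lemma nmB x y : nm (x - y) <= nm x + nm y.
Proof. by rewrite -(nmN y) nmD. Qed.

Lemma nm_sym x y : nm (x - y) = nm (y - x).
Proof. by rewrite /nm distrC. Qed.

Lemma nm_tri z x y : nm (x - y) <= nm (x - z) + nm (z - y).
Proof. by rewrite -lecR rmorphD /= -!nmE; exact: ler_distD. Qed.

Lemma nm0 : nm 0 = 0.
Proof. by rewrite /nm normr0. Qed.

Lemma nm1 : nm 1 = 1.
Proof. by rewrite /nm normr1. Qed.

Lemma nm_eq0 x : (nm x == 0) = (x == 0).
Proof. by rewrite -(inj_eq (@complexI R)) -nmE normr_eq0. Qed.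

Lemma nm_gt0 x : (0 < nm x) = (x != 0).
Proof. by rewrite lt_neqAle nm_ge0 andbT eq_sym nm_eq0. Qed.

Lemma nmX x n : nm (x ^+ n) = nm x ^+ n.
Proof. by elim: n => [|n IH]; rewrite ?expr0 ?nm1 // !exprS nmM IH. Qed.

Lemma nmV x : nm x^-1 = (nm x)^-1.
Proof.
apply: complexI; rewrite -nmE normfV nmE.
by rewrite (fmorphV (real_complex R)).
Qed.

Lemma nm_real (x : R) : nm x%:C = `|x|.
Proof. by rewrite /nm normc_def /= expr0n addr0 sqrtr_sqr. Qed.

Lemma nm_nat n : nm n%:R = n%:R.
Proof. by rewrite -(rmorph_nat (real_complex R)) nm_real normr_nat. Qed.

Lemma nm_Re z : `|complex.Re z| <= nm z.
Proof. by rewrite -lecR -nmE normc_ge_Re. Qed.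

Lemma nm_Im z : `|complex.Im z| <= nm z.
Proof.
by case: z => a b; rewrite /nm normc_def /= -sqrtr_sqr ler_wsqrtr // lerDr sqr_ge0.
Qed.

Lemma nm_le_ReIm z : nm z <= `|complex.Re z| + `|complex.Im z|.
Proof.
rewrite {1}(complexE z); apply: le_trans (nmD _ _) _.
by rewrite nmM !nm_real /nm normc_def /= expr0n expr1n add0r sqrtr1 mul1r.
Qed.

Lemma nm_conj z : nm (Num.conj z) = nm z.
Proof. by rewrite /nm norm_conjC. Qed.

Lemma nm_sum (I : Type) (s : seq I) (P : pred I) (F : I -> C) :
  nm (\sum_(i <- s | P i) F i) <= \sum_(i <- s | P i) nm (F i).
Proof.
elim/big_rec2: _ => [|i y x _ IH]; first by rewrite nm0.
by apply: le_trans (nmD _ _) _; rewrite lerD2l.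
Qed.

Lemma nm_le_eps0 z : (forall e, 0 < e -> nm z <= e) -> z = 0.
Proof.
move=> H; apply/eqP; rewrite -nm_eq0 eq_le nm_ge0 andbT.
by apply/ler_addgt0Pl => e /H; rewrite addr0.
Qed.

Lemma nm_lec (z : C) (M : R) : (`|z| <= M%:C) = (nm z <= M).
Proof. by rewrite nmE lecR. Qed.

Lemma gt0c (e : C) : 0 < e -> exists2 e' : R, 0 < e' & e = e'%:C.
Proof.
move=> e0; have /complex_realP [k ek] : e \is Num.real by rewrite gtr0_real.
by exists k => //; rewrite -ltcR -ek.
Qed.

Lemma ge0c (e : C) : 0 <= e -> exists2 e' : R, 0 <= e' & e = e'%:C.
Proof.
move=> e0; have /complex_realP [k ek] : e \is Num.real by rewrite ger0_real.
by exists k => //; rewrite -lecR -ek.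
Qed.

End ComplexModulus.

(** * Integrals of complex functions over real intervals *)

Section CIntegral.
Variable R : realType.
Local Notation C := (R[i]).
Local Notation mu := (@lebesgue_measure R).

Definition cont (F : R -> C) := forall x e, 0 < e ->
  exists2 d, 0 < d & forall y, `|y - x| < d -> nm (F y - F x) <= e.

Definition Jr (u : R -> R) a b : R := \int[mu]_(x in `[a, b]) u x.
Definition Jc (F : R -> C) a b : C :=
  (Jr (fun x => complex.Re (F x)) a b) +i* (Jr (fun x => complex.Im (F x)) a b).

Lemma cont_ReIm F : cont F ->
  continuous (fun x => complex.Re (F x)) /\ continuous (fun x => complex.Im (F x)).
Proof.
move=> cF; split=> x; apply/cvgrPdist_le => /= e e0.
  have [d d0 Hd] := cF x e e0; near=> y.
  have {}Hd : nm (F y - F x) <= e.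
    by apply: Hd; rewrite distrC; near: y; exact: cvgr_dist_lt.
  rewrite distrC; apply: le_trans Hd; apply: le_trans (nm_Re _).
  by rewrite raddfB.
have [d d0 Hd] := cF x e e0; near=> y.
have {}Hd : nm (F y - F x) <= e.
  by apply: Hd; rewrite distrC; near: y; exact: cvgr_dist_lt.
rewrite distrC; apply: le_trans Hd; apply: le_trans (nm_Im _).
by rewrite raddfB.
Unshelve. all: by end_near. Qed.

Lemma integrable_cont (u : R -> R) a b : continuous u ->
  mu.-integrable `[a, b] (EFin \o u).
Proof.
move=> cu; apply: continuous_compact_integrable; first exact: segment_compact.
by apply: continuous_subspaceT.
Qed.

Lemma Jr_add u a b c : continuous u -> a <= b -> b <= c ->
  Jr u a c = Jr u a b + Jr u b c.
Proof.
move=> cu ab bc; have H := @Rintegral_itvB R u (BLeft a) (BRight c) b (integrable_cont _ _ cu).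
rewrite /Jr -(@Rintegral_itv_obnd_cbnd _ b) -?H ?bnd_simp //; first by ring.
apply: integrableS (integrable_cont b c cu) => //.
by apply: subset_itvr; rewrite bnd_simp.
Qed.

Lemma Jr_cst k a b : a <= b -> Jr (fun _ => k) a b = k * (b - a).
Proof.
move=> ab; rewrite /Jr Rintegral_cst //= lebesgue_measure_itv /= lte_fin.
move: ab; rewrite le_eqVlt => /predU1P [->|->]; last by [].
by rewrite ltxx subrr.
Qed.

Lemma Jr_bound u a b K : continuous u -> a <= b ->
  (forall x, a <= x <= b -> `|u x| <= K) -> `|Jr u a b| <= K * (b - a).
Proof.
move=> cu ab H; apply: le_trans (le_normr_Rintegral _ (integrable_cont _ _ cu)) _ => //.
have -> : K * (b - a) = \int[mu]_(x in `[a, b]) K.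
  by rewrite -Jr_cst.
apply: le_Rintegral => //.
- apply: integrable_cont => x.
  apply: (@continuous_comp _ _ _ u Num.norm); first exact: cu.
  exact: norm_continuous.
- by apply: integrable_cont => x; exact: cst_continuous.
Qed.

Lemma Jr_B u v a b : continuous u -> continuous v ->
  Jr (fun x => u x - v x) a b = Jr u a b - Jr v a b.
Proof. by move=> cu cv; rewrite /Jr RintegralB //; apply: integrable_cont. Qed.

Lemma Jc_add F a b c : cont F -> a <= b -> b <= c -> Jc F a c = Jc F a b + Jc F b c.
Proof.
by move=> /cont_ReIm [cr ci] ab bc; rewrite /Jc (Jr_add cr ab bc) (Jr_add ci ab bc).
Qed.

Lemma Jc_B F G a b : cont F -> cont G ->
  Jc (fun x => F x - G x) a b = Jc F a b - Jc G a b.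
Proof.
move=> /cont_ReIm [cr ci] /cont_ReIm [cr' ci']; rewrite /Jc.
have -> : (fun x => complex.Re (F x - G x)) = (fun x => complex.Re (F x) - complex.Re (G x)).
  by apply/funext => x; rewrite raddfB.
have -> : (fun x => complex.Im (F x - G x)) = (fun x => complex.Im (F x) - complex.Im (G x)).
  by apply/funext => x; rewrite raddfB.
by rewrite !Jr_B.
Qed.

Lemma Jc_cst k a b : a <= b -> Jc (fun _ => k) a b = k * (b - a)%:C.
Proof.
by move=> ab; rewrite /Jc !Jr_cst //; case: k => x y /=; apply/eqP;
  rewrite eq_complex /=; apply/andP; split; apply/eqP; ring.
Qed.

(** Real and imaginary parts are bounded separately, which costs a factor 2 compared with the sharp
    bound; it only changes constants in what follows. *)
Lemma Jc_bound F a b K : cont F -> a <= b ->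
  (forall x, a <= x <= b -> nm (F x) <= K) -> nm (Jc F a b) <= K * (b - a) *+ 2.
Proof.
move=> /cont_ReIm [cr ci] ab H.
apply: le_trans (nm_le_ReIm _) _; rewrite mulr2n; apply: lerD => /=; apply: Jr_bound => // x xab.
  by apply: le_trans (nm_Re _) _; exact: H.
by apply: le_trans (nm_Im _) _; exact: H.
Qed.

Lemma cont_cst k : cont (fun _ => k).
Proof. by move=> x e e0; exists 1 => // y _; rewrite subrr nm0 ltW. Qed.

Lemma contB F G : cont F -> cont G -> cont (fun x => F x - G x).
Proof.
move=> cF cG x e e0; have e2 : 0 < e / 2 by rewrite divr_gt0.
have [d1 d10 H1] := cF x _ e2; have [d2 d20 H2] := cG x _ e2.
exists (Num.min d1 d2); first by rewrite lt_min d10.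
move=> y; rewrite lt_min => /andP [/H1 h1 /H2 h2].
have -> : F y - G y - (F x - G x) = (F y - F x) - (G y - G x) by ring.
by apply: le_trans (nmB _ _) _; lra.
Qed.

End CIntegral.

(** * Goursat's theorem *)

Section Goursat.
Variable R : realType.
Local Notation C := (R[i]).

(** Complex differentiability of a function pulled back along the affine map (x, y) -> w0 + al x +
    be y: the differential is a complex multiple g of al dx + be dy. Keeping al and be general
    allows the parallelogram spanned by a logarithm and 2 pi i later on. *)
Definition hdiff (al be : C) (H : R -> R -> C) := forall x0 y0, exists g : C,
  forall e, 0 < e -> exists2 d, 0 < d & forall x y, `|x - x0| < d -> `|y - y0| < d ->
  nm (H x y - H x0 y0 - g * (al * (x - x0)%:C + be * (y - y0)%:C))
    <= e * (`|x - x0| + `|y - y0|).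

Variables (al be : C) (H : R -> R -> C).
Hypothesis Hd : hdiff al be H.

Lemma hdiff_contl x : cont (H x).
Proof.
move=> y0 e e0; have [g Hg] := Hd x y0; have [d d0 {}Hg] := Hg 1 ltr01.
pose K := nm (g * be) + 1.
have K0 : 0 < K by have := nm_ge0 (g * be); rewrite /K; lra.
exists (Num.min d (e / K)); first by rewrite lt_min d0 divr_gt0.
move=> y; rewrite lt_min => /andP [yd ye].
have := Hg x y; rewrite subrr normr0 => /(_ d0 yd).
rewrite (_ : (0 : R)%:C = 0) // mulr0 !add0r mul1r => h.
have -> : H x y - H x y0 = (H x y - H x y0 - g * (be * (y - y0)%:C)) + g * be * (y - y0)%:C.
  by ring.
apply: le_trans (nmD _ _) _; rewrite nmM nm_real.
apply: (@le_trans _ _ (K * `|y - y0|)); first by rewrite /K; lra.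
by rewrite mulrC -ler_pdivlMr // ltW.
Qed.

Lemma hdiff_contr y : cont (H ^~ y).
Proof.
move=> x0 e e0; have [g Hg] := Hd x0 y; have [d d0 {}Hg] := Hg 1 ltr01.
pose K := nm (g * al) + 1.
have K0 : 0 < K by have := nm_ge0 (g * al); rewrite /K; lra.
exists (Num.min d (e / K)); first by rewrite lt_min d0 divr_gt0.
move=> x; rewrite lt_min => /andP [yd ye].
have := Hg x y; rewrite subrr normr0 => /(_ yd d0).
rewrite (_ : (0 : R)%:C = 0) // mulr0 !addr0 mul1r => h.
have -> : H x y - H x0 y = (H x y - H x0 y - g * (al * (x - x0)%:C)) + g * al * (x - x0)%:C.
  by ring.
apply: le_trans (nmD _ _) _; rewrite nmM nm_real.
apply: (@le_trans _ _ (K * `|x - x0|)); first by rewrite /K; lra.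
by rewrite mulrC -ler_pdivlMr // ltW.
Qed.

(** The integral of H (al dx + be dy) around the boundary of [a, b] x [c, d], counterclockwise. *)
Definition recI a b c d : C :=
  be * (Jc (H b) c d - Jc (H a) c d) - al * (Jc (H ^~ d) a b - Jc (H ^~ c) a b).

Lemma recI_add4 a m b c n d : a <= m -> m <= b -> c <= n -> n <= d ->
  recI a b c d = recI a m c n + recI m b c n + recI a m n d + recI m b n d.
Proof.
move=> am mb cn nd; rewrite /recI.
rewrite !(Jc_add (hdiff_contl _) cn nd) !(Jc_add (hdiff_contr _) am mb).
by ring.
Qed.

(** The affine part of H at (x0, y0) contributes g al be (b - a)(d - c) once with each sign. Only
    the remainder is left; it is small compared with the sides and is integrated over a boundary of
    comparable length. *)
Lemma recI_local x0 y0 e : 0 < e -> exists2 dl, 0 < dl & forall a b c d,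
  a <= x0 <= b -> c <= y0 <= d -> b - a < dl -> d - c < dl ->
  nm (recI a b c d) <= e * ((b - a) + (d - c)) ^+ 2.
Proof.
move=> e0; have [g Hg] := Hd x0 y0.
(* A difference of opposite sides contains two remainders and [Jc_bound] costs another factor 2,
   hence the 4; the summand 1 keeps [K] positive. *)
pose K := (nm al + nm be + 1) * 4.
have K0 : 0 < K by rewrite /K; have := nm_ge0 al; have := nm_ge0 be; lra.
have [dl dl0 {}Hg] := Hg (e / K) (divr_gt0 e0 K0).
exists dl => // a b c d /andP [ax xb] /andP [cy yd] bad dcd.
set s := (b - a) + (d - c).
have s0 : 0 <= s by rewrite /s; lra.
have ab : a <= b by lra.
have cd : c <= d by lra.
have Hg' x y : a <= x <= b -> c <= y <= d ->
    nm (H x y - H x0 y0 - g * (al * (x - x0)%:C + be * (y - y0)%:C)) <= e / K * s.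
  move=> /andP [h1 h2] /andP [h3 h4].
  have hx : `|x - x0| <= b - a by rewrite ler_norml; apply/andP; split; lra.
  have hy : `|y - y0| <= d - c by rewrite ler_norml; apply/andP; split; lra.
  apply: le_trans (Hg x y (le_lt_trans hx bad) (le_lt_trans hy dcd)) _.
  apply: ler_wpM2l; first by apply: divr_ge0; apply: ltW.
  by rewrite /s lerD.
have E1 : Jc (H b) c d - Jc (H a) c d =
    Jc (fun y => (H b y - H a y) - g * al * (b - a)%:C) c d + g * al * (b - a)%:C * (d - c)%:C.
  rewrite (Jc_B _ _ (contB (hdiff_contl b) (hdiff_contl a)) (cont_cst _)) Jc_B ?Jc_cst //;
    try exact: hdiff_contl.
  by ring.
have E2 : Jc (H ^~ d) a b - Jc (H ^~ c) a b =
    Jc (fun x => (H x d - H x c) - g * be * (d - c)%:C) a b + g * be * (d - c)%:C * (b - a)%:C.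
  rewrite (Jc_B _ _ (contB (hdiff_contr d) (hdiff_contr c)) (cont_cst _)) Jc_B ?Jc_cst //;
    try exact: hdiff_contr.
  by ring.
have -> : recI a b c d = be * Jc (fun y => (H b y - H a y) - g * al * (b - a)%:C) c d
   - al * Jc (fun x => (H x d - H x c) - g * be * (d - c)%:C) a b.
  by rewrite /recI E1 E2; ring.
have B1 : nm (Jc (fun y => (H b y - H a y) - g * al * (b - a)%:C) c d) <=
    (e / K * s *+ 2) * (d - c) *+ 2.
  apply: Jc_bound => //; first exact: (contB (contB (hdiff_contl b) (hdiff_contl a)) (cont_cst _)).
  move=> y hy; have h1 := Hg' b y; have h2 := Hg' a y.
  have -> : H b y - H a y - g * al * (b - a)%:C =
     (H b y - H x0 y0 - g * (al * (b - x0)%:C + be * (y - y0)%:C))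
     - (H a y - H x0 y0 - g * (al * (a - x0)%:C + be * (y - y0)%:C)).
    by rewrite !rmorphB /=; ring.
  apply: le_trans (nmB _ _) _; rewrite mulr2n lerD //; [apply: h1|apply: h2] => //;
  by apply/andP; split; lra.
have B2 : nm (Jc (fun x => (H x d - H x c) - g * be * (d - c)%:C) a b) <=
    (e / K * s *+ 2) * (b - a) *+ 2.
  apply: Jc_bound => //; first exact: (contB (contB (hdiff_contr d) (hdiff_contr c)) (cont_cst _)).
  move=> x hx; have h1 := Hg' x d; have h2 := Hg' x c.
  have -> : H x d - H x c - g * be * (d - c)%:C =
     (H x d - H x0 y0 - g * (al * (x - x0)%:C + be * (d - y0)%:C))
     - (H x c - H x0 y0 - g * (al * (x - x0)%:C + be * (c - y0)%:C)).
    by rewrite !rmorphB /=; ring.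
  apply: le_trans (nmB _ _) _; rewrite mulr2n lerD //; [apply: h1|apply: h2] => //;
  by apply/andP; split; lra.
apply: le_trans (nmB _ _) _; rewrite !nmM.
apply: (@le_trans _ _ (nm be * (e / K * s *+ 2 * (d - c) *+ 2) +
                       nm al * (e / K * s *+ 2 * (b - a) *+ 2))).
  by apply: lerD; apply: ler_wpM2l => //; exact: nm_ge0.
have eK : e = e / K * ((nm al + nm be + 1) * 4) by rewrite -/K mulfVK ?gt_eqF.
have t0 : 0 <= e / K by apply: divr_ge0; apply: ltW.
rewrite [X in _ <= X * _]eK; move: t0; set t := e / K => t0.
have := nm_ge0 al; have := nm_ge0 be; set p := nm be; set q := nm al => p0 q0.
rewrite (_ : _ + _ = t * (s * ((p * (d - c) + q * (b - a)) * 4))); last by ring.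
rewrite (_ : _ * s ^+ 2 = t * (s * ((q + p + 1) * 4 * s))); last by ring.
apply: ler_wpM2l => //; apply: ler_wpM2l => //.
have u0 : 0 <= b - a by rewrite subr_ge0.
have v0 : 0 <= d - c by rewrite subr_ge0.
have := mulr_ge0 q0 v0; have := mulr_ge0 p0 u0; rewrite /s; clear -u0 v0; lra.
Qed.

(** By additivity one of the four quarters carries at least a quarter of the integral. It is
    recorded by its lower left corner [p], since its sides are known. *)
Lemma recI_bisect a c w h : 0 <= w -> 0 <= h -> exists p : R * R,
  [/\ a <= p.1 <= a + w / 2, c <= p.2 <= c + h / 2 &
   nm (recI a (a + w) c (c + h)) / 4 <= nm (recI p.1 (p.1 + w / 2) p.2 (p.2 + h / 2))].
Proof.
move=> w0 h0; pose w' := w / 2; pose h' := h / 2.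
have w'0 : 0 <= w' by rewrite divr_ge0.
have h'0 : 0 <= h' by rewrite divr_ge0.
have wE : w = w' + w' by rewrite /w'; lra.
have hE : h = h' + h' by rewrite /h'; lra.
have a1 : a <= a + w' by rewrite lerDl.
have a2 : a + w' <= a + w by rewrite wE lerD2l lerDl.
have c1 : c <= c + h' by rewrite lerDl.
have c2 : c + h' <= c + h by rewrite hE lerD2l lerDl.
apply: contrapT => nex.
have key a' c' : a <= a' <= a + w' -> c <= c' <= c + h' ->
    nm (recI a' (a' + w') c' (c' + h')) < nm (recI a (a + w) c (c + h)) / 4.
  move=> ha hc; rewrite ltNge; apply/negP => hh; apply: nex.
  by exists (a', c').
have ka : a <= a <= a + w' by rewrite lexx.
have ka' : a <= a + w' <= a + w' by rewrite lexx a1.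
have kc : c <= c <= c + h' by rewrite lexx.
have kc' : c <= c + h' <= c + h' by rewrite lexx c1.
have k1 := key _ _ ka kc; have k2 := key _ _ ka' kc.
have k3 := key _ _ ka kc'; have k4 := key _ _ ka' kc'.
rewrite -!addrA -wE -hE in k1 k2 k3 k4.
have tr : nm (recI a (a + w) c (c + h)) <=
   nm (recI a (a + w') c (c + h')) + nm (recI (a + w') (a + w) c (c + h')) +
   nm (recI a (a + w') (c + h') (c + h)) + nm (recI (a + w') (a + w) (c + h') (c + h)).
  rewrite (recI_add4 a1 a2 c1 c2).
  apply: le_trans (nmD _ _) _; rewrite lerD2r.
  apply: le_trans (nmD _ _) _; rewrite lerD2r.
  exact: nmD.
apply/negP: tr; rewrite -ltNge.
have E4 (t : R) : t = t / 4 + t / 4 + t / 4 + t / 4 by field.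
rewrite [ltRHS]E4.
by rewrite !ltrD.
Qed.

(** The left end points increase and stay below every right end point, so their supremum lies in all
    the intervals. *)
Lemma nested_point (u : nat -> R) w : 0 <= w ->
  (forall k, u k <= u k.+1 <= u k + w / 2 ^+ k / 2) ->
  exists x, forall k, u k <= x <= u k + w / 2 ^+ k.
Proof.
move=> w0 Hu.
have up k j : u k <= u (k + j)%N /\ u (k + j)%N + w / 2 ^+ (k + j)%N <= u k + w / 2 ^+ k.
  elim: j => [|j [IH1 IH2]]; first by rewrite addn0.
  have /andP [h1 h2] := Hu (k + j)%N; rewrite addnS exprSr invfM mulrA.
  by split; lra.
have pw k : 0 <= w / 2 ^+ k by rewrite divr_ge0 ?exprn_ge0.
pose S := [set x : R | exists k, x = u k]%classic.
have ub k : ubound S (u k + w / 2 ^+ k).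
  move=> x [j ->]; have [jk|kj] := leqP j k.
    have [h _] := up j (k - j)%N; rewrite subnKC // in h.
    by have := pw k; lra.
  have [_ h] := up k (j - k)%N; rewrite subnKC ?(ltnW kj) // in h.
  by have := pw j; lra.
have hs : has_sup S by split; [exists (u 0%N), 0%N | exists (u 0%N + w / 2 ^+ 0)].
exists (sup S) => k; apply/andP; split.
  by apply: sup_ubound; [case: hs | exists k].
by apply: ge_sup; [case: hs|].
Qed.

Theorem goursat a b c d : a <= b -> c <= d -> recI a b c d = 0.
Proof.
move=> ab cd; pose w := b - a; pose h := d - c.
have w0 : 0 <= w by rewrite /w; lra.
have h0 : 0 <= h by rewrite /h; lra.
pose rel (k : nat) (p q : R * R) :=
  [/\ p.1 <= q.1 <= p.1 + w / 2 ^+ k / 2, p.2 <= q.2 <= p.2 + h / 2 ^+ k / 2 &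
   nm (recI p.1 (p.1 + w / 2 ^+ k) p.2 (p.2 + h / 2 ^+ k)) / 4
   <= nm (recI q.1 (q.1 + w / 2 ^+ k.+1) q.2 (q.2 + h / 2 ^+ k.+1))].
have ex k p : exists q, rel k p q.
  have [//|//|q [h1 h2 h3]] := @recI_bisect p.1 p.2 (w / 2 ^+ k) (h / 2 ^+ k).
  - by rewrite divr_ge0 // exprn_ge0.
  - by rewrite divr_ge0 // exprn_ge0.
  by exists q; split=> //; rewrite !exprSr !invfM !mulrA.
pose nxt k p := sval (cid (ex k p)).
pose sq := fix sq k := if k is k'.+1 then nxt k' (sq k') else (a, c).
have sqP k : rel k (sq k) (sq k.+1) by rewrite /= /nxt; case: cid.
have [x0 Hx] : exists x, forall k, (sq k).1 <= x <= (sq k).1 + w / 2 ^+ k.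
  by apply: nested_point => // k; case: (sqP k).
have [y0 Hy] : exists x, forall k, (sq k).2 <= x <= (sq k).2 + h / 2 ^+ k.
  by apply: nested_point => // k; case: (sqP k).
have low k : nm (recI a b c d) / 4 ^+ k <=
    nm (recI (sq k).1 ((sq k).1 + w / 2 ^+ k) (sq k).2 ((sq k).2 + h / 2 ^+ k)).
  elim: k => [|k IH].
    by rewrite !expr0 !divr1 /w /h /= !(addrC _ (_ - _)) !subrK.
  have [_ _] := sqP k; apply: le_trans.
  by rewrite exprSr invfM mulrA ler_pM2r ?invr_gt0.
apply: nm_le_eps0 => e e0.
(* The summand 1 keeps the denominator positive when the rectangle is degenerate. *)
pose s := w + h + 1.
have s0 : 0 < s by rewrite /s; lra.
have es0 : 0 < e / s ^+ 2 by rewrite divr_gt0 // exprn_gt0.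
have [dl dl0 Hdl] := recI_local x0 y0 es0.
have [k Hk] : exists k, s / 2 ^+ k < dl.
  pose k := Num.truncn (s / dl); exists k.
  have hk : s / dl < 2 ^+ k.
    apply: lt_le_trans (_ : k.+1%:R <= _).
      by have /andP [] := @truncn_itv R (s / dl) (divr_ge0 (ltW s0) (ltW dl0)).
    by rewrite -natrX ler_nat ltn_expl.
  by rewrite ltr_pdivrMr ?exprn_gt0 // mulrC -ltr_pdivrMr.
have p2 : 0 < 2 ^+ k :> R by rewrite exprn_gt0.
have := Hdl (sq k).1 ((sq k).1 + w / 2 ^+ k) (sq k).2 ((sq k).2 + h / 2 ^+ k) (Hx k) (Hy k).
have sw : w / 2 ^+ k <= s / 2 ^+ k by rewrite ler_pM2r ?invr_gt0 // /s; lra.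
have sh : h / 2 ^+ k <= s / 2 ^+ k by rewrite ler_pM2r ?invr_gt0 // /s; lra.
have E (p q : R) : p + q - p = q by ring.
rewrite !E => /(_ (le_lt_trans sw Hk) (le_lt_trans sh Hk)) H1.
(* The local bound is quadratic in the sides and so contributes 4^-k, which compensates the 4^k lost
   by k bisections. *)
have := le_trans (low k) H1; rewrite ler_pdivrMr ?exprn_gt0 // => /le_trans; apply.
have -> : (4 ^+ k : R) = (2 ^+ k) ^+ 2 by rewrite exprAC; congr (_ ^+ k); rewrite -natrX.
have -> : e / s ^+ 2 * (w / 2 ^+ k + h / 2 ^+ k) ^+ 2 * (2 ^+ k) ^+ 2 =
    e * ((w + h) / s) ^+ 2.
  by move: p2 s0; clear; move: (2 ^+ k) => q q0 s0; field; rewrite !gt_eqF.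
rewrite -[leRHS]mulr1; apply: ler_wpM2l; first exact: ltW.
have wh : 0 <= (w + h) / s by apply: divr_ge0; [apply: addr_ge0|apply: ltW].
apply: exprn_ile1 => //.
by rewrite ler_pdivrMr // mul1r /s lerDl.
Qed.

End Goursat.

(** * Complex derivatives in one variable *)

Section OneVariable.
Variable R : realType.
Local Notation C := (R[i]).
Implicit Types (z w k : C) (f g h : C -> C).

Definition ct0 (ph : C -> C) := forall e : R, 0 < e -> exists2 d : R, 0 < d &
  forall k, nm k < d -> nm (ph k - ph 0) <= e.

(** Caratheodory's form of differentiability: the difference quotient extends continuously to
    increment 0. Product, quotient and chain rule become algebra on [ph], without remainder
    terms. *)
Definition d1 h z := exists2 ph, ct0 ph & exists2 d : R, 0 < d &
  forall k, nm k < d -> h (z + k) - h z = ph k * k.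

Lemma ct0_cst c : ct0 (fun _ => c).
Proof. by move=> e e0; exists 1 => // k _; rewrite subrr nm0 ltW. Qed.

Lemma ct0_id : ct0 id.
Proof. by move=> e e0; exists e => // k ke; rewrite subr0 ltW. Qed.

Lemma ct0_near ph ps : ct0 ph ->
  (exists2 d : R, 0 < d & forall k, nm k < d -> ph k = ps k) -> ct0 ps.
Proof.
move=> H [d d0 Hd] e e0; have [d' d'0 Hd'] := H e e0.
exists (Num.min d d'); first by rewrite lt_min d0.
move=> k; rewrite lt_min => /andP [h1 h2]; rewrite -!Hd ?nm0 //; exact: Hd'.
Qed.

Lemma ct0_bd ph : ct0 ph -> exists2 K : R, 0 < K &
  exists2 d : R, 0 < d & forall k, nm k < d -> nm (ph k) <= K.
Proof.
move=> H; have [d d0 Hd] := H 1 ltr01; exists (nm (ph 0) + 1).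
  by rewrite ltr_wpDl ?nm_ge0.
exists d => // k /Hd h; rewrite -(subrK (ph 0) (ph k)) addrC.
by apply: le_trans (nmD _ _) _; rewrite lerD2l.
Qed.

Lemma ct0D ph ps : ct0 ph -> ct0 ps -> ct0 (fun k => ph k + ps k).
Proof.
move=> H1 H2 e e0; have e2 : 0 < e / 2 by rewrite divr_gt0.
have [d d0 Hd] := H1 _ e2; have [d' d'0 Hd'] := H2 _ e2.
exists (Num.min d d'); first by rewrite lt_min d0.
move=> k; rewrite lt_min => /andP [/Hd h1 /Hd' h2].
by rewrite opprD addrACA (splitr e); apply: le_trans (nmD _ _) (lerD h1 h2).
Qed.

Lemma ct0M ph ps : ct0 ph -> ct0 ps -> ct0 (fun k => ph k * ps k).
Proof.
move=> H1 H2 e e0; have [K K0 [dK dK0 HK]] := ct0_bd H1.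
pose L := nm (ps 0) + 1; have L0 : 0 < L by rewrite ltr_wpDl ?nm_ge0.
have e1 : 0 < e / 2 / L by rewrite !divr_gt0.
have e2 : 0 < e / 2 / K by rewrite !divr_gt0.
have [d d0 Hd] := H1 _ e1; have [d' d'0 Hd'] := H2 _ e2.
exists (Num.min dK (Num.min d d')); first by rewrite !lt_min dK0 d0.
move=> k; rewrite !lt_min => /and3P [/HK hK /Hd h1 /Hd' h2].
have -> : ph k * ps k - ph 0 * ps 0 = ph k * (ps k - ps 0) + (ph k - ph 0) * ps 0 by ring.
rewrite (splitr e); apply: le_trans (nmD _ _) _; rewrite !nmM; apply: lerD.
  have -> : e / 2 = K * (e / 2 / K) by rewrite [RHS]mulrC mulfVK ?gt_eqF.
  by apply: ler_pM; rewrite ?nm_ge0.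
have -> : e / 2 = e / 2 / L * L by rewrite mulfVK ?gt_eqF.
by apply: ler_pM; rewrite ?nm_ge0 // /L lerDl.
Qed.

Lemma ct0_comp ph ps : ct0 ph -> ct0 ps -> ps 0 = 0 -> ct0 (fun k => ph (ps k)).
Proof.
move=> H1 H2 ps0 e e0; have [d d0 Hd] := H1 e e0.
have d2 : 0 < d / 2 by rewrite divr_gt0.
have [d' d'0 Hd'] := H2 _ d2; exists d' => // k /Hd'; rewrite ps0 subr0 => h.
by apply: Hd; apply: le_lt_trans h _; rewrite ltr_pdivrMr // ltr_pMr // ltr1n.
Qed.

Lemma ct0V ph : ct0 ph -> ph 0 != 0 -> ct0 (fun k => (ph k)^-1).
Proof.
move=> H p0 e e0; pose m := nm (ph 0).
have m0 : 0 < m by rewrite nm_gt0.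
have m2 : 0 < m / 2 by rewrite divr_gt0.
have e1 : 0 < e * (m * (m / 2)) by rewrite !mulr_gt0.
have [d d0 Hd] := H _ m2; have [d' d'0 Hd'] := H _ e1.
exists (Num.min d d'); first by rewrite lt_min d0.
move=> k; rewrite lt_min => /andP [/Hd h1 /Hd' h2].
have pk : m / 2 <= nm (ph k).
  have := nmD (ph k) (ph 0 - ph k); rewrite addrC subrK -/m nm_sym.
  by move: h1; rewrite {2}(splitr m); clear; lra.
have pk0 : ph k != 0 by rewrite -nm_gt0; apply: lt_le_trans pk.
have -> : (ph k)^-1 - (ph 0)^-1 = (ph 0 - ph k) / (ph 0 * ph k).
  by field; rewrite p0 pk0.
rewrite nmM nmV nmM nm_sym ler_pdivrMr ?mulr_gt0 ?nm_gt0 //.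
apply: le_trans h2 _; apply: ler_wpM2l; first exact: ltW.
by apply: ler_wpM2l => //; exact: ltW.
Qed.

Lemma d1_ct h z : d1 h z -> ct0 (fun k => h (z + k)).
Proof.
move=> [ph Hp [d d0 Hd]].
apply: (@ct0_near (fun k => h z + ph k * k)).
  exact: ct0D (ct0_cst _) (ct0M Hp ct0_id).
by exists d => // k /Hd <-; rewrite addrC subrK.
Qed.

(** The bridge to linear approximation: Goursat's theorem and derivatives in several variables are
    phrased with remainders, the calculus rules with difference quotients. *)
Lemma d1_eps h z : d1 h z <-> exists c, forall e : R, 0 < e -> exists2 d : R, 0 < d &
  forall k, nm k < d -> nm (h (z + k) - h z - c * k) <= e * nm k.
Proof.
split=> [[ph Hp [d d0 Hd]]|[c Hc]].
  exists (ph 0) => e e0; have [d' d'0 Hd'] := Hp e e0.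
  exists (Num.min d d'); first by rewrite lt_min d0.
  move=> k; rewrite lt_min => /andP [/Hd -> /Hd' h2].
  by rewrite -mulrBl nmM ler_wpM2r ?nm_ge0.
exists (fun k => if k == 0 then c else (h (z + k) - h z) / k).
  move=> e e0; have [d d0 Hd] := Hc e e0; exists d => // k kd; rewrite eqxx.
  case: eqP => [_|/eqP k0]; first by rewrite subrr nm0 ltW.
  rewrite -(ler_pM2r (_ : 0 < nm k)) ?nm_gt0 // -nmM mulrBl mulfVK //.
  exact: Hd.
exists 1 => // k _; case: eqP => [->|/eqP k0]; last by rewrite mulfVK.
by rewrite mulr0 addr0 subrr.
Qed.

Lemma d1_near h g z : d1 h z ->
  (exists2 d : R, 0 < d & forall k, nm k < d -> h (z + k) = g (z + k)) -> d1 g z.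
Proof.
move=> [ph Hp [d d0 Hd]] [d' d'0 Hd']; exists ph => //.
exists (Num.min d d'); first by rewrite lt_min d0.
move=> k; rewrite lt_min => /andP [h1 h2]; rewrite -Hd' // -Hd //.
by have := Hd' 0; rewrite nm0 addr0 => ->.
Qed.

Lemma d1_cst c z : d1 (fun _ => c) z.
Proof.
by exists (fun _ => 0); [exact: ct0_cst|exists 1 => // k _; rewrite subrr mul0r].
Qed.

Lemma d1_id z : d1 id z.
Proof.
exists (fun _ => 1); first exact: ct0_cst.
by exists 1 => // k _; rewrite addrC addKr mul1r.
Qed.

Lemma d1D h g z : d1 h z -> d1 g z -> d1 (fun w => h w + g w) z.
Proof.
move=> [ph Hp [d d0 Hd]] [ps Hs [d' d'0 Hd']].
exists (fun k => ph k + ps k); first exact: ct0D.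
exists (Num.min d d'); first by rewrite lt_min d0.
move=> k; rewrite lt_min => /andP [/Hd h1 /Hd' h2].
by rewrite mulrDl -h1 -h2; ring.
Qed.

Lemma d1M h g z : d1 h z -> d1 g z -> d1 (fun w => h w * g w) z.
Proof.
move=> dh dg; have cg := d1_ct dg.
move: dh dg => [ph Hp [d d0 Hd]] [ps Hs [d' d'0 Hd']].
exists (fun k => ph k * g (z + k) + h z * ps k).
  by apply: ct0D; apply: ct0M => //; exact: ct0_cst.
exists (Num.min d d'); first by rewrite lt_min d0.
move=> k; rewrite lt_min => /andP [/Hd h1 /Hd' h2].
have -> : (ph k * g (z + k) + h z * ps k) * k = ph k * k * g (z + k) + h z * (ps k * k) by ring.
by rewrite -h1 -h2; ring.
Qed.

Lemma d1N h z : d1 h z -> d1 (fun w => - h w) z.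
Proof.
move=> dh; apply: (@d1_near (fun w => -1 * h w)); first exact: d1M (d1_cst _ _) dh.
by exists 1 => // k _; rewrite mulN1r.
Qed.

Lemma d1B h g z : d1 h z -> d1 g z -> d1 (fun w => h w - g w) z.
Proof. by move=> dh dg; apply: d1D => //; apply: d1N. Qed.

Lemma d1_sum (I : Type) (s : seq I) (P : pred I) (F : I -> C -> C) z :
  (forall i, P i -> d1 (F i) z) -> d1 (fun w => \sum_(i <- s | P i) F i w) z.
Proof.
move=> H; elim: s => [|i s IH].
  apply: (d1_near (d1_cst 0 z)); by exists 1 => // k _; rewrite big_nil.
case Pi: (P i); last first.
  by apply: (d1_near IH); exists 1 => // k _; rewrite big_cons Pi.
apply: (d1_near (d1D (H i Pi) IH)); by exists 1 => // k _; rewrite big_cons Pi.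
Qed.

Lemma d1X h n z : d1 h z -> d1 (fun w => h w ^+ n) z.
Proof.
move=> dh; elim: n => [|n IH]; first exact: d1_cst.
by apply: (d1_near (d1M dh IH)); exists 1 => // k _; rewrite exprS.
Qed.

Lemma d1_comp h g z : d1 g z -> d1 h (g z) -> d1 (fun w => h (g w)) z.
Proof.
move=> [ps Hs [d' d'0 Hd']] [ph Hp [d d0 Hd]].
have Hc : ct0 (fun k => ps k * k) := ct0M Hs ct0_id.
exists (fun k => ph (ps k * k) * ps k).
  by apply: ct0M => //; apply: (ct0_comp Hp Hc); rewrite mulr0.
have [d2 d20 Hd2] := Hc (d / 2) (divr_gt0 d0 (ltr0Sn _ _)).
exists (Num.min d' d2); first by rewrite lt_min d'0.
move=> k; rewrite lt_min => /andP [/Hd' h1 /Hd2]; rewrite mulr0 subr0 => h2.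
rewrite -mulrA -Hd; last first.
  by apply: le_lt_trans h2 _; rewrite ltr_pdivrMr // ltr_pMr // ltr1n.
by rewrite -h1 [g z + _]addrC subrK.
Qed.

Lemma d1V h z : d1 h z -> h z != 0 -> d1 (fun w => (h w)^-1) z.
Proof.
move=> dh hz; apply: (@d1_comp GRing.inv h z dh); move: (h z) hz => w w0.
exists (fun k => - (w * (w + k))^-1).
  apply: (@ct0_near (fun k => -1 * (w * (w + k))^-1)); last first.
    by exists 1 => // k _; rewrite mulN1r.
  apply: ct0M (ct0_cst _) _; apply: ct0V; last by rewrite addr0 mulf_neq0.
  exact: ct0M (ct0_cst _) (ct0D (ct0_cst _) ct0_id).
exists (nm w); first by rewrite nm_gt0.
move=> k kw; have wk : w + k != 0.
  by apply: contraTneq kw => /eqP; rewrite addr_eq0 => /eqP ->; rewrite nmN ltxx.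
by field; rewrite w0 wk.
Qed.

Lemma d1_hdiff (al be w0 : C) h : (forall z, d1 h z) ->
  hdiff al be (fun x y => h (w0 + (al * x%:C + be * y%:C))).
Proof.
move=> dh x0 y0; have /d1_eps [c Hc] := dh (w0 + (al * x0%:C + be * y0%:C)).
exists c => e e0; pose K := nm al + nm be + 1.
have K0 : 0 < K by rewrite ltr_wpDl // addr_ge0 ?nm_ge0.
have [d d0 Hd] := Hc (e / K) (divr_gt0 e0 K0).
have dK : 0 < d / (K + K) by rewrite divr_gt0 // addr_gt0.
exists (d / (K + K)) => // x y hx hy.
set k := al * (x - x0)%:C + be * (y - y0)%:C.
have nk : nm k <= K * (`|x - x0| + `|y - y0|).
  apply: le_trans (nmD _ _) _; rewrite !nmM !nm_real mulrDr.
  by apply: lerD; apply: ler_wpM2r => //; rewrite /K -addrA ?lerDl ?addr_ge0 ?nm_ge0 //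
     addrCA lerDl addr_ge0 ?nm_ge0.
have kd : nm k < d.
  apply: le_lt_trans nk _; rewrite mulrC -ltr_pdivlMr //.
  have -> : d / K = d / (K + K) + d / (K + K).
    by move: K0; clear; move: K => K K0; field; rewrite -mulr2n mulrn_eq0 /= !gt_eqF.
  exact: ltrD.
have := Hd k kd.
rewrite (_ : _ + k = w0 + (al * x%:C + be * y%:C)); last by rewrite /k !rmorphB /=; ring.
move/le_trans; apply; rewrite -mulrA; apply: ler_wpM2l; first exact: ltW.
by rewrite ler_pdivrMl.
Qed.

End OneVariable.

(** * Circle averages and the maximum principle *)

Section Circle.
Variable R : realType.
Local Notation C := (R[i]).
Implicit Types (z w k : C) (f g h : C -> C).

Lemma derive_eps0 (f : R -> R) (df : R) : is_derive (0 : R) 1 f df ->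
  forall e, 0 < e -> exists2 d, 0 < d &
    forall x, `|x| < d -> `|f x - f 0 - df * x| <= e * `|x|.
Proof.
move=> [dv dE] e e0.
have := dv; rewrite /derivable => /cvg_ex [l Hl].
have ldf : l = df by rewrite -dE; apply/esym/cvg_lim.
move/cvgrPdist_le : Hl => /(_ e e0) /nbhs_ballP [d /= d0 Hd].
exists d => // x xd; have [->|x0] := eqVneq x 0.
  by rewrite subrr mulr0 subrr normr0 mulr0.
have := Hd x; rewrite /ball /= sub0r normrN => /(_ xd x0).
rewrite addr0 ldf /GRing.scale /= mulr1 => h.
have -> : f x - f 0 - df * x = - ((df - x^-1 * (f x - f 0)) * x) by field.
by rewrite normrN normrM ler_wpM2r.
Qed.

Definition cexp z : C :=
  (expR (complex.Re z))%:C * (cos (complex.Im z) +i* sin (complex.Im z)).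

Lemma cexpD z w : cexp (z + w) = cexp z * cexp w.
Proof.
case: z => a b; case: w => c d; rewrite /cexp /= expRD cosD sinD.
by apply/eqP; rewrite eq_complex /=; apply/andP; split; apply/eqP; ring.
Qed.

Lemma cexp0 : cexp 0 = 1.
Proof. by rewrite /cexp /= expR0 cos0 sin0 mul1r. Qed.

Lemma nm_cexp z : nm (cexp z) = expR (complex.Re z).
Proof.
rewrite /cexp nmM nm_real ger0_norm ?expR_ge0 // /nm normc_def /=.
by rewrite cos2Dsin2 sqrtr1 mulr1.
Qed.

Lemma cexp_neq0 z : cexp z != 0.
Proof. by rewrite -nm_gt0 nm_cexp expR_gt0. Qed.

(** For k = x + iy the errors of exp at x and of cos, sin at y are at most e1 |k|. The radius bound
    e1 / 2 gives |x| <= 1/2, hence E <= 2, and |E - 1| <= 2 |k| <= e1 in the mixed term (E - 1) y.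
    Real and imaginary parts then cost 3 e1 |k| each, which e1 <= e / 8 accommodates. *)
Lemma cexp_lin0 e : 0 < e -> exists2 d, 0 < d &
  forall k, nm k < d -> nm (cexp k - 1 - k) <= e * nm k.
Proof.
move=> e0; pose e1 := Num.min 1 (e / 8).
have e10 : 0 < e1 by rewrite lt_min ltr01 divr_gt0.
have e11 : e1 <= 1 by rewrite ge_min lexx.
have e18 : e1 <= e / 8 by rewrite ge_min lexx orbT.
have [d1 d10 H1] := derive_eps0 (is_derive_expR 0) e10.
have [d2 d20 H2] := derive_eps0 (is_derive_cos 0) e10.
have [d3 d30 H3] := derive_eps0 (is_derive_sin 0) e10.
exists (Num.min (Num.min d1 d2) (Num.min d3 (e1 / 2))); first by rewrite !lt_min d10 d20 d30 divr_gt0.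
move=> k; have := nm_Re k; have := nm_Im k.
move: (nm_ge0 k) (nm_le_ReIm (cexp k - 1 - k)); move: (nm k) => N N0.
case: k => x y /=; rewrite !lt_min => hk hy hx /andP [/andP [n1 n2] /andP [n3 n4]].
have := H1 x (le_lt_trans hx n1); have := H2 y (le_lt_trans hy n2).
have := H3 y (le_lt_trans hy n3).
rewrite expR0 cos0 sin0 oppr0 !mul0r !subr0 ?addr0 !mul1r => hs hc hE.
apply: le_trans hk _; rewrite /= !(mul0r, oppr0, subr0, addr0, add0r).
set E := expR x in hE *; set c := cos y in hc *; set s := sin y in hs *.
have xN : `|x| <= 1 / 2 by apply: le_trans hx _; apply: le_trans (ltW n4) _; clear -e11; lra.
have eN p : 0 <= p -> e1 * p <= p by move=> p0; rewrite ler_piMl.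
have E1 : `|E - 1| <= 2 * N.
  have -> : E - 1 = (E - 1 - x) + x by ring.
  apply: le_trans (ler_normD _ _) _; rewrite mulr_natl mulr2n; apply: lerD => //.
  by apply: le_trans hE _; apply: le_trans hx; exact: eN.
have E2 : `|E| <= 2.
  have -> : E = (E - 1) + 1 by ring.
  apply: le_trans (ler_normD _ _) _; rewrite normr1; clear -E1 n4 e11; lra.
have A1 : `|E * c - 1 - x| <= 3 * (e1 * N).
  have -> : E * c - 1 - x = (E - 1 - x) + E * (c - 1) by ring.
  apply: le_trans (ler_normD _ _) _; rewrite normrM.
  have t1 : e1 * `|x| <= e1 * N by apply: ler_wpM2l => //; exact: ltW.
  have t2 : `|E| * `|c - 1| <= 2 * (e1 * N).
    apply: ler_pM => //; apply: le_trans hc _; apply: ler_wpM2l => //; exact: ltW.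
  by clear -hE t1 t2; lra.
have A2 : `|E * s - y| <= 3 * (e1 * N).
  have -> : E * s - y = E * (s - y) + (E - 1) * y by ring.
  apply: le_trans (ler_normD _ _) _; rewrite !normrM.
  have t2 : `|E| * `|s - y| <= 2 * (e1 * N).
    apply: ler_pM => //. apply: le_trans hs _; apply: ler_wpM2l => //; exact: ltW.
  have t1 : `|E - 1| * `|y| <= e1 * N.
    apply: ler_pM => //; apply: le_trans E1 _; clear -n4; lra.
  by clear -t1 t2; lra.
have A3 : e1 * N <= e / 8 * N by apply: ler_wpM2r.
have A4 : 0 <= e / 8 * N by rewrite mulr_ge0 // divr_ge0 // ltW.
apply: le_trans (lerD A1 A2) _.
by clear -A3 A4; lra.
Qed.

Lemma d1_cexp z : d1 cexp z.
Proof.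
apply/d1_eps; exists (cexp z) => e e0.
have z0 : 0 < nm (cexp z) by rewrite nm_gt0 cexp_neq0.
have [d d0 Hd] := cexp_lin0 (divr_gt0 e0 z0).
exists d => // k /Hd; rewrite cexpD => h.
have -> : cexp z * cexp k - cexp z - cexp z * k = cexp z * (cexp k - 1 - k) by ring.
rewrite nmM; apply: le_trans (ler_wpM2l (ltW z0) h) _.
by rewrite mulrA [X in X * _]mulrC mulfVK ?gt_eqF.
Qed.

Definition ucirc (y : R) : C := cos y +i* sin y.

Lemma ucircE y : ucirc y = cexp ('i * y%:C).
Proof.
rewrite /ucirc /cexp -complexiE.
have -> : 'i%C * y%:C = 0 +i* y by apply/eqP; rewrite eq_complex /=; apply/andP; split; apply/eqP; ring.
by rewrite /= expR0 (_ : 1%:C = 1) // mul1r.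
Qed.

Lemma nm_ucirc y : nm (ucirc y) = 1.
Proof. by rewrite /nm normc_def /= cos2Dsin2 sqrtr1. Qed.

Lemma ucircD x y : ucirc (x + y) = ucirc x * ucirc y.
Proof. by rewrite !ucircE rmorphD /= mulrDr cexpD. Qed.

Lemma ucirc0 : ucirc 0 = 1.
Proof. by rewrite /ucirc cos0 sin0. Qed.

Lemma ucirc_2pi : ucirc (pi *+ 2) = 1.
Proof. by rewrite /ucirc cos2pi sin2pi. Qed.

Lemma ucirc_neq0 y : ucirc y != 0.
Proof. by rewrite -nm_gt0 nm_ucirc. Qed.

Lemma ucircX y n : ucirc y ^+ n = ucirc (y *+ n).
Proof.
by elim: n => [|n IH]; rewrite ?expr0 ?mulr0n ?ucirc0 // exprS IH -ucircD mulrS.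
Qed.

Lemma ucirc_surj t : nm t = 1 -> exists y, t = ucirc y.
Proof.
case: t => a b; rewrite /nm normc_def /= => h.
have ab : a ^+ 2 + b ^+ 2 = 1.
  by rewrite -[LHS]sqr_sqrtr ?h ?expr1n // addr_ge0 ?sqr_ge0.
have ha : -1 <= a <= 1.
  by rewrite -ler_norml -(@expr_le1 _ 2) ?normr_ge0 // real_normK ?num_real // -ab lerDl sqr_ge0.
have [b0|b0] := leP 0 b.
  exists (acos a); rewrite /ucirc acosK ?in_itv //= sin_acos // -ab addrAC subrr add0r.
  by rewrite sqrtr_sqr ger0_norm.
exists (- acos a); rewrite /ucirc cosN sinN acosK ?in_itv //= sin_acos // -ab addrAC subrr add0r.
by rewrite sqrtr_sqr ltr0_norm // opprK.
Qed.

Lemma clog_exists z : z != 0 -> exists m, cexp m = z.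
Proof.
move=> z0; have n0 : 0 < nm z by rewrite nm_gt0.
have nC : (nm z)%:C != 0 by rewrite -nm_gt0 nm_real normr_gt0 gt_eqF.
have [y hy] : exists y, z / (nm z)%:C = ucirc y.
  by apply: ucirc_surj; rewrite nmM nmV nm_real gtr0_norm // divff // gt_eqF.
exists ((ln (nm z))%:C + 'i * y%:C).
rewrite cexpD -ucircE -hy /cexp /= lnK ?posrE // cos0 sin0.
by rewrite mulr1 mulrC mulfVK.
Qed.

Lemma cont_ucirc F : (forall t, nm t = 1 -> ct0 (fun k => F (t + k))) ->
  cont (fun y => F (ucirc y)).
Proof.
move=> cF x e e0; have [d d0 Hd] := cF _ (nm_ucirc x) e e0.
have [d' d'0 Hd'] := d1_ct (d1_cexp ('i * x%:C)) (divr_gt0 d0 (ltr0Sn _ 1)).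
exists d' => // y hy.
have -> : F (ucirc y) = F (ucirc x + (ucirc y - ucirc x)) by congr F; rewrite addrC subrK.
rewrite -[X in _ - F X]addr0.
apply: Hd; apply: (@le_lt_trans _ _ (d / 2)); last by rewrite ltr_pdivrMr // ltr_pMr // ltr1n.
have := Hd' ('i * (y - x)%:C); rewrite nmM nm_real.
have -> : nm 'i = 1 :> R by rewrite /nm normCi.
by rewrite mul1r => /(_ hy); rewrite -mulrDr -rmorphD /= [x + _]addrC subrK addr0 -!ucircE.
Qed.

(** With exp m = lam, Goursat's theorem is applied to the composite of h with exp on the
    parallelogram spanned by m and 2 pi i. The sides parallel to m cancel by periodicity of exp, and
    the other two are the two circle integrals. Since [lam] is complex, a rotation of the starting
    point is included. *)
Theorem circle_indep h lam : (forall z, z != 0 -> d1 h z) -> lam != 0 ->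
  Jc (fun y => h (lam * ucirc y)) 0 (pi *+ 2) = Jc (fun y => h (ucirc y)) 0 (pi *+ 2).
Proof.
move=> dh l0; have [m hm] := clog_exists l0.
have dH z : d1 (fun w => h (cexp w)) z.
  by apply: d1_comp (d1_cexp z) _; apply: dh; exact: cexp_neq0.
have Hd := @d1_hdiff R m 'i 0 _ dH.
have := goursat Hd (ler01) (mulrn_wge0 2 (pi_ge0 R)).
rewrite /recI; set T := (X in _ - m * X).
have -> : T = 0.
  rewrite /T; apply/eqP; rewrite subr_eq0; apply/eqP; congr Jc; apply/funext => x.
  by rewrite !add0r !cexpD -!ucircE ucirc_2pi ucirc0.
rewrite mulr0 subr0 => /eqP; rewrite mulf_eq0 => /orP [/eqP i0|].
  by have := neq0Ci C; rewrite i0 eqxx.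
rewrite subr_eq0 => /eqP H.
transitivity (Jc ((fun x y : R => h (cexp (0 + (m * x%:C + 'i * y%:C)))) 1) 0 (pi *+ 2)).
  by congr Jc; apply/funext => y; rewrite add0r cexpD mulr1 hm ucircE.
by rewrite H; congr Jc; apply/funext => y; rewrite !add0r ucircE.
Qed.

Lemma cont_circ h z lam : (forall t, nm t = 1 -> d1 h (z + lam * t)) ->
  cont (fun y => h (z + lam * ucirc y)).
Proof.
move=> dh; apply: (@cont_ucirc (fun t => h (z + lam * t))) => t t1.
apply: (@d1_ct _ (fun w => h (z + lam * w))).
apply: (@d1_comp _ h (fun w => z + lam * w)); last exact: dh.
exact: d1D (d1_cst _ _) (d1M (d1_cst _ _) (d1_id _)).
Qed.

Lemma pi2_gt0 : 0 < pi *+ 2 :> R.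
Proof. by rewrite mulrn_wgt0 // pi_gt0. Qed.

(* The factor 2 comes from bounding real and imaginary parts separately. *)
Theorem max_principle h z (r : R) E : (forall w, d1 h w) -> 0 < r ->
  (forall t, nm t = 1 -> nm (h (z + r%:C * t)) <= E) -> nm (h z) <= E *+ 2.
Proof.
move=> dh r0 HE.
have E0 : 0 <= E by apply: le_trans (HE 1 (nm1 _)); exact: nm_ge0.
pose g w := h (z + w).
have dg w : d1 g w by apply: (@d1_comp _ h) => //; exact: d1D (d1_cst _ _) (d1_id _).
have cg lam : cont (fun y => g (lam * ucirc y)).
  by apply: (@cont_circ h z lam).
have neC (x : R) : 0 < x -> x%:C != 0.
  by move=> x0; rewrite -nm_gt0 nm_real normr_gt0 gt_eqF.
have p0 := pi2_gt0.
have JE : nm (Jc (fun y => g (r%:C * ucirc y)) 0 (pi *+ 2)) <= E * (pi *+ 2 - 0) *+ 2.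
  by apply: Jc_bound; [exact: cg|exact: ltW|move=> y _; apply: HE; exact: nm_ucirc].
apply/ler_addgt0Pl => e e0.
have e2 : 0 < e / 2 by rewrite divr_gt0.
have [d d0 Hd] := d1_ct (dg 0) e2.
have d2 : 0 < d / 2 by rewrite divr_gt0.
have JJ : Jc (fun y => g (r%:C * ucirc y)) 0 (pi *+ 2) =
          Jc (fun y => g ((d / 2)%:C * ucirc y)) 0 (pi *+ 2).
  by rewrite !circle_indep ?neC.
have := Jc_B 0 (pi *+ 2) (cg (d / 2)%:C) (@cont_cst _ (g 0)).
rewrite Jc_cst ?(ltW p0) // -JJ subr0 => B.
have B2 : nm (Jc (fun y => g ((d / 2)%:C * ucirc y) - g 0) 0 (pi *+ 2)) <= e / 2 * (pi *+ 2 - 0) *+ 2.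
  apply: Jc_bound; [exact: (contB (cg _) (@cont_cst _ _))|exact: ltW|move=> y _].
  have := Hd ((d / 2)%:C * ucirc y); rewrite !add0r; apply.
  by rewrite nmM nm_ucirc nm_real mulr1 gtr0_norm // ltr_pdivrMr // ltr_pMr // ltr1n.
have {B} B : g 0 * (pi *+ 2)%:C = Jc (fun y => g (r%:C * ucirc y)) 0 (pi *+ 2) -
    Jc (fun y => g ((d / 2)%:C * ucirc y) - g 0) 0 (pi *+ 2) by rewrite B; ring.
have := nmB (Jc (fun y => g (r%:C * ucirc y)) 0 (pi *+ 2))
   (Jc (fun y => g ((d / 2)%:C * ucirc y) - g 0) 0 (pi *+ 2)).
rewrite -B nmM nm_real (gtr0_norm p0) => /le_trans /(_ (lerD JE B2)).
rewrite subr0 -!mulrnAl -mulrDl ler_pM2r // {1}/g addr0 => /le_trans; apply.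
by rewrite mulr2n; clear; lra.
Qed.

Definition zt M : C := ucirc (pi *+ 2 / M%:R).
Definition AM M (F : C -> C) : C := M%:R^-1 * \sum_(j < M) F (zt M ^+ j).

Lemma zt_X M j : zt M ^+ j = ucirc (pi *+ 2 / M%:R * j%:R).
Proof. by rewrite /zt ucircX mulr_natr. Qed.

Lemma nm_zt M j : nm (zt M ^+ j) = 1.
Proof. by rewrite zt_X nm_ucirc. Qed.

Lemma Jc_self a (F : R -> C) : cont F -> Jc F a a = 0.
Proof.
by move=> cF; apply: (@addrI _ (Jc F a a)); rewrite -(Jc_add cF) // addr0.
Qed.

(** [om] bounds the oscillation of F on arcs of angle 2 pi / M; the integral is compared arc by arc
    with the value at the initial point. *)
Lemma riemann_circ F M om : (0 < M)%N -> cont (fun y => F (ucirc y)) ->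
  (forall y y', `|y - y'| <= pi *+ 2 / M%:R -> nm (F (ucirc y) - F (ucirc y')) <= om) ->
  nm ((pi *+ 2)%:C * AM M F - Jc (fun y => F (ucirc y)) 0 (pi *+ 2)) <= om * (pi *+ 2) *+ 2.
Proof.
move=> M0 cF osc; set s : R := pi *+ 2 / M%:R.
have M0' : 0 < M%:R :> R by rewrite ltr0n.
have s0 : 0 < s by rewrite divr_gt0 // pi2_gt0.
have sM : s * M%:R = pi *+ 2 by rewrite mulfVK // gt_eqF.
have -> : (pi *+ 2)%:C * AM M F = \sum_(0 <= j < M) F (zt M ^+ j) * s%:C.
  rewrite big_mkord -mulr_suml /AM mulrA mulrC; congr (_ * _).
  by rewrite /s rmorphM fmorphV rmorph_nat.
rewrite -sM; have step n : nm (\sum_(0 <= j < n) F (zt M ^+ j) * s%:C -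
    Jc (fun y => F (ucirc y)) 0 (s * n%:R)) <= om * (s * n%:R) *+ 2.
  elim: n => [|n IH].
    by rewrite big_geq // mulr0 (Jc_self 0 cF) subrr nm0 mulr0 mul0rn.
  have l1 : 0 <= s * n%:R by rewrite mulr_ge0 // ltW.
  have l2 : s * n%:R <= s * n.+1%:R by rewrite ler_pM2l // ler_nat.
  rewrite big_nat_recr //= (Jc_add cF l1 l2).
  have -> : s * n.+1%:R = s * n%:R + s by rewrite -natr1 mulrDr mulr1.
  set a := s * n%:R.
  have := Jc_B a (a + s) (@cont_cst _ (F (zt M ^+ n))) cF.
  rewrite Jc_cst ?lerDl ?(ltW s0) //.
  have -> : a + s - a = s by ring.
  move=> B.
  rewrite opprD addrACA -B mulrDr mulrnDl.
  apply: le_trans (nmD _ _) _; apply: lerD => //.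
  have -> : om * s = om * (a + s - a) by congr (_ * _); ring.
  apply: Jc_bound; first exact: contB (@cont_cst _ _) cF.
    by rewrite lerDl ltW.
  move=> x /andP [x1 x2]; rewrite zt_X -/s -/a; apply: osc.
  by rewrite -/s ler_norml; apply/andP; split; lra.
exact: step.
Qed.

End Circle.

(** * Averages over roots of unity and the Fejer kernel *)

Section CircleAverages.
Variable R : realType.
Local Notation C := (R[i]).
Local Notation zt := (@zt R).
Local Notation AM := (@AM R).

(** With y = pi k / M, the equation exp(2 i y) = 1 forces sin y = 0 by the double-angle formula,
    whereas sin is positive on (0, pi). *)
Lemma zt_prim M k : (k < M)%N -> zt M ^+ k = 1 -> k = 0%N.
Proof.
move=> kM; have [//|k0] := posnP k.
have M0 : 0 < M%:R :> R by rewrite ltr0n (leq_ltn_trans _ kM).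
rewrite zt_X; set y : R := pi / M%:R * k%:R.
have -> : pi *+ 2 / M%:R * k%:R = y *+ 2 :> R by rewrite /y !mulrnAl.
have s0 : 0 < sin y.
  apply: sin_gt0_pi; apply/andP; split.
    by rewrite /y mulr_gt0 ?ltr0n // divr_gt0 ?pi_gt0.
  by rewrite /y mulrAC ltr_pdivrMr // ltr_pM2l ?pi_gt0 // ltr_nat.
case=> hc _; move: hc; rewrite cos_mulr2n => hc.
have : sin y ^+ 2 = 0 by rewrite sin2cos2; move: hc; rewrite mulr2n; clear; lra.
by move/eqP; rewrite expf_eq0 /= gt_eqF.
Qed.

Lemma zt_neq0 M : zt M != 0.
Proof. exact: ucirc_neq0. Qed.

Lemma zt_M M : (0 < M)%N -> zt M ^+ M = 1.
Proof. by move=> M0; rewrite zt_X mulfVK ?ucirc_2pi // pnatr_eq0 -lt0n. Qed.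

Lemma AM_sum M (I : finType) (P : pred I) (F : I -> C -> C) :
  AM M (fun t => \sum_(i | P i) F i t) = \sum_(i | P i) AM M (F i).
Proof. by rewrite /AM exchange_big mulr_sumr. Qed.

Lemma AM_Ml M c (F : C -> C) : AM M (fun t => c * F t) = c * AM M F.
Proof. by rewrite /AM -mulr_sumr mulrCA. Qed.

Lemma AM_B M (F G : C -> C) : AM M (fun t => F t - G t) = AM M F - AM M G.
Proof. by rewrite /AM sumrB mulrBr. Qed.

Lemma eq_AM M (F G : C -> C) : (forall t, nm t = 1 -> F t = G t) -> AM M F = AM M G.
Proof. by move=> H; congr (_ * _); apply: eq_bigr => i _; apply: H; exact: nm_zt. Qed.

Lemma nm_AM M (F : C -> C) B : 0 <= B -> (forall t, nm t = 1 -> nm (F t) <= B) ->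
  nm (AM M F) <= B.
Proof.
move=> B0 H; rewrite /AM nmM nmV nm_nat.
have [->|M0] := posnP M; first by rewrite invr0 mul0r.
rewrite ler_pdivrMl ?ltr0n //; apply: le_trans (nm_sum _ _ _) _.
apply: (@le_trans _ _ (\sum_(i < M) B)).
  by apply: ler_sum => i _; apply: H; exact: nm_zt.
by rewrite sumr_const card_ord mulr_natl.
Qed.

Lemma AM_orth M i j : (i < M)%N -> (j < M)%N ->
  AM M (fun t => t ^+ i * (t^-1) ^+ j) = (i == j)%:R.
Proof.
move=> iM jM; have M0 : (0 < M)%N := leq_ltn_trans (leq0n _) iM.
have MC : (M%:R : C) != 0 by rewrite pnatr_eq0 -lt0n.
rewrite /AM; have [->|ij] := eqVneq i j.
  under eq_bigr => l _ do rewrite exprVn divff ?expf_neq0 ?zt_neq0 //.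
  by rewrite sumr_const card_ord mulVf.
set r := zt M ^+ i * zt M ^- j.
under eq_bigr => l _.
  rewrite exprVn -!exprM !(mulnC l) !exprM -exprVn -exprMn -/r; over.
have r1 : r != 1.
  apply/eqP => /(congr1 ( *%R^~ (zt M ^+ j))); rewrite mulfVK ?expf_neq0 ?zt_neq0 // mul1r.
  wlog: i j iM jM ij r / (i < j)%N => [H e|lt_ij e].
    move: ij; rewrite neq_ltn => /orP [] lt; first by apply: H e => //; rewrite neq_ltn lt.
    by apply: H (esym e) => //; rewrite neq_ltn lt.
  have : zt M ^+ (j - i) = 1.
    apply: (@mulfI _ (zt M ^+ i)); first by rewrite expf_neq0 ?zt_neq0.
    by rewrite -exprD subnKC ?(ltnW lt_ij) // -e mulr1.
  by move/zt_prim => /(_ (leq_ltn_trans (leq_subr _ _) jM)) /eqP; rewrite subn_eq0 leqNgt lt_ij.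
have rM : r ^+ M = 1.
  by rewrite /r exprMn exprVn -!exprM !(mulnC _ M) !exprM zt_M // !expr1n invr1 mulr1.
have := subrX1 r M; rewrite rM subrr => /esym/eqP; rewrite mulf_eq0 subr_eq0 (negPf r1) /=.
by move/eqP ->; rewrite mulr0.
Qed.

(** In the double sum the discrete Fourier coefficient of index j - i occurs N - |j - i| times, so
    this is a Cesaro mean at the point 1. Its kernel |S|^2 / N is nonnegative with average 1,
    exactly so because N <= M. For |t - 1| < d the integrand is at most om times the kernel;
    elsewhere |S| = |t^N - 1| / |t - 1| <= 2 / d and |F t - F 1| <= 2 B, which gives 8 B / (d^2
    N). *)
Lemma fejer_approx (F : C -> C) N M om B d : (0 < N)%N -> (N <= M)%N ->
  0 < d -> 0 <= om ->
  (forall t, nm t = 1 -> nm (F t) <= B) ->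
  (forall t, nm t = 1 -> nm (t - 1) < d -> nm (F t - F 1) <= om) ->
  nm (N%:R^-1 * \sum_(i < N) \sum_(j < N) AM M (fun t => F t * (t ^+ i * (t^-1) ^+ j)) - F 1)
    <= om + B *+ 8 / d ^+ 2 / N%:R.
Proof.
move=> N0 NM d0 om0 HB Hom.
have M0 : (0 < M)%N := leq_trans N0 NM.
have N0' : 0 < N%:R :> R by rewrite ltr0n.
have NC : (N%:R : C) != 0 by rewrite pnatr_eq0 -lt0n.
pose S (t : C) : C := \sum_(i < N) t ^+ i.
pose K (t : C) : C := N%:R^-1 * (S t * S t^-1).
have KE t : K t = N%:R^-1 * \sum_(i < N) \sum_(j < N) (t ^+ i * t^-1 ^+ j).
  by rewrite /K /S mulr_suml; congr (_ * _); apply: eq_bigr => i _; rewrite mulr_sumr.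
have AK1 : AM M K = 1.
  rewrite (@eq_AM _ _ (fun t => N%:R^-1 * \sum_(i < N) \sum_(j < N) (t ^+ i * t^-1 ^+ j))) //.
  rewrite AM_Ml AM_sum; under eq_bigr => i _.
    rewrite AM_sum; under eq_bigr => j _ do rewrite AM_orth ?(leq_trans _ NM) //.
    rewrite (bigD1 i) //= eqxx big1 ?addr0; last first.
      by move=> j ji; rewrite eq_sym (inj_eq val_inj) (negPf ji).
    over.
  by rewrite sumr_const card_ord mulVf.
have -> : N%:R^-1 * \sum_(i < N) \sum_(j < N) AM M (fun t => F t * (t ^+ i * (t^-1) ^+ j)) - F 1
   = AM M (fun t => (F t - F 1) * K t).
  rewrite (@eq_AM _ _ (fun t => F t * K t - F 1 * K t)); last by move=> t _; rewrite mulrBl.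
  rewrite AM_B AM_Ml AK1 mulr1; congr (_ - _).
  rewrite (@eq_AM _ _ (fun t => N%:R^-1 *
     \sum_(i < N) \sum_(j < N) (F t * (t ^+ i * t^-1 ^+ j)))); last first.
    move=> t _; rewrite KE mulrCA; congr (_ * _); rewrite mulr_sumr.
    by apply: eq_bigr => i _; rewrite mulr_sumr.
  rewrite AM_Ml AM_sum; congr (_ * _); apply: eq_bigr => i _; by rewrite AM_sum.
have tV t : nm t = 1 -> t^-1 = Num.conj t.
  by move=> t1; rewrite invC_norm nmE t1 expr1n invr1 mul1r.
have SV t : nm t = 1 -> S t^-1 = Num.conj (S t).
  by move=> t1; rewrite tV // /S rmorph_sum; apply: eq_bigr => i _; rewrite rmorphXn.
have Kr t : nm t = 1 -> K t = (nm (S t) ^+ 2 / N%:R)%:C.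
  move=> t1; rewrite /K SV // -normCK nmE rmorphM fmorphV rmorph_nat rmorphXn /=.
  by rewrite mulrC.
have Kb t : nm t = 1 -> nm (F t - F 1) * (nm (S t) ^+ 2 / N%:R) <=
    om * (nm (S t) ^+ 2 / N%:R) + B *+ 8 / d ^+ 2 / N%:R.
  move=> t1; have B0 : 0 <= B by apply: le_trans (HB t t1); exact: nm_ge0.
  have K0 : 0 <= nm (S t) ^+ 2 / N%:R by rewrite divr_ge0 ?sqr_ge0 // ltW.
  have R0 : 0 <= B *+ 8 / d ^+ 2 / N%:R.
    by rewrite divr_ge0 ?(ltW N0') // divr_ge0 ?sqr_ge0 // mulrn_wge0.
  have [/Hom h|td] := ltP (nm (t - 1)) d.
    by rewrite -[leLHS]addr0; apply: lerD => //; apply: ler_wpM2r => //; exact: h.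
  apply: (@le_trans _ _ (B *+ 8 / d ^+ 2 / N%:R)); last by rewrite lerDr mulr_ge0.
  have S2 : nm (S t) <= 2 / d.
    have t0 : 0 < nm (t - 1) by apply: lt_le_trans td.
    rewrite ler_pdivlMr //; apply: (@le_trans _ _ (nm (S t) * nm (t - 1))).
      by apply: ler_wpM2l => //; exact: nm_ge0.
    rewrite -nmM mulrC /S -subrX1; apply: le_trans (nmB _ _) _.
    by rewrite nmX t1 expr1n nm1.
  have FB : nm (F t - F 1) <= B *+ 2.
    by apply: le_trans (nmB _ _) _; rewrite mulr2n lerD // HB // nm1.
  rewrite mulrA ler_pM2r ?invr_gt0 //.
  have -> : B *+ 8 / d ^+ 2 = B *+ 2 * (2 / d) ^+ 2.
    by rewrite expr_div_n -!(mulr_natr B) mulrA -natrX -!mulrA; congr (_ * _);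
      rewrite !mulrA -natrM.
  have h2 : 0 <= 2 / d by apply: divr_ge0 => //; exact: ltW.
  apply: ler_pM => //; [exact: nm_ge0|exact: sqr_ge0|].
  by apply: lerXn2r => //; rewrite nnegrE nm_ge0.
rewrite {1}/AM nmM nmV nm_nat ler_pdivrMl ?ltr0n //.
apply: le_trans (nm_sum _ _ _) _.
apply: (@le_trans _ _ (\sum_(l < M) (om * (nm (S (zt M ^+ l)) ^+ 2 / N%:R) + B *+ 8 / d ^+ 2 / N%:R))).
  apply: ler_sum => l _; rewrite nmM Kr ?nm_zt // nm_real ger0_norm; first exact/Kb/nm_zt.
  by rewrite divr_ge0 ?sqr_ge0 // ltW.
rewrite big_split /= sumr_const card_ord mulrDr -[X in _ + X <= _]mulr_natl lerD2r.
rewrite -mulr_sumr [leRHS]mulrC ler_wpM2l //.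
have := AK1; rewrite /AM => /(congr1 ( *%R M%:R)); rewrite mulr1 mulVKf ?pnatr_eq0 -?lt0n // => H.
rewrite -(@lecR R) rmorph_nat -H rmorph_sum /= le_eqVlt; apply/orP; left; apply/eqP/eq_bigr => l _.
by rewrite Kr ?nm_zt.
Qed.

End CircleAverages.

(** * Fejer sums of Laurent and Taylor expansions, uniformly in a parameter *)

Section Families.
Variable R : realType.
Local Notation C := (R[i]).
Local Notation AM := (@AM R).

Definition ann (a b : R) (z : C) := a <= nm z <= b.

(** Equicontinuity and boundedness on a closed annulus, uniform in the parameter w. The parameter
    will stand for the remaining coordinates, so that N and M can be chosen once for a whole
    polydisc. *)
Definition UB (W : Type) (a b : R) (h : W -> C -> C) :=
  (forall e, 0 < e -> exists2 d, 0 < d & forall w z z', ann a b z -> ann a b z' ->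
     nm (z - z') < d -> nm (h w z - h w z') <= e) /\
  (exists2 B, 0 <= B & forall w z, ann a b z -> nm (h w z) <= B).

Lemma UB_mul W a b (h g : W -> C -> C) : UB a b h -> UB a b g ->
  UB a b (fun w z => h w z * g w z).
Proof.
move=> [uh [B B0 hB]] [ug [B' B'0 gB]]; split; last first.
  exists (B * B'); first exact: mulr_ge0.
  by move=> w z az; rewrite nmM ler_pM ?nm_ge0 ?hB ?gB.
move=> e e0; pose L := B + B' + 1.
have L0 : 0 < L by rewrite ltr_wpDl ?addr_ge0.
have [d d0 Hd] := uh (e / 2 / L) (divr_gt0 (divr_gt0 e0 (ltr0Sn _ 1)) L0).
have [d' d'0 Hd'] := ug (e / 2 / L) (divr_gt0 (divr_gt0 e0 (ltr0Sn _ 1)) L0).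
exists (Num.min d d'); first by rewrite lt_min d0.
move=> w z z' az az'; rewrite lt_min => /andP [/(Hd w z z' az az') h1 /(Hd' w z z' az az') h2].
have -> : h w z * g w z - h w z' * g w z' = h w z * (g w z - g w z') + (h w z - h w z') * g w z'.
  by ring.
rewrite (splitr e); apply: le_trans (nmD _ _) _; rewrite !nmM; apply: lerD.
  have -> : e / 2 = L * (e / 2 / L) by rewrite [RHS]mulrC mulfVK ?gt_eqF.
  apply: ler_pM => //; [exact: nm_ge0|exact: nm_ge0|].
  by apply: le_trans (hB w z az) _; rewrite /L -addrA lerDl addr_ge0.
have -> : e / 2 = e / 2 / L * L by rewrite mulfVK ?gt_eqF.
apply: ler_pM => //; [exact: nm_ge0|exact: nm_ge0|].
by apply: le_trans (gB w z' az') _; rewrite /L addrAC lerDr addr_ge0.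
Qed.

Lemma UB_cst W a b (c : C) : UB a b (fun (_ : W) _ => c).
Proof.
split; last by exists (nm c) => //; exact: nm_ge0.
by move=> e e0; exists 1 => // *; rewrite subrr nm0 ltW.
Qed.

Lemma UB_id W a b : UB a b (fun (_ : W) z => z).
Proof.
split; first by move=> e e0; exists e => // w z z' _ _ /ltW.
exists (Num.max 0 b); first by rewrite le_max lexx.
by move=> _ z /andP [_ zb]; rewrite le_max zb orbT.
Qed.

Lemma UB_inv W a b : 0 < a -> UB a b (fun (_ : W) z => z^-1).
Proof.
move=> a0; have pos z : ann a b z -> 0 < nm z.
  by move=> /andP [h _]; apply: lt_le_trans h.
split; last first.
  exists a^-1; first by rewrite invr_ge0 ltW.
  by move=> _ z az; rewrite nmV lef_pV2 ?posrE ?pos //; case/andP: az.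
move=> e e0; exists (e * (a * a)); first by rewrite !mulr_gt0.
move=> _ z z' az az' /ltW h.
have z0 : z != 0 by rewrite -nm_gt0 pos.
have z'0 : z' != 0 by rewrite -nm_gt0 pos.
have -> : z^-1 - z'^-1 = (z' - z) / (z * z') by field; rewrite z0 z'0.
rewrite nmM nmV nmM nm_sym ler_pdivrMr ?mulr_gt0 ?pos //.
apply: le_trans h _; apply: ler_wpM2l; first exact: ltW.
by case/andP: az => az _; case/andP: az' => az' _; apply: ler_pM => //; apply: ltW.
Qed.

Lemma UB_exp W a b (h : W -> C -> C) n : UB a b h -> UB a b (fun w z => h w z ^+ n).
Proof.
move=> uh; elim: n => [|n IH]; first exact: UB_cst.
have -> : (fun w z => h w z ^+ n.+1) = (fun w z => h w z * h w z ^+ n).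
  by apply/funext => w; apply/funext => z; rewrite exprS.
exact: UB_mul.
Qed.

Lemma UB_sub W a b a' b' (h : W -> C -> C) : a <= a' -> b' <= b -> UB a b h -> UB a' b' h.
Proof.
move=> aa bb; have sub z : ann a' b' z -> ann a b z.
  by move=> /andP [h1 h2]; rewrite /ann (le_trans aa h1) (le_trans h2 bb).
move=> [uh [B B0 hB]]; split; last by exists B => // w z /sub; exact: hB.
by move=> e /uh [d d0 Hd]; exists d => // w z z' /sub h1 /sub h2; exact: Hd.
Qed.

Definition ev (P : nat -> Prop) := exists M0, forall M, (M0 <= M)%N -> P M.

Lemma ev_all (I : finType) (P : I -> nat -> Prop) :
  (forall i, ev (P i)) -> ev (fun M => forall i, P i M).
Proof.
move=> H; pose f i := sval (cid (H i)); exists (\max_i f i) => M HM i.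
have := svalP (cid (H i)); apply; apply: leq_trans HM; exact: leq_bigmax.
Qed.

Lemma ucirc_near d : 0 < d -> exists2 d' : R, 0 < d' &
  forall y y', `|y - y'| < d' -> nm (ucirc y - ucirc y') < d.
Proof.
move=> d0; have [d' d'0 Hd'] := d1_ct (@d1_cexp R 0) (divr_gt0 d0 (ltr0Sn _ 1)).
exists d' => // y y' hy.
have -> : ucirc y - ucirc y' = (ucirc (y - y') - 1) * ucirc y'.
  by rewrite mulrBl mul1r -ucircD subrK.
rewrite nmM nm_ucirc mulr1; apply: (@le_lt_trans _ _ (d / 2)).
  have := Hd' ('i * (y - y')%:C); rewrite nmM nm_real !add0r cexp0 -ucircE.
  have -> : nm 'i = 1 :> R by rewrite /nm normCi.
  by rewrite mul1r => /(_ hy).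
by rewrite ltr_pdivrMr // ltr_pMr // ltr1n.
Qed.

(** Both averages are Riemann sums of circle integrals that coincide by [circle_indep];
    equicontinuity makes the error of these sums uniform in w and in the radius. *)
Lemma AM_indep W a b (h : W -> C -> C) : 0 < a -> UB a b h ->
  (forall w z, z != 0 -> d1 (h w) z) -> forall e, 0 < e ->
  ev (fun M => forall w l l', ann a b l -> ann a b l' ->
    nm (AM M (fun t => h w (l * t)) - AM M (fun t => h w (l' * t))) <= e).
Proof.
move=> a0 [uh _] dh e e0.
(* Each of the two Riemann sums costs 2 pi e / 4, doubled by [riemann_circ]; together this is 2 pi
   e. *)
have [d d0 Hd] := uh (e / 4) (divr_gt0 e0 (ltr0Sn _ 3)).
pose b1 := Num.max 1 b; have b10 : 0 < b1 by rewrite lt_max ltr01.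
have [d' d'0 Hd'] := ucirc_near (divr_gt0 d0 b10).
have p0 := pi2_gt0 R.
pose M0 := (Num.truncn (pi *+ 2 / d')).+1.
exists M0 => M HM w l l' al al'.
have Mpos : (0 < M)%N by apply: leq_trans HM.
have sM : pi *+ 2 / M%:R < d'.
  rewrite ltr_pdivrMr ?ltr0n // mulrC -ltr_pdivrMr //.
  have /andP [_ h2] := @truncn_itv R (pi *+ 2 / d') (divr_ge0 (ltW p0) (ltW d'0)).
  by apply: lt_le_trans h2 _; rewrite ler_nat.
have key k : ann a b k ->
   nm ((pi *+ 2)%:C * AM M (fun t => h w (k * t)) -
       Jc (fun y => h w (k * ucirc y)) 0 (pi *+ 2)) <= e / 4 * (pi *+ 2) *+ 2 /\ k != 0.
  move=> /andP [k1 k2]; have k0 : k != 0 by rewrite -nm_gt0 (lt_le_trans a0).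
  split=> //; apply: riemann_circ => //.
    have := @cont_circ R (h w) 0 k.
    have -> : (fun y => h w (0 + k * ucirc y)) = (fun y => h w (k * ucirc y)).
      by apply/funext => y; rewrite add0r.
    apply=> t t1; rewrite add0r; apply: dh; rewrite mulf_neq0 //.
    by rewrite -nm_gt0 t1.
  move=> y y' yy; apply: Hd; rewrite /ann ?nmM ?nm_ucirc ?mulr1 ?k1 //.
  rewrite -mulrBr nmM; apply: (@le_lt_trans _ _ (b1 * nm (ucirc y - ucirc y'))).
    by apply: ler_wpM2r; [exact: nm_ge0|rewrite le_max k2 orbT].
  by rewrite mulrC -ltr_pdivlMr //; apply: Hd'; apply: le_lt_trans yy sM.
have [K1 l0] := key l al; have [K2 l'0] := key l' al'.
rewrite !(circle_indep (dh w)) // in K1 K2.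
have := nm_tri (Jc (fun y => h w (ucirc y)) 0 (pi *+ 2))
  ((pi *+ 2)%:C * AM M (fun t => h w (l * t))) ((pi *+ 2)%:C * AM M (fun t => h w (l' * t))).
rewrite -mulrBr nmM nm_real (gtr0_norm p0) => /le_trans H.
have {H} := H _ (lerD K1 (_ : _ <= e / 4 * (pi *+ 2) *+ 2)); rewrite nm_sym => /(_ K2).
have -> : e / 4 * (pi *+ 2) *+ 2 + e / 4 * (pi *+ 2) *+ 2 = pi *+ 2 * e.
  by move: (pi *+ 2) => p; rewrite !mulr2n; field.
by rewrite ler_pM2l.
Qed.

(** The discrete Laurent coefficient of index j - i. The pair (i, j) is kept because Fejer's double
    sum is indexed by it and all exponents remain natural numbers. *)
Definition AMij M i j (F : C -> C) := AM M (fun t => F t * (t ^+ i * (t^-1) ^+ j)).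

Lemma AMij_indep W a b (h : W -> C -> C) : 0 < a -> UB a b h ->
  (forall w z, z != 0 -> d1 (h w) z) -> forall i j e, 0 < e ->
  ev (fun M => forall w l l', ann a b l -> ann a b l' ->
    nm (l ^+ i * l^-1 ^+ j * AMij M i j (fun t => h w (l * t)) -
        l' ^+ i * l'^-1 ^+ j * AMij M i j (fun t => h w (l' * t))) <= e).
Proof.
move=> a0 uh dh i j e e0.
have ug : UB a b (fun w z => h w z * (z ^+ i * z^-1 ^+ j)).
  by apply: UB_mul => //; apply: UB_mul; apply: UB_exp; [exact: UB_id|exact: UB_inv].
have dg w z : z != 0 -> d1 (fun z => h w z * (z ^+ i * z^-1 ^+ j)) z.
  move=> z0; apply: d1M; first exact: dh.
  by apply: d1M; apply: d1X; [exact: d1_id|apply: d1V => //; exact: d1_id].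
have [M0 HM] := AM_indep a0 ug dg e0; exists M0 => M hM w l l' al al'.
have := HM M hM w l l' al al'; rewrite /AMij -!AM_Ml.
by congr (nm (_ - _) <= _); apply: eq_AM => t _; rewrite !exprMn invfM exprMn; ring.
Qed.

Lemma lt_inv_nat (x y : R) : 0 <= x -> 0 < y -> exists2 N, (0 < N)%N & x / N%:R <= y.
Proof.
move=> x0 y0; exists (Num.truncn (x / y)).+1 => //.
rewrite ler_pdivrMr ?ltr0n // mulrC -ler_pdivrMr //.
by have /andP [_ /ltW] := @truncn_itv R (x / y) (divr_ge0 x0 (ltW y0)).
Qed.

Lemma fejer_family W a b (h : W -> C -> C) : 0 < b -> UB a b h ->
  forall e, 0 < e -> exists2 N, (0 < N)%N & forall M w l, (N <= M)%N -> ann a b l ->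
  nm (N%:R^-1 * \sum_(i < N) \sum_(j < N) AMij M i j (fun t => h w (l * t)) - h w l) <= e.
Proof.
move=> b0 [uh [B B0 hB]] e e0.
have e2 : 0 < e / 2 by rewrite divr_gt0.
have [d d0 Hd] := uh _ e2.
pose d' := d / b; have d'0 : 0 < d' by rewrite divr_gt0.
have [N N0 HN] := @lt_inv_nat (B *+ 8 / d' ^+ 2) (e / 2)
  (divr_ge0 (mulrn_wge0 8 B0) (sqr_ge0 _)) e2.
exists N => // M w l NM al; have /andP [l1 l2] := al.
have at1 t : nm t = 1 -> ann a b (l * t) by move=> t1; rewrite /ann nmM t1 mulr1.
have := @fejer_approx R (fun t => h w (l * t)) N M (e / 2) B d' N0 NM d'0 (ltW e2).
rewrite mulr1 => H; apply: le_trans (H _ _) _.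
- by move=> t t1; apply: hB; exact: at1.
- move=> t t1 td; apply: Hd => //; first exact: at1.
  rewrite -[X in _ - X]mulr1 -mulrBr nmM; apply: (@le_lt_trans _ _ (b * nm (t - 1))).
    by apply: ler_wpM2r => //; exact: nm_ge0.
  by rewrite mulrC -ltr_pdivlMr.
by rewrite [leRHS]splitr lerD2l.
Qed.

(** N is fixed before M, so only finitely many coefficients have to be replaced and one M serves
    them all. Each of the N^2 coefficients may err by e / (2 N), because the sum is divided by N. *)
Lemma fejer_replace W V a b (h : W -> C -> C) (w : V -> W) (l : V -> C)
    (T : nat -> nat -> nat -> V -> C) : 0 < b -> UB a b h -> (forall v, ann a b (l v)) ->
  (forall i j e, 0 < e -> ev (fun M => forall v,
     nm (AMij M i j (fun t => h (w v) (l v * t)) - T M i j v) <= e)) ->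
  forall e, 0 < e -> exists N M, [/\ (0 < N)%N, (0 < M)%N & forall v,
   nm (N%:R^-1 * \sum_(i < N) \sum_(j < N) T M i j v - h (w v) (l v)) <= e].
Proof.
move=> b0 uh al HT e e0; have e2 : 0 < e / 2 by rewrite divr_gt0.
have [N N0 HN] := fejer_family b0 uh e2.
have NN0 : 0 < N%:R :> R by rewrite ltr0n.
have [M0 HM] := ev_all (fun ij : 'I_N * 'I_N => HT ij.1 ij.2 _ (divr_gt0 e2 NN0)).
exists N, (maxn N M0); split=> //; first by rewrite leq_max N0.
move=> v; have hN := HN (maxn N M0) (w v) (l v) (leq_maxl _ _) (al v).
have {HM} hM := HM (maxn N M0) (leq_maxr _ _); set M := maxn N M0 in hN hM *.
set Q := (X in N%:R^-1 * X - h (w v) (l v)).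
set P := (X in N%:R^-1 * X - h (w v) (l v)) in hN.
apply: le_trans (nm_tri (N%:R^-1 * P) _ _) _; rewrite (splitr e); apply: lerD => //.
rewrite -mulrBr nmM nmV nm_nat ler_pdivrMl // /Q /P -sumrB.
apply: le_trans (nm_sum _ _ _) _.
apply: (@le_trans _ _ (\sum_(i < N) e / 2)); last by rewrite sumr_const card_ord mulr_natl.
apply: ler_sum => i _; rewrite -sumrB; apply: le_trans (nm_sum _ _ _) _.
apply: (@le_trans _ _ (\sum_(j < N) e / 2 / N%:R)).
  by apply: ler_sum => j _; rewrite nm_sym; exact: (hM (i, j)).
by rewrite sumr_const card_ord -[leLHS]mulr_natr mulfVK // gt_eqF.
Qed.

(** By [AMij_indep] the coefficient on the circle through l, multiplied by l^(i - j), hardly depends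
    on l. Multiplying back by l^(j - i), which is bounded on the annulus, expresses it by the
    coefficient on the circle through k. *)
Lemma AMij_transfer W a b (h : W -> C -> C) : 0 < a -> UB a b h ->
  (forall w z, z != 0 -> d1 (h w) z) -> forall i j e, 0 < e ->
  ev (fun M => forall w l k, ann a b l -> ann a b k ->
    nm (AMij M i j (fun t => h w (l * t)) - l ^+ j * l^-1 ^+ i *
       (k ^+ i * k^-1 ^+ j * AMij M i j (fun t => h w (k * t)))) <= e).
Proof.
move=> a0 uh dh i j e e0.
have [_ [L L0 HL]] : UB a b (fun (_ : unit) z => z ^+ j * z^-1 ^+ i).
  by apply: UB_mul; apply: UB_exp; [exact: UB_id|exact: UB_inv].
have L1 : 0 < L + 1 by rewrite ltr_wpDl.
have [M0 HM] := AMij_indep a0 uh dh i j (divr_gt0 e0 L1).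
exists M0 => M hM w l k al ak.
have l0 : l != 0 by case/andP: al => l1 _; rewrite -nm_gt0 (lt_le_trans a0).
have -> : AMij M i j (fun t => h w (l * t)) =
    l ^+ j * l^-1 ^+ i * (l ^+ i * l^-1 ^+ j * AMij M i j (fun t => h w (l * t))).
  by rewrite !exprVn; field; rewrite !expf_neq0.
rewrite -mulrBr nmM.
have h1 := HL tt l al; have h2 := HM M hM w l k al ak.
apply: (@le_trans _ _ ((L + 1) * (e / (L + 1)))); last by rewrite mulrC mulfVK // gt_eqF.
apply: ler_pM; [exact: nm_ge0|exact: nm_ge0| |exact: h2].
by apply: le_trans h1 _; rewrite lerDl.
Qed.

Lemma expr_sub (l : C) i j : l != 0 -> (i <= j)%N -> l ^+ j * l^-1 ^+ i = l ^+ (j - i).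
Proof. by move=> l0 ij; rewrite -{1}(subnK ij) exprD exprVn mulfK // expf_neq0. Qed.

(** Coefficients of index j - i >= 0 are transferred to the unit circle and get the factor l^(j -
    i). Those of negative index are transferred to the circle through l m, where l^(j - i) (l m)^(i
    - j) = m^(i - j). Thus no negative power is left, and the coefficients involve l and m only
    through the product l m. *)
Lemma laurent_family W a b (h : W -> C -> C) : 0 < a -> a <= 1 -> 1 <= b -> UB a b h ->
  (forall w z, z != 0 -> d1 (h w) z) -> forall e, 0 < e ->
  exists N M, [/\ (0 < N)%N, (0 < M)%N & forall w l m, ann a b l -> ann a b (l * m) ->
  nm (N%:R^-1 * \sum_(i < N) \sum_(j < N)
    (if (i <= j)%N then l ^+ (j - i) * AMij M i j (h w)
     else m ^+ (i - j) * AMij M i j (fun t => h w (l * m * t))) - h w l) <= e].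
Proof.
move=> a0 a1 b1 uh dh e e0.
pose V := {v : W * C * C | ann a b v.1.2 /\ ann a b (v.1.2 * v.2)}.
pose T M i j (v : V) : C := let: (w, l, m) := sval v in
   if (i <= j)%N then l ^+ (j - i) * AMij M i j (h w)
     else m ^+ (i - j) * AMij M i j (fun t => h w (l * m * t)).
have nz k : ann a b k -> k != 0.
  by move=> /andP [k1 _]; rewrite -nm_gt0 (lt_le_trans a0).
have HT i j e' : 0 < e' -> ev (fun M => forall v : V,
     nm (AMij M i j (fun t => h (sval v).1.1 ((sval v).1.2 * t)) - T M i j v) <= e').
  move=> e'0; have [M0 HM] := AMij_transfer a0 uh dh i j e'0.
  exists M0 => M hM [[[w l] m] [al alm]] /=; simpl in al, alm; rewrite /T /=.
  have l0 := nz l al; have lm0 := nz _ alm.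
  have m0 : m != 0 by move: lm0; apply: contraNneq => ->; rewrite mulr0.
  case: (leqP i j) => ij.
    have := HM M hM w l 1 al; rewrite /ann nm1 a1 b1 => /(_ isT).
    have -> : (fun t => h w (1 * t)) = h w by apply/funext => t; rewrite mul1r.
    by rewrite invr1 !expr1n !mul1r expr_sub.
  have := HM M hM w l _ al alm.
  rewrite (mulrA _ _ (AMij _ _ _ _)).
  suff -> : l ^+ j * l^-1 ^+ i * ((l * m) ^+ i * (l * m)^-1 ^+ j) = m ^+ (i - j) by [].
  rewrite -(expr_sub m0 (ltnW ij)) !invfM !exprMn !exprVn.
  by field; rewrite !expf_neq0.
have alV (v : V) : ann a b (sval v).1.2 by case: (svalP v).
have [N [M [N0 M0 HNM]]] := fejer_replace (lt_le_trans ltr01 b1) uh alV HT e0.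
exists N, M; split=> // w l m al alm.
by have := HNM (exist _ (w, l, m) (conj al alm)).
Qed.

(** For entire h the coefficients of negative index are negligible: transferred to a circle of small
    radius eta they carry the factor eta^(i - j) <= eta, while the averages stay below B. *)
Lemma taylor_family W a b (h : W -> C -> C) : 0 < a -> a <= 1 -> 1 <= b -> UB 0 b h ->
  (forall w z, d1 (h w) z) -> forall e, 0 < e ->
  exists N M, [/\ (0 < N)%N, (0 < M)%N & forall w l, ann a b l ->
  nm (N%:R^-1 * \sum_(i < N) \sum_(j < N)
    (if (i <= j)%N then l ^+ (j - i) * AMij M i j (h w) else 0) - h w l) <= e].
Proof.
move=> a0 a1 b1 uh dh e e0.
pose V := {v : W * C | ann a b v.2}.
pose T M i j (v : V) : C := 
   if (i <= j)%N then (sval v).2 ^+ (j - i) * AMij M i j (h (sval v).1) else 0.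
have nz k : ann a b k -> k != 0.
  by move=> /andP [k1 _]; rewrite -nm_gt0 (lt_le_trans a0).
have uha := UB_sub (ltW a0) (lexx b) uh.
have HT i j e' : 0 < e' -> ev (fun M => forall v : V,
     nm (AMij M i j (fun t => h (sval v).1 ((sval v).2 * t)) - T M i j v) <= e').
  move=> e'0; rewrite /T; case: (leqP i j) => ij.
    have [M0 HM] := AMij_transfer a0 uha (fun w z _ => dh w z) i j e'0.
    exists M0 => M hM [[w l] al] /=; simpl in al.
    have l0 := nz l al.
    have := HM M hM w l 1 al; rewrite /ann nm1 a1 b1 => /(_ isT).
    have -> : (fun t => h w (1 * t)) = h w by apply/funext => t; rewrite mul1r.
    by rewrite invr1 !expr1n !mul1r expr_sub.
  have [_ [L L0 HL]] : UB a b (fun (_ : unit) z => z ^+ j * z^-1 ^+ i).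
    by apply: UB_mul; apply: UB_exp; [exact: UB_id|exact: UB_inv].
  have [_ [B B0 HB]] := uh.
  have e'2 : 0 < e' / 2 by rewrite divr_gt0.
  have LB : 0 < L * B + 1 by rewrite ltr_wpDl // mulr_ge0.
  (* The bound by [a] keeps l in the enlarged annulus; the second one makes L eta B at most e' / 2,
     where the summand 1 avoids division by zero. *)
  pose eta := Num.min a (e' / 2 / (L * B + 1)).
  have eta0 : 0 < eta by rewrite lt_min a0 divr_gt0.
  have etaa : eta <= a by rewrite ge_min lexx.
  have uhe := UB_sub (ltW eta0) (lexx b) uh.
  have [M0 HM] := AMij_transfer eta0 uhe (fun w z _ => dh w z) i j e'2.
  exists M0 => M hM [[w l] al] /=; simpl in al; rewrite subr0.
  have al' : ann eta b l by case/andP: al => l1 l2; rewrite /ann l2 (le_trans etaa).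
  have ne : nm eta%:C = eta by rewrite nm_real gtr0_norm.
  have ae : ann eta b eta%:C by rewrite /ann ne lexx (le_trans etaa) // (le_trans a1).
  have ee0 : eta%:C != 0 by rewrite -nm_gt0 ne.
  have := HM M hM w l _ al' ae; rewrite (expr_sub ee0 (ltnW ij)).
  set A := AMij _ _ _ _; set A' := AMij _ _ _ _ => hA.
  have b1' : nm A' <= B.
    apply: nm_AM => // t t1; rewrite !nmM !nmX nmV t1 invr1 !expr1n !mulr1.
    by apply: HB; rewrite /ann nm_ge0 nmM t1 mulr1 ne (le_trans etaa) // (le_trans a1).
  clearbody A A'.
  rewrite -(subrK (l ^+ j * l^-1 ^+ i * (eta%:C ^+ (i - j) * A')) A) (splitr e').
  apply: le_trans (nmD _ _) _; apply: lerD => //.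
  rewrite !nmM.
  have b2 : nm (eta%:C ^+ (i - j)) <= eta.
    rewrite nmX ne -(subnKC (_ : (0 < i - j)%N)) ?subn_gt0 // exprD expr1.
    rewrite -[leRHS]mulr1; apply: ler_wpM2l; first exact: ltW.
    by apply: exprn_ile1; [exact: ltW|exact: le_trans etaa a1].
  have b3 := HL tt l al; rewrite nmM in b3.
  apply: (@le_trans _ _ (L * (eta * B))).
    apply: ler_pM => //; rewrite ?mulr_ge0 ?nm_ge0 //.
    by apply: ler_pM; rewrite ?nm_ge0.
  apply: (@le_trans _ _ (e' / 2 / (L * B + 1) * (L * B + 1))); last by rewrite mulfVK // gt_eqF.
  rewrite mulrCA; apply: ler_pM; [exact: ltW|exact: mulr_ge0| |by rewrite lerDl].
  by rewrite ge_min lexx orbT.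
have [N [M [N0 M0 HNM]]] := fejer_replace (lt_le_trans ltr01 b1) uha (fun v : V => svalP v) HT e0.
exists N, M; split=> // w l al.
by have := HNM (exist _ (w, l) al).
Qed.

End Families.

(** * Polynomial approximation of entire functions *)

Section Entire.
Variable R : realType.
Local Notation C := (R[i]).
Local Notation AM := (@AM R).
Variable I : finType.
Implicit Types (F P : (I -> C) -> C) (x y : I -> C).

Definition upd x (j : I) (t : C) : I -> C := fun i => if i == j then t else x i.
Definition pdisc (rho : R) x := forall i, nm (x i) <= rho.

(** Holomorphy is tested along arbitrary curves with holomorphic coordinates, in place of a
    differential in several variables; with uniform continuity and boundedness on polydiscs this is
    stable under sums, products and freezing of variables, and it is the input of
    [taylor_family]. *)
Definition ent F :=
  [/\ forall (g : C -> I -> C) z, (forall i, d1 (fun s => g s i) z) -> d1 (fun s => F (g s)) z,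
      forall rho e, 0 < e -> exists2 d, 0 < d & forall x y, pdisc rho x -> pdisc rho y ->
        (forall i, nm (x i - y i) < d) -> nm (F x - F y) <= e &
      forall rho, exists2 B, 0 <= B & forall x, pdisc rho x -> nm (F x) <= B].

Lemma d1_upd x j i z : d1 (fun t => upd x j t i) z.
Proof. by rewrite /upd; case: eqP => _; [exact: d1_id|exact: d1_cst]. Qed.

Lemma ent_d1 F x j z : ent F -> d1 (fun t => F (upd x j t)) z.
Proof. by case=> H _ _; apply: H => i; exact: d1_upd. Qed.

Definition pf P := exists s : seq (C * (I -> nat)),
  forall x, P x = \sum_(cm <- s) cm.1 * \prod_i x i ^+ cm.2 i.

Lemma pf0 : pf (fun _ => 0).
Proof. by exists [::] => x; rewrite big_nil. Qed.

Lemma pf_cst c : pf (fun _ => c).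
Proof.
exists [:: (c, fun _ => 0%N)] => x; rewrite big_cons big_nil addr0 /= big1 ?mulr1 //.
Qed.

Lemma pfD P Q : pf P -> pf Q -> pf (fun x => P x + Q x).
Proof. by move=> [s Hs] [s' Hs']; exists (s ++ s') => x; rewrite big_cat Hs Hs'. Qed.

Lemma pf_sum (J : Type) (r : seq J) (p : pred J) (G : J -> (I -> C) -> C) :
  (forall j, pf (G j)) -> pf (fun x => \sum_(j <- r | p j) G j x).
Proof.
move=> H; elim: r => [|j r IH].
  by have [s Hs] := pf0; exists s => x; rewrite big_nil -Hs.
case pj: (p j).
  by have [s Hs] := pfD (H j) IH; exists s => x; rewrite big_cons pj -Hs.
by have [s Hs] := IH; exists s => x; rewrite big_cons pj -Hs.
Qed.

Lemma pf_Mmon P c (m : I -> nat) : pf P -> pf (fun x => c * \prod_i x i ^+ m i * P x).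
Proof.
move=> [s Hs]; exists [seq (c * cm.1, fun i => (m i + cm.2 i)%N) | cm <- s] => x.
rewrite big_map Hs mulr_sumr; apply: eq_bigr => cm _ /=.
under [in RHS]eq_bigr do rewrite exprD; rewrite big_split /=; ring.
Qed.

Lemma pf_Ml P c : pf P -> pf (fun x => c * P x).
Proof.
move=> /(pf_Mmon c (fun _ => 0%N)) [s Hs]; exists s => x; rewrite -Hs big1 ?mulr1 //.
Qed.

Lemma pf_MX P j k : pf P -> pf (fun x => x j ^+ k * P x).
Proof.
move=> /(pf_Mmon 1 (fun i => if i == j then k else 0%N)) [s Hs]; exists s => x.
rewrite -Hs mul1r (bigD1 j) //= eqxx big1 ?mulr1 // => i /negPf ->.
by rewrite expr0.
Qed.

Lemma ent_freeze F j t : ent F -> ent (fun x => F (upd x j t)).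
Proof.
move=> [H1 H2 H3]; split.
- move=> g z Hg; apply: (H1 (fun s => upd (g s) j t)) => i; rewrite /upd.
  by case: eqP => _; [exact: d1_cst|exact: Hg].
- move=> rho e e0; have [d d0 Hd] := H2 (Num.max rho (nm t)) e e0.
  exists d => // x y hx hy hxy; apply: Hd => i; rewrite /upd; case: eqP => _.
  + by rewrite le_max lexx orbT.
  + by rewrite le_max hx.
  + by rewrite le_max lexx orbT.
  + by rewrite le_max hy.
  + by rewrite subrr nm0.
  + exact: hxy.
- move=> rho; have [B B0 HB] := H3 (Num.max rho (nm t)); exists B => // x hx.
  apply: HB => i; rewrite /upd; case: eqP => _; first by rewrite le_max lexx orbT.
  by rewrite le_max hx.
Qed.

Lemma ent_cst c : ent (fun _ => c).
Proof.
split; first by move=> *; exact: d1_cst.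
  by move=> rho e e0; exists 1 => // *; rewrite subrr nm0 ltW.
by move=> rho; exists (nm c) => //; exact: nm_ge0.
Qed.

Lemma ent_coord i : ent (fun x => x i).
Proof.
split; first by move=> g z; apply.
  by move=> rho e e0; exists e => // x y _ _ /(_ i) /ltW.
move=> rho; exists (Num.max 0 rho); first by rewrite le_max lexx.
by move=> x /(_ i) h; rewrite le_max h orbT.
Qed.

Lemma entD F G : ent F -> ent G -> ent (fun x => F x + G x).
Proof.
move=> [F1 F2 F3] [G1 G2 G3]; split.
- by move=> g z Hg; apply: d1D; [exact: F1|exact: G1].
- move=> rho e e0; have e2 : 0 < e / 2 by rewrite divr_gt0.
  have [d d0 Hd] := F2 rho _ e2; have [d' d'0 Hd'] := G2 rho _ e2.
  exists (Num.min d d'); first by rewrite lt_min d0.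
  move=> x y hx hy hxy; rewrite opprD addrACA [leRHS]splitr; apply: le_trans (nmD _ _) _.
  by apply: lerD; [apply: Hd|apply: Hd'] => // i; have := hxy i; rewrite lt_min => /andP [].
- move=> rho; have [B B0 HB] := F3 rho; have [B' B'0 HB'] := G3 rho.
  exists (B + B'); first exact: addr_ge0.
  by move=> x hx; apply: le_trans (nmD _ _) _; apply: lerD; [exact: HB|exact: HB'].
Qed.

Lemma entM F G : ent F -> ent G -> ent (fun x => F x * G x).
Proof.
move=> [F1 F2 F3] [G1 G2 G3]; split.
- by move=> g z Hg; apply: d1M; [exact: F1|exact: G1].
- move=> rho e e0; have [B B0 HB] := F3 rho; have [B' B'0 HB'] := G3 rho.
  pose L := B + B' + 1; have L0 : 0 < L by rewrite ltr_wpDl ?addr_ge0.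
  have e2 : 0 < e / 2 / L by rewrite !divr_gt0.
  have [d d0 Hd] := F2 rho _ e2; have [d' d'0 Hd'] := G2 rho _ e2.
  exists (Num.min d d'); first by rewrite lt_min d0.
  move=> x y hx hy hxy.
  have h1 : nm (F x - F y) <= e / 2 / L.
    by apply: Hd => // i; have := hxy i; rewrite lt_min => /andP [].
  have h2 : nm (G x - G y) <= e / 2 / L.
    by apply: Hd' => // i; have := hxy i; rewrite lt_min => /andP [].
  have -> : F x * G x - F y * G y = F x * (G x - G y) + (F x - F y) * G y by ring.
  rewrite [leRHS]splitr; apply: le_trans (nmD _ _) _; rewrite !nmM; apply: lerD.
    have -> : e / 2 = L * (e / 2 / L) by rewrite [RHS]mulrC mulfVK ?gt_eqF.
    apply: ler_pM => //; [exact: nm_ge0|exact: nm_ge0|].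
    by apply: le_trans (HB x hx) _; rewrite /L -addrA lerDl addr_ge0.
  have -> : e / 2 = e / 2 / L * L by rewrite mulfVK ?gt_eqF.
  apply: ler_pM => //; [exact: nm_ge0|exact: nm_ge0|].
  by apply: le_trans (HB' y hy) _; rewrite /L addrAC lerDr addr_ge0.
- move=> rho; have [B B0 HB] := F3 rho; have [B' B'0 HB'] := G3 rho.
  exists (B * B'); first exact: mulr_ge0.
  by move=> x hx; rewrite nmM; apply: ler_pM; rewrite ?nm_ge0 ?HB ?HB'.
Qed.

Lemma ent_sum (J : Type) (r : seq J) (p : pred J) (G : J -> (I -> C) -> C) :
  (forall j, p j -> ent (G j)) -> ent (fun x => \sum_(j <- r | p j) G j x).
Proof.
move=> H; elim: r => [|j r IH].
  have -> : (fun x => \sum_(j <- [::] | p j) G j x) = (fun _ => 0).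
    by apply/funext => x; rewrite big_nil.
  exact: ent_cst.
have -> : (fun x => \sum_(k <- j :: r | p k) G k x) =
    (fun x => if p j then G j x + \sum_(k <- r | p k) G k x else \sum_(k <- r | p k) G k x).
  by apply/funext => x; rewrite big_cons.
by case pj: (p j) => //; apply: entD => //; exact: H.
Qed.

Lemma entX F k : ent F -> ent (fun x => F x ^+ k).
Proof.
move=> eF; elim: k => [|k IH]; first exact: ent_cst.
have -> : (fun x => F x ^+ k.+1) = (fun x => F x * F x ^+ k).
  by apply/funext => x; rewrite exprS.
exact: entM.
Qed.

(** [taylor_family] controls only an annulus in x_j. The difference between F and its Fejer sum is
    entire in x_j, and the circle of radius 3 rho about a point with |x_j| <= rho lies in 2 rho <=
    |z| <= 4 rho, so the maximum principle carries the estimate inside; its factor 2 is the reason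
    for working with e / 2. *)
Lemma ent_taylor F j rho : ent F -> 0 < rho -> forall e, 0 < e ->
  exists N M, [/\ (0 < N)%N, (0 < M)%N & forall x, pdisc rho x ->
  nm (N%:R^-1 * \sum_(i < N) \sum_(k < N)
    (if (i <= k)%N then x j ^+ (k - i) * AMij M i k (fun t => F (upd x j t)) else 0) - F x) <= e].
Proof.
move=> eF; case: (eF) => [_ H2 H3] r0 e e0.
pose W := {x | pdisc rho x}; pose h (w : W) t := F (upd (sval w) j t).
pose a := Num.min 1 (2 * rho); pose b := Num.max 1 (4 * rho).
have a0 : 0 < a by rewrite lt_min ltr01 mulr_gt0.
have a1 : a <= 1 by rewrite ge_min lexx.
have b1 : 1 <= b by rewrite le_max lexx.
have rb : rho <= b by rewrite le_max; apply/orP; right; rewrite ler_peMl ?ler1n // ltW.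
have pw (w : W) t : nm t <= b -> pdisc b (upd (sval w) j t).
  move=> tb i; rewrite /upd; case: eqP => // _; apply: le_trans rb; exact: (svalP w).
have uh : UB 0 b h.
  split.
    move=> e' e'0; have [d d0 Hd] := H2 b e' e'0; exists d => // w z z' /andP [_ zb] /andP [_ zb'] hd.
    by apply: Hd; [exact: pw|exact: pw|move=> i; rewrite /upd; case: eqP => // _; rewrite subrr nm0].
  by have [B B0 HB] := H3 b; exists B => // w z /andP [_ zb]; apply: HB; exact: pw.
have [N [M [N0 M0 HNM]]] := taylor_family a0 a1 b1 uh (fun w z => ent_d1 _ _ _ eF) (divr_gt0 e0 (ltr0Sn _ 1)).
exists N, M; split=> // x hx; pose w : W := exist _ x hx.
pose g l := N%:R^-1 * \sum_(i < N) \sum_(k < N)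
    (if (i <= k)%N then l ^+ (k - i) * AMij M i k (h w) else 0) - h w l.
have gx : N%:R^-1 * \sum_(i < N) \sum_(k < N)
    (if (i <= k)%N then x j ^+ (k - i) * AMij M i k (fun t => F (upd x j t)) else 0) - F x = g (x j).
  rewrite /g /h /=; congr (_ - F _); apply/funext => i; rewrite /upd; by case: eqP => [->|].
rewrite gx.
have dg z : d1 g z.
  apply: d1B; last exact: ent_d1.
  apply: d1M; first exact: d1_cst.
  apply: d1_sum => i _; apply: d1_sum => k _; case: leqP => _; last exact: d1_cst.
  by apply: d1M; [apply: d1X; exact: d1_id|exact: d1_cst].
have r3 : 0 < 3 * rho by rewrite mulr_gt0.
have -> : e = (e / 2) *+ 2 by rewrite mulr2n; field.
apply: (max_principle dg r3) => t t1.
apply: HNM; rewrite /ann /a /b ge_min le_max; apply/andP; split; apply/orP; right.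
  have := nmD (x j + (3 * rho)%:C * t) (- x j).
  rewrite addrAC subrr add0r nmN nmM nm_real t1 mulr1 (gtr0_norm r3).
  by have := hx j; clear; lra.
apply: le_trans (nmD _ _) _; rewrite nmM nm_real t1 mulr1 (gtr0_norm r3).
by have := hx j; clear; lra.
Qed.

(** Induction on a list l of variables that determine F. The Taylor coefficients in x_j are finite
    combinations of F with x_j frozen at roots of unity; these are functions of the remaining
    variables, and the induction hypothesis approximates each of them. *)
Theorem ent_approx (l : seq I) F : ent F ->
  (forall x y, (forall i, i \in l -> x i = y i) -> F x = F y) ->
  forall rho e, 0 < rho -> 0 < e ->
  exists2 P, pf P & forall x, pdisc rho x -> nm (F x - P x) <= e.
Proof.
elim: l F => [|j l IH] F eF dep rho e r0 e0.
  exists (fun _ => F (fun _ => 0)); first exact: pf_cst.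
  by move=> x _; rewrite (dep x (fun _ => 0)) // subrr nm0 ltW.
have e2 : 0 < e / 2 by rewrite divr_gt0.
have [N [M [N0 M0 HNM]]] := ent_taylor j eF r0 e2.
pose L := \sum_(i < N) \sum_(k < N) rho ^+ (k - i) + 1.
have L0 : 0 < L.
  by rewrite ltr_wpDl // sumr_ge0 // => i _; rewrite sumr_ge0 // => k _; rewrite exprn_ge0 // ltW.
have eL : 0 < e / 2 / L by rewrite divr_gt0.
have ex q : exists P, pf P /\ forall x, pdisc rho x -> nm (F (upd x j (zt R M ^+ q)) - P x) <= e / 2 / L.
  have [] := IH (fun x => F (upd x j (zt R M ^+ q))) _ _ rho (e / 2 / L) r0 eL.
  - exact: ent_freeze.
  - move=> x y xy; apply: dep => i; rewrite /upd inE; case: eqP => //= _; exact: xy.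
  by move=> P pP HP; exists P.
pose P q := sval (cid (ex q)).
have pP q : pf (P q) by have [] := svalP (cid (ex q)).
have HP q x : pdisc rho x -> nm (F (upd x j (zt R M ^+ q)) - P q x) <= e / 2 / L.
  by have [_] := svalP (cid (ex q)); apply.
pose A i k x := M%:R^-1 * \sum_(q < M) P q x * ((zt R M ^+ q) ^+ i * ((zt R M ^+ q)^-1) ^+ k).
pose G x := N%:R^-1 * \sum_(i < N) \sum_(k < N) (if (i <= k)%N then x j ^+ (k - i) * A i k x else 0).
exists G.
  apply: pf_Ml; apply: pf_sum => i; apply: pf_sum => k; case: leqP => _; last exact: pf0.
  apply: pf_MX; apply: pf_Ml; apply: pf_sum => q.
  have [s Hs] := pf_Ml ((zt R M ^+ q) ^+ i * ((zt R M ^+ q)^-1) ^+ k) (pP q).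
  by exists s => x; rewrite -Hs mulrC.
move=> x hx; have := HNM x hx; rewrite nm_sym => h1.
apply: le_trans (nm_tri _ _ _) _; rewrite [leRHS]splitr; apply: lerD; first exact: h1.
rewrite /G -mulrBr -sumrB nmM nmV nm_nat.
have N0' : 0 < N%:R :> R by rewrite ltr0n.
have N1' : 1 <= N%:R :> R by rewrite ler1n.
rewrite ler_pdivrMl //; apply: (@le_trans _ _ (e / 2)); last by rewrite ler_peMl // ltW.
apply: le_trans (nm_sum _ _ _) _.
apply: (@le_trans _ _ (\sum_(i < N) \sum_(k < N) rho ^+ (k - i) * (e / 2 / L))).
  apply: ler_sum => i _; rewrite -sumrB; apply: le_trans (nm_sum _ _ _) _.
  apply: ler_sum => k _; case: leqP => _; last first.
    by rewrite subrr nm0 mulr_ge0 ?exprn_ge0 // ltW.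
  rewrite -mulrBr nmM nmX; apply: ler_pM; rewrite ?exprn_ge0 ?nm_ge0 //.
    by apply: lerXn2r; rewrite ?nnegrE ?nm_ge0 // ltW.
  rewrite /AMij /A /AM -mulrBr -sumrB nmM nmV nm_nat ler_pdivrMl ?ltr0n //.
  apply: le_trans (nm_sum _ _ _) _.
  apply: (@le_trans _ _ (\sum_(q < M) (e / 2 / L))); last by rewrite sumr_const card_ord mulr_natl.
  apply: ler_sum => q _; have n1 := nm_zt R M q; rewrite -mulrBl nmM; set u := zt R M ^+ q in n1 *.
  by rewrite (nmM (u ^+ i)) (nmX u) (nmX u^-1) nmV n1 invr1 !expr1n !mulr1; exact: HP.
under eq_bigr do rewrite -mulr_suml; rewrite -mulr_suml.
rewrite -[leRHS](mulfVK (lt0r_neq0 L0)) [leRHS]mulrC.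
by apply: ler_wpM2r; [exact: ltW|rewrite /L lerDl].
Qed.

End Entire.

(** * Holomorphic functions on the quadric *)

Section Differentiability.
Variable R : realType.
Local Notation C := (R[i]).
Variable n : nat.
Local Notation vec := 'rV[C]_n.+1.
Implicit Types (z w : vec * vec) (f g : vec * vec -> C).

Definition nmz z : R := \sum_i nm (z.1 0 i) + \sum_i nm (z.2 0 i).

Lemma nrmE z : nrm z = (nmz z)%:C.
Proof.
rewrite /nrm /nmz rmorphD !rmorph_sum /=.
by congr (_ + _); apply: eq_bigr => i _; rewrite nmE.
Qed.

Lemma nmz_ge0 z : 0 <= nmz z.
Proof. by rewrite addr_ge0 // sumr_ge0 // => i _; exact: nm_ge0. Qed.

Lemma nmz_le1 z i : nm (z.1 0 i) <= nmz z.
Proof.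
rewrite /nmz (bigD1 i) //= -addrA lerDl addr_ge0 // sumr_ge0 // => *; exact: nm_ge0.
Qed.

Lemma nmz_le2 z i : nm (z.2 0 i) <= nmz z.
Proof.
rewrite /nmz addrC (bigD1 i) //= -addrA lerDl addr_ge0 // sumr_ge0 // => *; exact: nm_ge0.
Qed.

Lemma nmz_lt z (d : R) : (forall i, nm (z.1 0 i) < d) -> (forall i, nm (z.2 0 i) < d) ->
  nmz z <= d *+ n.+1 *+ 2.
Proof.
move=> h1 h2; rewrite mulr2n /nmz.
have E : d *+ n.+1 = \sum_(i < n.+1) d by rewrite sumr_const card_ord.
by rewrite E lerD // ler_sum // => i _; exact: ltW.
Qed.

Lemma nmz0 : nmz 0 = 0.
Proof. by rewrite /nmz !big1 ?addr0 // => i _; rewrite mxE nm0. Qed.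

Lemma nmz_tri w z1 z2 : nmz (z1 - z2) <= nmz (z1 - w) + nmz (w - z2).
Proof.
rewrite /nmz -!big_split /=; apply: ler_sum => i _.
by rewrite !mxE addrACA; apply: lerD; exact: nm_tri.
Qed.

Lemma subpE w z : subp w z = w - z.
Proof. by []. Qed.

Definition linf (c d : vec) (k : vec * vec) : C := \sum_i c 0 i * k.1 0 i + \sum_i d 0 i * k.2 0 i.

Lemma linf_bound c d : exists2 K : R, 0 < K & forall k, nm (linf c d k) <= K * nmz k.
Proof.
exists (\sum_i nm (c 0 i) + \sum_i nm (d 0 i) + 1).
  by rewrite ltr_wpDl // addr_ge0 // sumr_ge0 // => *; exact: nm_ge0.
move=> k; apply: le_trans (nmD _ _) _.
apply: (@le_trans _ _ ((\sum_i nm (c 0 i)) * nmz k + (\sum_i nm (d 0 i)) * nmz k)).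
  rewrite !mulr_suml; apply: lerD; apply: le_trans (nm_sum _ _ _) _; apply: ler_sum => i _;
    rewrite nmM ler_wpM2l ?nm_ge0 ?nmz_le1 ?nmz_le2 //.
by rewrite -mulrDl; apply: ler_wpM2r; [exact: nmz_ge0|rewrite lerDl].
Qed.

Lemma cdiffP g z : cdiff g z <-> exists c d : vec, forall e : R, 0 < e ->
  exists2 dl : R, 0 < dl & forall k, nmz k < dl ->
    nm (g (z + k) - g z - linf c d k) <= e * nmz k.
Proof.
split=> -[c [d H]]; exists c, d => e e0.
  have [] := H e%:C; first by rewrite ltcR.
  move=> dl [/gt0c [dl' dl0 ->] Hd]; exists dl' => // -[h k] hk.
  by have := Hd h k; rewrite nrmE ltcR => /(_ hk); rewrite -rmorphM nm_lec.
have [e' e'0 ->] := gt0c e0; have [dl dl0 Hd] := H e' e'0.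
exists dl%:C; rewrite ltcR; split=> // h k; rewrite nrmE ltcR => hk.
by rewrite -rmorphM nm_lec; exact: (Hd (h, k)).
Qed.

Lemma cdiff_cont g z : cdiff g z -> forall e : R, 0 < e -> exists2 d : R, 0 < d &
  forall w, nmz (w - z) < d -> nm (g w - g z) <= e.
Proof.
move=> /cdiffP [c [d Hd]] e e0; have [dl dl0 {}Hd] := Hd 1 ltr01.
have [K K0 HK] := linf_bound c d.
have K1 : 0 < 1 + K by rewrite addr_gt0.
exists (Num.min dl (e / (1 + K))); first by rewrite lt_min dl0 divr_gt0.
move=> w; rewrite lt_min => /andP [h1 h2].
have := Hd _ h1; rewrite [z + _]addrC subrK mul1r => h3.
rewrite -(subrK (linf c d (w - z)) (g w - g z)).
apply: le_trans (nmD _ _) _; apply: le_trans (lerD h3 (HK _)) _.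
rewrite -{1}[nmz _]mul1r -mulrDl mulrC -ler_pdivlMr //; exact: ltW.
Qed.

Lemma cdiff_cst c z : cdiff (fun _ => c) z.
Proof.
apply/cdiffP; exists 0, 0 => e e0; exists 1 => // k _.
rewrite /linf !big1 => [|i _|i _]; rewrite ?mxE ?mul0r //.
by rewrite subrr addr0 subr0 nm0 mulr_ge0 ?nmz_ge0 // ltW.
Qed.

Lemma cdiff_lin c d z : cdiff (linf c d) z.
Proof.
apply/cdiffP; exists c, d => e e0; exists 1 => // k _.
have -> : linf c d (z + k) - linf c d z - linf c d k = 0.
  rewrite /linf /=; under eq_bigr do rewrite mxE mulrDr.
  under [X in _ + X - _ - _]eq_bigr do rewrite mxE mulrDr.
  by rewrite !big_split /=; ring.
by rewrite nm0 mulr_ge0 ?nmz_ge0 // ltW.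
Qed.

Lemma cdiff_ext f g z : (forall w, f w = g w) -> cdiff f z -> cdiff g z.
Proof. by move=> fg; have -> : f = g by exact/funext. Qed.

Lemma cdiff_coord1 i z : cdiff (fun w => w.1 0 i) z.
Proof.
apply: (cdiff_ext _ (cdiff_lin (delta_mx 0 i) 0 z)) => w; rewrite /linf (bigD1 i) //=.
rewrite mxE !eqxx mul1r !big1 ?addr0 // => j; first [by move=> _; rewrite mxE mul0r | by move=> /negPf ij; rewrite mxE ij andbF mul0r].
Qed.

Lemma cdiff_coord2 i z : cdiff (fun w => w.2 0 i) z.
Proof.
apply: (cdiff_ext _ (cdiff_lin 0 (delta_mx 0 i) z)) => w; rewrite /linf addrC (bigD1 i) //=.
rewrite mxE !eqxx mul1r !big1 ?addr0 // => j; first [by move=> _; rewrite mxE mul0r | by move=> /negPf ij; rewrite mxE ij andbF mul0r].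
Qed.

Lemma cdiffD f g z : cdiff f z -> cdiff g z -> cdiff (fun w => f w + g w) z.
Proof.
move=> /cdiffP [c [d Hf]] /cdiffP [c' [d' Hg]].
apply/cdiffP; exists (c + c'), (d + d') => e e0; have e2 : 0 < e / 2 by rewrite divr_gt0.
have [d1 d10 {}Hf] := Hf _ e2; have [d2 d20 {}Hg] := Hg _ e2.
exists (Num.min d1 d2); first by rewrite lt_min d10.
move=> k; rewrite lt_min => /andP [/Hf h1 /Hg h2].
have -> : f (z + k) + g (z + k) - (f z + g z) - linf (c + c') (d + d') k =
   (f (z + k) - f z - linf c d k) + (g (z + k) - g z - linf c' d' k).
  rewrite /linf; under eq_bigr do rewrite mxE mulrDl.
  under [X in _ - (_ + X) = _]eq_bigr do rewrite mxE mulrDl.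
  by rewrite !big_split /=; ring.
by apply: le_trans (nmD _ _) _; apply: le_trans (lerD h1 h2) _; rewrite -mulrDl -splitr.
Qed.

Lemma cdiffM f g z : cdiff f z -> cdiff g z -> cdiff (fun w => f w * g w) z.
Proof.
move=> df dg; have cg := cdiff_cont dg; move: df dg.
move=> /cdiffP [c [d Hf]] /cdiffP [c' [d' Hg]].
apply/cdiffP; exists (g z *: c + f z *: c'), (g z *: d + f z *: d') => e e0.
have [K K0 HK] := linf_bound c d.
pose A := nm (g z) + 1; pose B := nm (f z) + 1.
have A0 : 0 < A by rewrite ltr_wpDl ?nm_ge0.
have B0 : 0 < B by rewrite ltr_wpDl ?nm_ge0.
have e3 : 0 < e / 3 by rewrite divr_gt0.
have [d1 d10 {}Hf] := Hf _ (divr_gt0 e3 A0); have [d2 d20 {}Hg] := Hg _ (divr_gt0 e3 B0).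
have [d3 d30 Hc] := cg _ (divr_gt0 e3 K0); have [d4 d40 Hc1] := cg _ ltr01.
exists (Num.min (Num.min d1 d2) (Num.min d3 d4)); first by rewrite !lt_min d10 d20 d30.
move=> k; rewrite !lt_min => /andP [/andP [/Hf h1 /Hg h2] /andP [h3 h4]].
have {}h3 : nm (g (z + k) - g z) <= e / 3 / K by apply: Hc; rewrite addrC addKr.
have {}h4 : nm (g (z + k)) <= A.
  rewrite /A -(subrK (g z) (g (z + k))) addrC; apply: le_trans (nmD _ _) _.
  by rewrite lerD2l; apply: Hc1; rewrite addrC addKr.
have -> : linf (g z *: c + f z *: c') (g z *: d + f z *: d') k =
    g z * linf c d k + f z * linf c' d' k.
  rewrite /linf; under eq_bigr do rewrite !mxE mulrDl -!mulrA.
  under [X in _ + X = _]eq_bigr do rewrite !mxE mulrDl -!mulrA.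
  by rewrite !big_split /= -!mulr_sumr; ring.
have -> : f (z + k) * g (z + k) - f z * g z - (g z * linf c d k + f z * linf c' d' k) =
   (f (z + k) - f z - linf c d k) * g (z + k) + linf c d k * (g (z + k) - g z) +
   f z * (g (z + k) - g z - linf c' d' k) by ring.
have -> : e * nmz k = e / 3 * nmz k + e / 3 * nmz k + e / 3 * nmz k by field.
have N0 := nmz_ge0 k.
apply: le_trans (nmD _ _) _; apply: lerD.
  apply: le_trans (nmD _ _) _; rewrite !nmM; apply: lerD.
    apply: (@le_trans _ _ (e / 3 / A * nmz k * A)); first by apply: ler_pM; rewrite ?nm_ge0.
    by rewrite mulrAC mulfVK ?gt_eqF.
  apply: (@le_trans _ _ (K * nmz k * (e / 3 / K))); first by apply: ler_pM; rewrite ?nm_ge0.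
  by rewrite mulrC mulrA mulfVK ?gt_eqF.
rewrite nmM; apply: (@le_trans _ _ (B * (e / 3 / B * nmz k))).
  by apply: ler_pM; rewrite ?nm_ge0 // /B lerDl.
by rewrite mulrA [B * _]mulrC mulfVK ?gt_eqF.
Qed.

Lemma cdiff_sum (J : Type) (r : seq J) (p : pred J) (F : J -> vec * vec -> C) z :
  (forall j, cdiff (F j) z) -> cdiff (fun w => \sum_(j <- r | p j) F j w) z.
Proof.
move=> H; elim: r => [|j r IH].
  by apply: (cdiff_ext _ (cdiff_cst 0 z)) => w; rewrite big_nil.
case pj: (p j); last by apply: (cdiff_ext _ IH) => w; rewrite big_cons pj.
by apply: (cdiff_ext _ (cdiffD (H j) IH)) => w; rewrite big_cons pj.
Qed.

Lemma cdiff_prod (J : Type) (r : seq J) (p : pred J) (F : J -> vec * vec -> C) z :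
  (forall j, cdiff (F j) z) -> cdiff (fun w => \prod_(j <- r | p j) F j w) z.
Proof.
move=> H; elim: r => [|j r IH].
  by apply: (cdiff_ext _ (cdiff_cst 1 z)) => w; rewrite big_nil.
case pj: (p j); last by apply: (cdiff_ext _ IH) => w; rewrite big_cons pj.
by apply: (cdiff_ext _ (cdiffM (H j) IH)) => w; rewrite big_cons pj.
Qed.

Lemma cdiffX f (m : nat) z : cdiff f z -> cdiff (fun w => f w ^+ m) z.
Proof.
move=> H; elim: m => [|m IH]; first exact: cdiff_cst.
by apply: (cdiff_ext _ (cdiffM H IH)) => w; rewrite exprS.
Qed.

(** The antiholomorphic involution whose fixed points on the quadric are the pairs (r, conj r), that
    is, the image of D_n. Conjugating the composite of f with it gives the holomorphic extension of
    the pointwise conjugate. *)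
Definition swapc z : vec * vec := (conjv z.2, conjv z.1).

Lemma nmz_swapc z : nmz (swapc z) = nmz z.
Proof.
by rewrite /nmz /= addrC; congr (_ + _); apply: eq_bigr => i _; rewrite mxE nm_conj.
Qed.

Lemma swapcD z w : swapc (z + w) = swapc z + swapc w.
Proof. by rewrite /swapc /conjv /= !raddfD. Qed.

Lemma cdiff_swapc f z : cdiff f (swapc z) -> cdiff (fun w => Num.conj (f (swapc w))) z.
Proof.
move=> /cdiffP [c [d H]]; apply/cdiffP; exists (conjv d), (conjv c) => e e0.
have [dl dl0 Hd] := H e e0; exists dl => // k kd.
have := Hd (swapc k); rewrite nmz_swapc => /(_ kd); rewrite -nm_conj.
rewrite !rmorphB /= swapcD; congr (nm (_ - _) <= _).
rewrite /linf rmorphD /= !rmorph_sum addrC.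
by congr (_ + _); apply: eq_bigr => i _; rewrite rmorphM /swapc /conjv /= !mxE conjCK.
Qed.

(** Differentiable coordinates make a curve Lipschitz at s, which turns a remainder measured in the
    ambient space into one measured in the curve parameter. *)
Lemma d1_lip_sum (J : Type) (r : seq J) (u : J -> C -> C) (s : C) :
  (forall j, d1 (u j) s) -> exists2 K : R, 0 < K & exists2 d : R, 0 < d &
  forall k, nm k < d -> \sum_(j <- r) nm (u j (s + k) - u j s) <= K * nm k.
Proof.
move=> H; elim: r => [|j r [K K0 [d d0 Hd]]].
  by exists 1 => //; exists 1 => // k _; rewrite big_nil mul1r nm_ge0.
have [ph Hp [d1 d10 Hd1]] := H j; have [K' K'0 [d2 d20 Hd2]] := ct0_bd Hp.
exists (K' + K); first exact: addr_gt0.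
exists (Num.min d (Num.min d1 d2)); first by rewrite !lt_min d0 d10.
move=> k; rewrite !lt_min => /and3P [/Hd h /Hd1 h1 /Hd2 h2].
rewrite big_cons mulrDl; apply: lerD => //.
by rewrite h1 nmM ler_wpM2r ?nm_ge0.
Qed.

(** f has only local holomorphic extensions off the quadric. Differentiation at s uses a single one,
    around [ga s], and the curve must stay on the quadric near s for f and the extension to agree
    along it. *)
Lemma holo_curve f (ga : C -> vec * vec) (s : C) : holo_on_Zhat f ->
  (forall i, d1 (fun t => (ga t).1 0 i) s) -> (forall i, d1 (fun t => (ga t).2 0 i) s) ->
  (exists2 dl : R, 0 < dl & forall k, nm k < dl -> in_Zhat (ga (s + k))) ->
  d1 (fun t => f (ga t)) s.
Proof.
move=> hf h1 h2 [dl dl0 Hz].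
have z0 : in_Zhat (ga s) by have := Hz 0; rewrite nm0 addr0; exact.
have [d [/gt0c [d' d'0 ->] [g [gd fg]]]] := hf _ z0.
have nn0 : nmz (ga s - ga s) = 0 by rewrite subrr nmz0.
have /cdiffP [c [c' Hg]] : cdiff g (ga s).
  by apply: gd; rewrite nrmE subpE nn0 ltcR.
have fgs : f (ga s) = g (ga s) by apply: fg => //; rewrite nrmE subpE nn0 ltcR.
have [K1 K10 [dK1 dK10 HK1]] := d1_lip_sum (index_enum _) h1.
have [K2 K20 [dK2 dK20 HK2]] := d1_lip_sum (index_enum _) h2.
have K0 : 0 < K1 + K2 by rewrite addr_gt0.
have lip k : nm k < Num.min dK1 dK2 -> nmz (ga (s + k) - ga s) <= (K1 + K2) * nm k.
  rewrite lt_min mulrDl => /andP [/HK1 a /HK2 b]; apply: le_trans (lerD a b).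
  by apply: lerD; apply: ler_sum => i _; rewrite !mxE.
have /d1_eps [m Hm] : d1 (fun t => linf c c' (ga t - ga s)) s.
  apply: d1D; apply: d1_sum => i _; apply: d1M; rewrite ?mxE; try exact: d1_cst.
    apply: (d1_near (d1B (h1 i) (d1_cst ((ga s).1 0 i) s))).
    by exists 1 => // k _; rewrite !mxE.
  apply: (d1_near (d1B (h2 i) (d1_cst ((ga s).2 0 i) s))).
  by exists 1 => // k _; rewrite !mxE.
have l0 : linf c c' (ga s - ga s) = 0.
  by rewrite subrr /linf !big1 ?addr0 // => i _; rewrite mxE mulr0.
apply/d1_eps; exists m => e e0; have e2 : 0 < e / 2 by rewrite divr_gt0.
have [a a0 {}Hm] := Hm _ e2.
have [b b0 {}Hg] := Hg _ (divr_gt0 e2 K0).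
pose mb := Num.min b d'; have mb0 : 0 < mb by rewrite lt_min b0.
exists (Num.min (Num.min dl a) (Num.min (Num.min dK1 dK2) (mb / (K1 + K2)))).
  by rewrite !lt_min dl0 a0 dK10 dK20 divr_gt0.
move=> k; rewrite lt_min => /andP []; rewrite lt_min => /andP [/Hz hz /Hm hm].
rewrite lt_min => /andP [/lip hl].
rewrite ltr_pdivlMr // mulrC => /(le_lt_trans hl); rewrite lt_min => /andP [hb hd].
have := Hg _ hb; rewrite [ga s + _]addrC subrK => hg.
have -> : f (ga (s + k)) = g (ga (s + k)) by apply: fg => //; rewrite nrmE subpE ltcR.
rewrite fgs; rewrite l0 subr0 in hm.
rewrite -(subrK (linf c c' (ga (s + k) - ga s)) (g _ - g _)) -addrA.
apply: le_trans (nmD _ _) _; rewrite (splitr e) mulrDl; apply: lerD => //.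
apply: le_trans hg _; rewrite -mulrA; apply: ler_wpM2l; first exact: ltW.
by rewrite ler_pdivrMl.
Qed.

Lemma holo_cont f z : holo_on_Zhat f -> in_Zhat z -> forall e : R, 0 < e ->
  exists2 d : R, 0 < d & forall w, in_Zhat w -> nmz (w - z) < d -> nm (f w - f z) <= e.
Proof.
move=> hf zz e e0; have [d [/gt0c [d' d'0 ->] [g [gd fg]]]] := hf _ zz.
have nn0 : nmz (z - z) = 0 by rewrite subrr nmz0.
have [b b0 Hb] : exists2 b : R, 0 < b & forall w, nmz (w - z) < b -> nm (g w - g z) <= e.
  by apply: cdiff_cont => //; apply: gd; rewrite nrmE subpE nn0 ltcR.
exists (Num.min b d'); first by rewrite lt_min b0.
move=> w wz; rewrite lt_min => /andP [/Hb h1 h2].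
by rewrite !fg // nrmE subpE ?nn0 ltcR.
Qed.

Definition quad z : C := - (z.1 0 ord0 * z.2 0 ord0) + \sum_(i < n.+1 | i != ord0) z.1 0 i * z.2 0 i.

Lemma cdiff_quad z : cdiff quad z.
Proof.
apply: cdiffD; last by apply: cdiff_sum => i; apply: cdiffM; [exact: cdiff_coord1|exact: cdiff_coord2].
apply: (@cdiff_ext (fun w => -1 * (w.1 0 ord0 * w.2 0 ord0))); first by move=> w; rewrite mulN1r.
by apply: cdiffM (cdiff_cst _ _) (cdiffM _ _); [exact: cdiff_coord1|exact: cdiff_coord2].
Qed.

Definition box (rho : R) z := (forall i, nm (z.1 0 i) <= rho) /\ (forall i, nm (z.2 0 i) <= rho).

(* Heine-Borel for polydiscs, as a uniformisation principle for local properties. *)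
Lemma box_cover (P : R -> vec * vec -> Prop) :
  (forall d d' z, d' <= d -> P d z -> P d' z) ->
  (forall z, exists2 d : R, 0 < d & forall w, nmz (w - z) < d -> P d w) ->
  forall rho, exists2 d : R, 0 < d & forall z, box rho z -> P d z.
Proof.
move=> mono loc rho.
pose T : Type := ('rV[R]_n.+1 * 'rV[R]_n.+1 * ('rV[R]_n.+1 * 'rV[R]_n.+1))%type.
pose A : set 'rV[R]_n.+1 := [set v | forall i, (`[(- rho), rho]%classic : set R) (v ord0 i)]%classic.
have cA : compact A by apply: (@rV_compact R n.+1 (fun=> `[(- rho), rho]%classic)) => i; exact: segment_compact.
have cK : compact ((A `*` A) `*` (A `*` A))%classic.
  by apply: compact_setX; apply: compact_setX.
pose zz (v : T) : vec * vec :=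
  (\row_i ((v.1.1 0 i) +i* (v.1.2 0 i)), \row_i ((v.2.1 0 i) +i* (v.2.2 0 i))).
pose Kset := ((A `*` A) `*` (A `*` A))%classic.
have H : \forall t \near at_right (0 : R), (Kset `<=` (fun v => P t (zz v)))%classic.
  apply: (compact_near_coveringP Kset).1 => //= v _; have [d d0 Hd] := loc (zz v).
  have N0 : 0 < n.+1%:R :> R by rewrite ltr0n.
  pose ep := d / (n.+1%:R * 8); have ep0 : 0 < ep by rewrite divr_gt0 // mulr_gt0.
  near=> v' t => /=.
  have td : t <= d by near: t; exact: nbhs_right_le.
  apply: mono td _; apply: Hd.
  have : ball v ep v' by near: v'; exact: nbhsx_ballx.
  move=> [[b1 b2] [b3 b4]].
  have bb (a a' c c' : 'rV[R]_n.+1) i : ball a ep a' -> ball c ep c' ->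
      nm (a' 0 i +i* c' 0 i - (a 0 i +i* c 0 i)) < ep + ep.
    move=> [_ /(_ 0 i)]; rewrite /ball /= distrC => h1 [_ /(_ 0 i)]; rewrite /ball /= distrC => h2.
    by apply: le_lt_trans (nm_le_ReIm _) _; apply: ltrD.
  have E : d = (ep + ep) *+ n.+1 *+ 2 *+ 2.
    rewrite -(mulr_natr _ n.+1) !mulr2n /ep.
    by move: N0; move: (n.+1%:R) => N N0; field; rewrite gt_eqF.
  have e40 : 0 < (ep + ep) *+ n.+1 *+ 2 by rewrite mulrn_wgt0 // mulrn_wgt0 // addr_gt0.
  apply: (@le_lt_trans _ _ ((ep + ep) *+ n.+1 *+ 2)); last by rewrite [ltRHS]E [ltRHS]mulr2n ltrDl.
  by apply: nmz_lt => i; rewrite !mxE; apply: bb.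
have {H} /nbhs_ballP [d /= d0 Hd] := H.
exists (d / 2); first by rewrite divr_gt0.
move=> z [z1 z2].
have := Hd (d / 2); rewrite /ball /= sub0r normrN gtr0_norm ?divr_gt0 //.
rewrite ltr_pdivrMr // ltr_pMr // ltr1n => /(_ isT isT).
pose v : T := ((\row_i complex.Re (z.1 0 i), \row_i complex.Im (z.1 0 i)),
               (\row_i complex.Re (z.2 0 i), \row_i complex.Im (z.2 0 i))).
have vz : zz v = z.
  by rewrite /zz /v /=; case: (z) => p q /=; congr (_, _); apply/rowP => i; rewrite !mxE; case: (_ 0 i).
have Re_le (u : vec) i : nm (u 0 i) <= rho -> - rho <= complex.Re (u 0 i) <= rho.
  by move=> h; rewrite -ler_norml; apply: le_trans (nm_Re _) h.
have Im_le (u : vec) i : nm (u 0 i) <= rho -> - rho <= complex.Im (u 0 i) <= rho.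
  by move=> h; rewrite -ler_norml; apply: le_trans (nm_Im _) h.
move=> /(_ v); rewrite vz; apply; split; split => i /=; rewrite mxE in_itv /=;
  by [apply: Re_le; rewrite ?z1 ?z2|apply: Im_le; rewrite ?z1 ?z2].
Unshelve. all: by end_near. Qed.

(** The quadric is closed; this makes the local conditions fed into [box_cover] vacuous near points
    off it. *)
Lemma notin_Zhat_near z : ~ in_Zhat z -> exists2 d : R, 0 < d &
  forall w, nmz (w - z) < d -> ~ in_Zhat w.
Proof.
move=> zz; have e0 : 0 < nm (quad z + 1).
  by rewrite nm_gt0 addr_eq0; apply/eqP => h; exact: zz.
have [d d0 Hd] := cdiff_cont (cdiff_quad z) (divr_gt0 e0 (ltr0Sn _ 1)).
exists d => // w /Hd hw wz; move: hw; have -> : quad w = -1 by exact: wz.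
by rewrite nm_sym opprK; move: e0; clear; move: (nm _) => X; lra.
Qed.

Lemma holo_box_bounded f : holo_on_Zhat f -> forall rho, exists2 B : R, 0 <= B &
  forall z, in_Zhat z -> box rho z -> nm (f z) <= B.
Proof.
move=> hf rho.
(* The bound is encoded as the inverse of a scale, so that a uniform scale is a uniform bound; the
   guard [0 < d] makes the property monotone in d. *)
have [||d d0 Hd] := @box_cover (fun d z => in_Zhat z -> 0 < d -> nm (f z) <= d^-1) _ _ rho.
- move=> d d' z dd H zz d'0; have d0 := lt_le_trans d'0 dd.
  by apply: le_trans (H zz d0) _; rewrite lef_pV2.
- move=> z; case: (pselect (in_Zhat z)) => zz; last first.
    by have [d d0 Hd] := notin_Zhat_near zz; exists d => // w /Hd.
  have [d d0 Hd] := holo_cont hf zz ltr01.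
  have B0 : 0 < nm (f z) + 1 by rewrite ltr_wpDl ?nm_ge0.
  exists (Num.min d (nm (f z) + 1)^-1); first by rewrite lt_min d0 invr_gt0.
  move=> w; rewrite lt_min => /andP [wd _] wz m0.
  apply: (@le_trans _ _ (nm (f z) + 1)).
    rewrite -(subrK (f z) (f w)) addrC; apply: le_trans (nmD _ _) _; rewrite lerD2l.
    exact: Hd.
  by rewrite -[leLHS]invrK lef_pV2 ?posrE ?invr_gt0 // ge_min lexx orbT.
exists d^-1; first by rewrite invr_ge0 ltW.
by move=> z zz bz; exact: Hd.
Qed.

Lemma holo_box_uc f : holo_on_Zhat f -> forall rho e, 0 < e -> exists2 d : R, 0 < d &
  forall z w, in_Zhat z -> in_Zhat w -> box rho z -> nmz (w - z) < d -> nm (f w - f z) <= e.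
Proof.
move=> hf rho e e0; have e2 : 0 < e / 2 by rewrite divr_gt0.
have [||d d0 Hd] := @box_cover (fun d z => in_Zhat z -> forall w, in_Zhat w -> nmz (w - z) < d ->
   nm (f w - f z) <= e) _ _ rho.
- move=> d d' z dd H zz w wz wd; apply: H => //; exact: lt_le_trans dd.
- move=> z; case: (pselect (in_Zhat z)) => zz; last first.
    by have [d d0 Hd] := notin_Zhat_near zz; exists d => // w /Hd.
  have [d d0 Hd] := holo_cont hf zz e2.
  exists (d / 2); first by rewrite divr_gt0.
  move=> w wd wz w' wz' wd'.
  have d2 : d / 2 < d by rewrite ltr_pdivrMr // ltr_pMr // ltr1n.
  rewrite (splitr e); apply: le_trans (nm_tri (f z) _ _) _; apply: lerD.
    apply: Hd => //; apply: le_lt_trans (nmz_tri w _ _) _; rewrite [ltRHS]splitr; exact: ltrD.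
  by rewrite nm_sym; apply: Hd => //; apply: lt_trans d2.
by exists d => // z w zz wz bz; apply: Hd.
Qed.

End Differentiability.

(** * Density of invariant polynomials *)

Section Density.
Variable R : realType.
Local Notation C := (R[i]).
Variable n : nat.
Local Notation vec := 'rV[C]_n.+1.
Local Notation AM := (@AM R).
Local Notation I := (bool * 'I_n.+1)%type.
Implicit Types (x y : I -> C) (f : vec * vec -> C).

Lemma fin_pos (T : finType) (P : T -> R -> Prop) :
  (forall i d d', d' <= d -> P i d -> P i d') -> (forall i, exists2 d, 0 < d & P i d) ->
  exists2 d, 0 < d & forall i, P i d.
Proof.
move=> mono H; pose D i := s2val (cid2 (H i)).
have D0 i : 0 < D i by exact: (s2valP (cid2 (H i))).
exists (\big[Num.min/1]_i D i); first by elim/big_rec: _ => // i x _ x0; rewrite lt_min D0.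
move=> i; apply: mono (s2valP' (cid2 (H i))); exact: bigmin_le.
Qed.

Definition zcoord (b : bool) (i : 'I_n.+1) (z : vec * vec) : C := if b then z.1 0 i else z.2 0 i.

(** The common core of [ent_holo] and [UB_holo], with [near] abstracting closeness of arguments: a
    map with bounded coordinates lands in a polydisc, on which f is bounded and uniformly
    continuous. *)
Lemma holo_comp_uc (X : Type) (near : R -> X -> X -> Prop) (D : X -> Prop)
    (Ph : X -> vec * vec) f : holo_on_Zhat f ->
  (forall d d' u v, d' <= d -> near d' u v -> near d u v) ->
  (forall u, D u -> in_Zhat (Ph u)) ->
  (forall i : I, exists2 B, 0 <= B & forall u, D u -> nm (zcoord i.1 i.2 (Ph u)) <= B) ->
  (forall (i : I) e, 0 < e -> exists2 d, 0 < d & forall u v, D u -> D v -> near d u v ->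
     nm (zcoord i.1 i.2 (Ph u) - zcoord i.1 i.2 (Ph v)) <= e) ->
  (forall e, 0 < e -> exists2 d, 0 < d & forall u v, D u -> D v -> near d u v ->
     nm (f (Ph u) - f (Ph v)) <= e) /\
  (exists2 B, 0 <= B & forall u, D u -> nm (f (Ph u)) <= B).
Proof.
move=> hf mono hz hb hu.
pose B i := s2val (cid2 (hb i)); have B0 i : 0 <= B i by exact: (s2valP (cid2 (hb i))).
pose rho := \sum_i B i.
have bx u : D u -> box rho (Ph u).
  move=> Du; have H i : nm (zcoord i.1 i.2 (Ph u)) <= rho.
    apply: le_trans (s2valP' (cid2 (hb i)) u Du) _; rewrite /rho (bigD1 i) //= lerDl.
    by apply: sumr_ge0 => *.
  by split=> i; [exact: (H (true, i))|exact: (H (false, i))].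
split; last first.
  have [K K0 HK] := holo_box_bounded hf rho.
  by exists K => // u Du; apply: HK; [exact: hz|exact: bx].
move=> e e0; have [d d0 Hd] := holo_box_uc hf rho e0.
have N0 : 0 < n.+1%:R :> R by rewrite ltr0n.
pose ep := d / (n.+1%:R * 8); have ep0 : 0 < ep by rewrite divr_gt0 // mulr_gt0.
have [dl dl0 Hdl] : exists2 dl, 0 < dl & forall i : I, forall u v, D u -> D v -> near dl u v ->
     nm (zcoord i.1 i.2 (Ph u) - zcoord i.1 i.2 (Ph v)) <= ep.
  apply: fin_pos => [i d1 d2 d21 H u v Du Dv nuv|i]; last exact: hu.
  by apply: H => //; apply: mono nuv.
exists dl => // u v Du Dv nuv.
apply: Hd; [exact: hz|exact: hz|exact: bx|].
have E : d = (ep + ep) *+ n.+1 *+ 2 *+ 2.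
  rewrite -(mulr_natr _ n.+1) !mulr2n /ep.
  by move: N0; move: (n.+1%:R) => N N0; field; rewrite gt_eqF.
have e40 : 0 < (ep + ep) *+ n.+1 *+ 2 by rewrite mulrn_wgt0 // mulrn_wgt0 // addr_gt0.
apply: (@le_lt_trans _ _ ((ep + ep) *+ n.+1 *+ 2)); last by rewrite [ltRHS]E [ltRHS]mulr2n ltrDl.
have ee : ep < ep + ep by rewrite ltrDl.
apply: nmz_lt => i; rewrite !mxE; apply: le_lt_trans ee.
  exact: (Hdl (true, i)).
exact: (Hdl (false, i)).
Qed.

Lemma ent_holo f (Ph : (I -> C) -> vec * vec) : holo_on_Zhat f ->
  (forall i : I, ent (fun x => zcoord i.1 i.2 (Ph x))) -> (forall x, in_Zhat (Ph x)) ->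
  ent (fun x => f (Ph x)).
Proof.
move=> hf hP hz.
have key rho := @holo_comp_uc (I -> C) (fun d x y => forall i, nm (x i - y i) < d) (pdisc rho) Ph f hf
  (fun d d' x y (dd : d' <= d) H i => lt_le_trans (H i) dd) (fun x _ => hz x).
split.
- move=> g z Hg; apply: holo_curve => //.
  + by move=> i; have [H _ _] := hP (true, i); exact: H.
  + by move=> i; have [H _ _] := hP (false, i); exact: H.
  + by exists 1.
- move=> rho; have [] := key rho => // i.
    by have [_ _ H] := hP i; exact: H.
  by have [_ H _] := hP i; exact: H.
- move=> rho; have [] := key rho => // i.
    by have [_ _ H] := hP i; exact: H.
  by have [_ H _] := hP i; exact: H.
Qed.

Lemma UB_holo (W : Type) a b f (Ph : W -> C -> vec * vec) : holo_on_Zhat f ->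
  (forall i : I, UB a b (fun w l => zcoord i.1 i.2 (Ph w l))) ->
  (forall w l, ann a b l -> in_Zhat (Ph w l)) -> UB a b (fun w l => f (Ph w l)).
Proof.
move=> hf hP hz.
have [] := @holo_comp_uc (W * C) (fun d u v => u.1 = v.1 /\ nm (u.2 - v.2) < d)
   (fun u => ann a b u.2) (fun u => Ph u.1 u.2) f hf.
- by move=> d d' u v dd [-> h]; split=> //; exact: lt_le_trans dd.
- by move=> [w l]; exact: hz.
- by move=> i; have [_ [B B0 HB]] := hP i; exists B => // -[w l]; exact: HB.
- move=> i e e0; have [H _] := hP i; have [d d0 Hd] := H e e0; exists d => //.
  by move=> [w l] [w' l'] /= al al' [-> h]; exact: Hd.
move=> H1 [B B0 HB]; split.
  move=> e e0; have [d d0 Hd] := H1 e e0; exists d => // w z z' az az' h.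
  exact: (Hd (w, z) (w, z')).
by exists B => // w z; exact: (HB (w, z)).
Qed.

Definition uu x : C := 1 + \sum_(i < n.+1 | i != ord0) x (true, i) * x (false, i).

Lemma ent_uu : ent uu.
Proof.
by apply: entD (ent_cst _ _) _; apply: ent_sum => i _; apply: entM; exact: ent_coord.
Qed.

(** Puts a and b in place of p_0 and q_0. Since [uu x] does not involve these two coordinates, a b =
    [uu x] can be arranged for every x, by (t, uu / t) or by (uu t, 1 / t) with t != 0; these are
    the two charts of the approximant. *)
Definition Phi (a b : C) x : vec * vec :=
  (\row_i (if i == ord0 then a else x (true, i)), \row_i (if i == ord0 then b else x (false, i))).

Lemma Phi_Zhat a b x : a * b = uu x -> in_Zhat (Phi a b x).
Proof.
move=> ab; rewrite /in_Zhat /= !mxE eqxx ab /uu opprD -addrA.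
under [X in _ + (_ + X)]eq_bigr => i i0 do rewrite !mxE (negPf i0).
by rewrite addNr addr0.
Qed.

Lemma zcoord_Phi b i (c d : C) x : zcoord b i (Phi c d x) =
  if i == ord0 then (if b then c else d) else x (b, i).
Proof. by case: b; rewrite /zcoord mxE. Qed.

Lemma ent_Phi f (c d : (I -> C) -> C) : holo_on_Zhat f -> ent c -> ent d ->
  (forall x, c x * d x = uu x) -> ent (fun x => f (Phi (c x) (d x) x)).
Proof.
move=> hf ec ed cd; apply: ent_holo => // [|x]; last exact: Phi_Zhat.
move=> [b i] /=.
have -> : (fun x => zcoord b i (Phi (c x) (d x) x)) =
   if i == ord0 then (if b then c else d) else fun x => x (b, i).
  by apply/funext => x; rewrite zcoord_Phi; case: eqP => _ //; case: b.
by case: eqP => _; [case: b|exact: ent_coord].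
Qed.

Definition coordz (w : vec * vec) : I -> C := fun i => zcoord i.1 i.2 w.

Lemma uu_coordz w : in_Zhat w -> uu (coordz w) = w.1 0 ord0 * w.2 0 ord0.
Proof.
rewrite /in_Zhat /uu /coordz /= => h.
by rewrite -[X in 1 + X](addNKr (w.1 0 ord0 * w.2 0 ord0)) h addrC subrK.
Qed.

Lemma Phi_coordz (w : vec * vec) : Phi (w.1 0 ord0) (w.2 0 ord0) (coordz w) = w.
Proof.
case: w => p q; rewrite /Phi /coordz; congr (_, _); apply/rowP => i; rewrite mxE /=;
  by case: eqP => [->|].
Qed.

(* The entire approximant of f: the Fejer sum of the Laurent expansion of f
   along t |-> (t p0, p'; q0 / t, q'), nonnegative weights being expanded in the
   chart p0 = 1 and negative ones in the chart q0 = 1. *)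
Definition approxQ f N M x : C :=
  N%:R^-1 * \sum_(i < N) \sum_(j < N)
    (if (i <= j)%N
     then x (true, ord0) ^+ (j - i) * AMij M i j (fun t => f (Phi t (uu x * t^-1) x))
     else x (false, ord0) ^+ (i - j) * AMij M i j (fun t => f (Phi (uu x * t) t^-1 x))).

Lemma ent_AMij M i j (F : C -> (I -> C) -> C) : (forall t, t != 0 -> ent (F t)) ->
  ent (fun x => AMij M i j (fun t => F t x)).
Proof.
move=> H; apply: entM (ent_cst _ _) _; apply: ent_sum => q _.
by apply: entM (ent_cst _ _); apply: H; rewrite expf_neq0 // zt_neq0.
Qed.

(** Roots of unity are nonzero, so every sampled value of f is taken at a point of the quadric that
    is polynomial in x. *)
Lemma ent_approxQ f N M : holo_on_Zhat f -> ent (approxQ f N M).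
Proof.
move=> hf; apply: entM (ent_cst _ _) _; apply: ent_sum => i _; apply: ent_sum => j _.
case: leqP => _; apply: entM (entX _ (ent_coord _ _)) _.
  apply: (@ent_AMij _ _ _ (fun t x => f (Phi t (uu x * t^-1) x))) => t t0.
  apply: (ent_Phi hf) => [||x]; first exact: ent_cst.
    exact: entM ent_uu (ent_cst _ _).
  by rewrite mulrC mulfVK.
apply: (@ent_AMij _ _ _ (fun t x => f (Phi (uu x * t) t^-1 x))) => t t0.
apply: (ent_Phi hf) => [||x]; [|exact: ent_cst|by rewrite mulfK].
exact: entM ent_uu (ent_cst _ _).
Qed.

(** [laurent_family] with l = p_0 and m = q_0: on the quadric l m = [uu x], so the coefficients on
    the circle through l m are averages of f in the chart (uu t, 1 / t). *)
Lemma approxQ_annulus f rho a b : holo_on_Zhat f -> 0 < a -> a <= 1 -> 1 <= b ->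
  forall e, 0 < e -> exists N M, forall w, in_Zhat w -> box rho w ->
    ann a b (w.1 0 ord0) -> ann a b (w.1 0 ord0 * w.2 0 ord0) ->
    nm (approxQ f N M (coordz w) - f w) <= e.
Proof.
move=> hf a0 a1 b1 e e0.
pose W := {x : I -> C | pdisc rho x}.
pose h (w : W) l := f (Phi l (uu (sval w) * l^-1) (sval w)).
have az l : ann a b l -> l != 0.
  by move=> /andP [l1 _]; rewrite -nm_gt0 (lt_le_trans a0).
have uh : UB a b h.
  apply: (@UB_holo W a b f (fun w l => Phi l (uu (sval w) * l^-1) (sval w)) hf).
    move=> [c i] /=.
    have -> : (fun w l => zcoord c i (Phi l (uu (sval w) * l^-1) (sval w))) =
       if i == ord0 then (if c then fun (w : W) l => l else fun w l => uu (sval w) * l^-1)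
       else fun w l => sval w (c, i).
      by apply/funext => w; apply/funext => l; rewrite zcoord_Phi; case: eqP => _ //; case: c.
    have cst (F : (I -> C) -> C) : ent F -> UB a b (fun (w : W) l => F (sval w)).
      move=> [_ _ /(_ rho) [B B0 HB]]; split.
        by move=> e' e'0; exists 1 => // *; rewrite subrr nm0 ltW.
      by exists B => // w l _; apply: HB; exact: (svalP w).
    case: eqP => _; last by apply: (cst (fun x => x (c, i))); exact: ent_coord.
    case: c; first exact: UB_id.
    by apply: UB_mul; [exact: (cst uu ent_uu)|exact: UB_inv].
  by move=> w l /az l0; apply: Phi_Zhat; rewrite mulrC mulfVK.
have dh (w : W) z : z != 0 -> d1 (h w) z.
  move=> z0; apply: (@holo_curve _ _ f (fun l => Phi l (uu (sval w) * l^-1) (sval w)) z hf).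
  - move=> i; have [i0|i0] := eqVneq i ord0.
      by apply: (d1_near (d1_id z)); exists 1 => // k _; rewrite mxE i0 eqxx.
    by apply: (d1_near (d1_cst (sval w (true, i)) z)); exists 1 => // k _; rewrite mxE (negPf i0).
  - move=> i; have [i0|i0] := eqVneq i ord0.
      apply: (d1_near (d1M (d1_cst (uu (sval w)) z) (d1V (d1_id z) z0))).
      by exists 1 => // k _; rewrite mxE i0 eqxx.
    by apply: (d1_near (d1_cst (sval w (false, i)) z)); exists 1 => // k _; rewrite mxE (negPf i0).
  - exists (nm z); first by rewrite nm_gt0.
    move=> k kz; have zk : z + k != 0.
      by apply: contraTneq kz => /eqP; rewrite addrC addr_eq0 => /eqP ->; rewrite nmN ltxx.
    by apply: Phi_Zhat; rewrite mulrC mulfVK.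
have [N [M [N0 M0 HNM]]] := laurent_family a0 a1 b1 uh dh e0.
exists N, M => w wz wb al alm.
have pw : pdisc rho (coordz w).
  by case: wb => w1 w2 [[] i]; rewrite /coordz /zcoord /=.
have := HNM (exist _ _ pw) (w.1 0 ord0) (w.2 0 ord0) al alm.
have uE := uu_coordz wz.
have l0 := az _ al; have lm0 := az _ alm.
congr (nm (_ * _ - _) <= e); last first.
  by rewrite /h /= uE [_ * w.2 _ _]mulrC mulfK // Phi_coordz.
apply: eq_bigr => i _; apply: eq_bigr => j _; case: leqP => _ //.
congr (_ * _); apply: eq_AM => t t1; congr (_ * _).
have t0 : t != 0 by rewrite -nm_gt0 t1.
rewrite /h /= uE; congr (f (Phi _ _ _)).
by move: lm0; rewrite mulf_eq0 negb_or => /andP [p0 q0]; field; rewrite t0 p0 q0.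
Qed.

(** A holomorphic curve through w inside the quadric: p_0 and q_0 are both shifted by s, and the q_i
    with i > 0 are rescaled to restore the equation, which is possible for p_0 q_0 != 1. *)
Definition disc (w : vec * vec) (s : C) : vec * vec :=
  (\row_i (if i == ord0 then w.1 0 ord0 + s else w.1 0 i),
   \row_i (if i == ord0 then w.2 0 ord0 + s else w.2 0 i *
     (((w.1 0 ord0 + s) * (w.2 0 ord0 + s) - 1) / (w.1 0 ord0 * w.2 0 ord0 - 1)))).

Lemma disc_Zhat (w : vec * vec) s : in_Zhat w -> w.1 0 ord0 * w.2 0 ord0 != 1 -> in_Zhat (disc w s).
Proof.
move=> wz; have := uu_coordz wz; rewrite /uu /coordz /= => uE u1.
have u1' : w.1 0 ord0 * w.2 0 ord0 - 1 != 0 by rewrite subr_eq0.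
rewrite /in_Zhat /= !mxE eqxx.
under eq_bigr => i i0 do rewrite !mxE (negPf i0) mulrA.
rewrite -mulr_suml.
have -> : \sum_(i < n.+1 | i != ord0) w.1 0 i * w.2 0 i = w.1 0 ord0 * w.2 0 ord0 - 1.
  by rewrite -uE addrC addKr.
by field; rewrite u1'.
Qed.

Lemma disc0 (w : vec * vec) : w.1 0 ord0 * w.2 0 ord0 != 1 -> disc w 0 = w.
Proof.
move=> u1; have u1' : w.1 0 ord0 * w.2 0 ord0 - 1 != 0 by rewrite subr_eq0.
case: w u1 u1' => p q /= u1 u1'; rewrite /disc /=; congr (_, _); apply/rowP => i; rewrite mxE !addr0.
  by case: eqP => [->|].
by case: eqP => [->|] //; rewrite divff // mulr1.
Qed.

Lemma d1_disc (w : vec * vec) s (i : I) : d1 (fun s => zcoord i.1 i.2 (disc w s)) s.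
Proof.
have da c : d1 (fun s : C => c + s) s by apply: d1D (d1_cst _ _) (d1_id _).
case: i => [[] i] /=; have [i0|i0] := eqVneq i ord0.
- by apply: (d1_near (da (w.1 0 ord0))); exists 1 => // k _; rewrite mxE i0 eqxx.
- by apply: (d1_near (d1_cst (w.1 0 i) s)); exists 1 => // k _; rewrite mxE (negPf i0).
- by apply: (d1_near (da (w.2 0 ord0))); exists 1 => // k _; rewrite mxE i0 eqxx.
- have H := d1M (d1_cst (w.2 0 i) s) (d1M (d1B (d1M (da (w.1 0 ord0)) (da (w.2 0 ord0))) (d1_cst 1 s))
     (d1_cst (w.1 0 ord0 * w.2 0 ord0 - 1)^-1 s)).
  by apply: (d1_near H); exists 1 => // k _; rewrite mxE (negPf i0).
Qed.

(** If |p_0 q_0| >= 1/2, then p_0 and p_0 q_0 are both away from 0 and the annulus estimate applies.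
    Otherwise p_0 q_0 is away from 1 and the maximum principle is used along [disc]: for |s| = rho0
    + 1 both shifted coordinates have modulus at least 1. *)
Lemma approxQ_box f rho0 : holo_on_Zhat f -> 1 <= rho0 -> forall e, 0 < e ->
  exists N M, forall w, in_Zhat w -> box rho0 w -> nm (approxQ f N M (coordz w) - f w) <= e.
Proof.
move=> hf r1 e e0; have r0 : 0 < rho0 := lt_le_trans ltr01 r1.
(* [D] bounds |p_0 + s| and |q_0 + s|. [rho] bounds the rescaled q_i, its factor 2 coming from |p_0
   q_0 - 1| >= 1/2. The lower bound [a] for |p_0| follows from |p_0 q_0| >= 1/2 and |q_0| <=
   rho0. *)
pose D := 2 * rho0 + 1; pose rho := 2 * rho0 * (D ^+ 2 + 1); pose a := (2 * rho0)^-1.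
have D1 : 1 <= D by rewrite /D; clear -r0; lra.
have D2 : D <= D ^+ 2 by rewrite expr2 ler_peMr // (le_trans ler01).
have rD : rho0 <= D by rewrite /D; clear -r0; lra.
have DD0 : 0 <= D ^+ 2 by rewrite sqr_ge0.
have rr : rho0 <= rho by rewrite /rho; clear -r0 DD0; nra.
have Dr : D <= rho by rewrite /rho; clear -r1 D2 DD0; nra.
have a0 : 0 < a by rewrite invr_gt0 mulr_gt0.
have a2 : a <= 1 / 2 by rewrite /a ler_pdivlMr // mulrC ler_pdivrMr ?mulr_gt0 // mul1r; clear -r1; lra.
have a1 : a <= 1 by apply: le_trans a2 _; rewrite ler_pdivrMr // mul1r ler1n.
have b1 : 1 <= D ^+ 2 := le_trans D1 D2.
have [N [M HNM]] := approxQ_annulus rho hf a0 a1 b1 (divr_gt0 e0 (ltr0Sn _ 1)).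
exists N, M => w wz wb; have [wp wq] := wb.
set p0 := w.1 0 ord0; set q0 := w.2 0 ord0.
have P0 : nm p0 <= rho0 := wp ord0; have Q0 : nm q0 <= rho0 := wq ord0.
have [u2|u2] := leP (1 / 2) (nm (p0 * q0)).
  apply: (@le_trans _ _ (e / 2)); last by rewrite ler_pdivrMr // ler_pMr // ler1n.
  apply: HNM => //.
  - by split=> i; [exact: le_trans (wp i) rr|exact: le_trans (wq i) rr].
  - apply/andP; split; last by apply: le_trans P0 _; apply: le_trans rD D2.
    rewrite /a invfM -[leLHS]mul1r mulrA ler_pdivrMr // ; apply: le_trans u2 _.
    by rewrite nmM ler_wpM2l ?nm_ge0.
  - rewrite /ann (le_trans a2 u2) /= nmM expr2.
    by apply: ler_pM; rewrite ?nm_ge0 // (le_trans _ rD).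
have u1 : p0 * q0 != 1.
  by apply: contraTneq u2 => ->; rewrite nm1 -leNgt ler_pdivrMr // mul1r ler1n.
have u1n : 1 / 2 <= nm (p0 * q0 - 1).
  have := nm_tri (p0 * q0) 1 0; rewrite !subr0 nm1 nm_sym => h.
  by move: h u2; clear; move: (nm _) (nm _) => X Y; lra.
pose g s := approxQ f N M (coordz (disc w s)) - f (disc w s).
have dg s : d1 g s.
  apply: d1B.
    by have [H _ _] := ent_approxQ N M hf; apply: H => i; exact: d1_disc.
  apply: holo_curve => //.
  - by move=> i; exact: (d1_disc w s (true, i)).
  - by move=> i; exact: (d1_disc w s (false, i)).
  - by exists 1 => // k _; exact: disc_Zhat.
rewrite -(disc0 u1) -/(g 0).
have -> : e = (e / 2) *+ 2 by rewrite mulr2n -splitr.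
have rp : 0 < rho0 + 1 by rewrite addr_gt0.
apply: (max_principle dg rp) => t t1; rewrite add0r; set s := (rho0 + 1)%:C * t.
have ns : nm s = rho0 + 1 by rewrite nmM t1 mulr1 nm_real gtr0_norm.
have bd c : nm c <= rho0 -> 1 <= nm (c + s) <= D.
  move=> hc; have h1 := nmD c s; have h2 := nmD (c + s) (- c).
  rewrite addrAC subrr add0r nmN ns in h2; rewrite ns in h1.
  apply/andP; split; rewrite /D; first by move: hc h2; clear; move: (nm c) (nm _) => X Y; lra.
  by move: hc h1; clear; move: (nm c) (nm _) => X Y; lra.
have /andP [p1 p2] := bd _ P0; have /andP [q1 q2] := bd _ Q0.
have us1 : 1 <= nm ((p0 + s) * (q0 + s)) by rewrite nmM -(mulr1 1); apply: ler_pM.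
have us2 : nm ((p0 + s) * (q0 + s)) <= D ^+ 2 by rewrite nmM expr2; apply: ler_pM; rewrite ?nm_ge0.
apply: HNM; first exact: disc_Zhat.
- split=> i; rewrite mxE; case: eqP => _.
  + exact: le_trans p2 Dr.
  + exact: le_trans (wp i) rr.
  + exact: le_trans q2 Dr.
  + have n0 : 0 < nm (p0 * q0 - 1) by apply: lt_le_trans u1n; rewrite divr_gt0.
    have k1 : nm ((p0 + s) * (q0 + s) - 1) <= D ^+ 2 + 1.
      by apply: le_trans (nmB _ _) _; rewrite nm1 lerD2r.
    rewrite -/p0 -/q0 !nmM nmV mulrA ler_pdivrMr //.
    apply: (@le_trans _ _ (rho0 * (D ^+ 2 + 1))).
      by apply: ler_pM; rewrite ?nm_ge0 ?mulr_ge0 ?nm_ge0 ?wq.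
    apply: (@le_trans _ _ (rho * (1 / 2))); last by apply: ler_wpM2l => //; apply: le_trans rr; exact: ltW.
    by rewrite /rho; clear; lra.
- by rewrite mxE eqxx /ann (le_trans a1 p1) (le_trans p2 D2).
- by rewrite !mxE eqxx /ann (le_trans a1 us1) us2.
Qed.

Definition fhat (P Q : 'I_n.+1 -> nat) (w : vec * vec) : C :=
  \prod_i (w.1 0 i ^+ P i * w.2 0 i ^+ Q i).

Definition mono := (C * ('I_n.+1 -> nat) * ('I_n.+1 -> nat))%type.
Definition balanced (m : mono) := mabs m.1.2 == mabs m.2.
Definition polyhat (s : seq mono) w : C := \sum_(m <- s) m.1.1 * fhat m.1.2 m.2 w.

Lemma fhat_scale P Q (w : vec * vec) (t u : C) :
  fhat P Q (t *: w.1, u *: w.2) = t ^+ mabs P * u ^+ mabs Q * fhat P Q w.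
Proof.
rewrite /fhat /mabs -!prodrXr -!big_split /=; apply: eq_bigr => i _.
by rewrite !mxE !exprMn; ring.
Qed.

(** Averaging over the circle action removes the unbalanced monomials, fixes f and preserves the
    quadric and the polydisc, so the error does not grow. K-th roots of unity suffice for an exact
    projection because K exceeds the degree of every monomial that occurs. *)
Theorem poly_dense f : Ohat f -> forall rho e, 0 < e -> exists2 s : seq mono, all balanced s &
  forall w, in_Zhat w -> box rho w -> nm (f w - polyhat s w) <= e.
Proof.
move=> [hf inv] rho e e0; pose rho0 := Num.max 1 rho.
have r1 : 1 <= rho0 by rewrite le_max lexx.
have rr : rho <= rho0 by rewrite le_max lexx orbT.
have e2 : 0 < e / 2 by rewrite divr_gt0.
have [N [M HQ]] := approxQ_box hf r1 e2.
have [|P [s0 Hs0] HP] := @ent_approx R _ (enum {: I}) _ (ent_approxQ N M hf) _ rho0 (e / 2) (lt_le_trans ltr01 r1) e2.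
  by move=> x y xy; congr (approxQ _ _ _ _); apply/funext => i; apply: xy; rewrite mem_enum.
pose tom (cm : C * (I -> nat)) : mono := (cm.1, fun i => cm.2 (true, i), fun i => cm.2 (false, i)).
have PE w : P (coordz w) = polyhat [seq tom cm | cm <- s0] w.
  rewrite Hs0 /polyhat big_map; apply: eq_bigr => cm _; congr (_ * _).
  have -> : \prod_i coordz w i ^+ cm.2 i = \prod_b \prod_j coordz w (b, j) ^+ cm.2 (b, j).
    by rewrite pair_bigA; apply: eq_bigr => -[].
  by rewrite big_bool /= /fhat big_split.
have H1 w : in_Zhat w -> box rho w -> nm (f w - polyhat [seq tom cm | cm <- s0] w) <= e.
  move=> wz wb.
  have wb0 : box rho0 w by case: wb => h1 h2; split=> i; apply: le_trans rr.
  rewrite -PE (splitr e); apply: le_trans (nm_tri (approxQ f N M (coordz w)) _ _) _.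
  apply: lerD; first by rewrite nm_sym; exact: HQ.
  by apply: HP; case: wb0 => h1 h2 [[] i]; rewrite /coordz /zcoord /=.
set s1 := [seq _ | _ <- _] in H1; clearbody s1; clear -H1 inv e0.
exists [seq m <- s1 | balanced m]; first exact: filter_all.
move=> w wz wb.
pose K := (\sum_(m <- s1) (mabs m.1.2 + mabs m.2)).+1.
have KK : (K != 0)%N by [].
have E m : (mabs m.1.2 + mabs m.2 < K)%N -> AM K (fun t => m.1.1 * fhat m.1.2 m.2 (t *: w.1, t^-1 *: w.2)) =
   if balanced m then m.1.1 * fhat m.1.2 m.2 w else 0.
  move=> mK; rewrite (@eq_AM _ _ _ (fun t => (m.1.1 * fhat m.1.2 m.2 w) *
     (t ^+ mabs m.1.2 * t^-1 ^+ mabs m.2))); last first.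
    by move=> t _; rewrite fhat_scale; ring.
  rewrite AM_Ml AM_orth ?(leq_ltn_trans _ mK) ?leq_addr ?leq_addl // /balanced.
  by case: eqP => _; rewrite ?mulr1 ?mulr0.
have aK : all (fun m : mono => mabs m.1.2 + mabs m.2 < K)%N s1.
  rewrite /K; elim: (s1) => //= m s IH; rewrite big_cons ltnS leq_addr /=.
  by apply: sub_all IH => m' /leq_trans; apply; rewrite ltnS leq_addl.
have -> : polyhat [seq m <- s1 | balanced m] w = AM K (fun t => polyhat s1 (t *: w.1, t^-1 *: w.2)).
  rewrite /polyhat big_filter big_mkcond /= /AM exchange_big /= mulr_sumr.
  elim: (s1) aK => [|m s IH] /=; first by rewrite !big_nil.
  by move=> /andP [mK /IH {}IH]; rewrite !big_cons -IH -E.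
have -> : f w = AM K (fun t => f w * (t ^+ 0 * t^-1 ^+ 0)) by rewrite AM_Ml AM_orth // mulr1.
rewrite -AM_B; apply: nm_AM; first exact: ltW.
move=> t t1; rewrite !expr0 mulr1 mulr1; have t0 : t != 0 by rewrite -nm_gt0 t1.
rewrite -(inv t w t0 wz); apply: H1.
  rewrite /in_Zhat /= !mxE -[RHS]wz.
  congr (- _ + _); first by field; rewrite t0.
  by apply: eq_bigr => i _; rewrite !mxE; field; rewrite t0.
by case: wb => h1 h2; split=> i; rewrite mxE nmM ?nmV t1 ?invr1 mul1r.
Qed.

End Density.

(** * Wick products of monomials *)

Section Contractions.

(* The number of ways to contract T of p derivatives with T of q variables. *)
Definition contr (p q T : nat) : nat := (T`! * 'C(p, T) * 'C(q, T))%N.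

Lemma ffactD n k l : (n ^_ (k + l) = n ^_ k * (n - k) ^_ l)%N.
Proof.
elim: k n => [|k IH] n; first by rewrite ffactn0 mul1n subn0.
by rewrite addSn !ffactnS IH mulnA; congr (_ * falling_factorial _ _)%N; lia.
Qed.

(** Here s, i, t count the contractions between factors 1 and 2, 2 and 3, 1 and 3. After
    multiplication by t! both sides are products of falling factorials, and [ffactD] says that the
    contractions of one factor may be chosen in two stages. *)
Lemma contr_assoc p1 p2 q2 q3 s i t :
  (contr p1 q2 s * ((i + t)`! * ('C(p2, i) * 'C(p1 - s, t)) * 'C(q3, i + t)) =
   contr p2 q3 i * ((s + t)`! * 'C(p1, s + t) * ('C(q2, s) * 'C(q3 - i, t))))%N.
Proof.
apply/eqP; rewrite -(eqn_pmul2r (fact_gt0 t)); apply/eqP.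
have F := bin_ffact; rewrite /contr.
have -> : (s`! * 'C(p1, s) * 'C(q2, s) * ((i + t)`! * ('C(p2, i) * 'C(p1 - s, t)) * 'C(q3, i + t)) * t`! =
  'C(q2, s) * 'C(p2, i) * (('C(p1, s) * s`!) * ('C(p1 - s, t) * t`!)) * ('C(q3, i + t) * (i + t)`!))%N.
  by lia.
have -> : (i`! * 'C(p2, i) * 'C(q3, i) * ((s + t)`! * 'C(p1, s + t) * ('C(q2, s) * 'C(q3 - i, t))) * t`! =
  'C(q2, s) * 'C(p2, i) * ('C(p1, s + t) * (s + t)`!) * (('C(q3, i) * i`!) * ('C(q3 - i, t) * t`!)))%N.
  by lia.
by rewrite !F -!ffactD.
Qed.

(** Vandermonde's identity with both indices running below a common B, so that sums can be exchanged
    without dependent ranges. *)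
Lemma Vandermonde_conv k l B U : (k < B)%N -> (l < B)%N ->
  'C(k + l, U) = (\sum_(i < B) \sum_(t < B | i + t == U) 'C(k, i) * 'C(l, t))%N.
Proof.
move=> kB lB; rewrite -binomial.Vandermonde.
have inner (i : nat) : (\sum_(t < B | i + t == U) 'C(k, i) * 'C(l, t) =
    if i <= U then 'C(k, i) * 'C(l, U - i) else 0)%N.
  case: leqP => iU; last first.
    by rewrite big1 // => t /eqP tE; move: iU; rewrite -tE ltnNge leq_addr.
  have [UB|UB] := ltnP (U - i) B.
    rewrite (big_pred1 (Ordinal UB)) // => t /=.
    by apply/eqP/eqP => [H|->]; [apply: val_inj => /=; lia|rewrite /=; lia].
  rewrite big1 ?(bin_small (leq_trans lB UB)) ?muln0 // => t /eqP tE.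
  by move: UB; rewrite -tE addKn leqNgt ltn_ord.
under [RHS]eq_bigr do rewrite inner.
rewrite -big_mkcond /= (big_ord_widen (maxn U.+1 B) (fun j => 'C(k, j) * 'C(l, U - j))%N (leq_maxl _ _)).
rewrite (big_ord_widen_cond (maxn U.+1 B) (fun j => j <= U)%N (fun j => 'C(k, j) * 'C(l, U - j))%N (leq_maxr _ _)).
rewrite big_mkcond [RHS]big_mkcond; apply: eq_bigr => j _; rewrite ltnS.
by case: leqP => //= Bj; case: ltnP => // jU; rewrite (bin_small (leq_trans kB Bj)) ?mul0n.
Qed.

Variable V : nmodType.
Implicit Type Th : nat -> V.

(** The p1 + p2 - T derivatives left over by the first product are split by Vandermonde into i from
    the second factor and t from the first. *)
Lemma contr_left p1 p2 q2 q3 B Th : (p1 < B)%N -> (p2 < B)%N ->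
  \sum_(T < B) \sum_(U < B + B) Th (T + U)%N *+ (contr p1 q2 T * contr (p1 + p2 - T) q3 U) =
  \sum_(s < B) \sum_(i < B) \sum_(t < B) Th (s + i + t)%N *+
    (contr p1 q2 s * ((i + t)`! * ('C(p2, i) * 'C(p1 - s, t)) * 'C(q3, i + t))).
Proof.
move=> h1 h2; apply: eq_bigr => s _; have [sp|ps] := leqP s p1; last first.
  have c0 : contr p1 q2 s = 0%N by rewrite /contr (bin_small ps) muln0.
  rewrite big1 => [|U _]; last by rewrite c0 mul0n mulr0n.
  by rewrite big1 // => i _; rewrite big1 // => t _; rewrite c0 mul0n mulr0n.
have cE U : contr (p1 + p2 - s) q3 U =
   (\sum_(i < B) \sum_(t < B | i + t == U) (i + t)`! * ('C(p2, i) * 'C(p1 - s, t)) * 'C(q3, i + t))%N.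
  rewrite /contr (_ : p1 + p2 - s = p2 + (p1 - s))%N; last by lia.
  rewrite (@Vandermonde_conv p2 (p1 - s) B) //; last exact: leq_ltn_trans (leq_subr _ _) h1.
  rewrite mulnAC big_distrr /=; apply: eq_bigr => i _; rewrite big_distrr /=.
  by apply: eq_bigr => t /eqP ->; rewrite mulnAC.
under eq_bigr => U _ do rewrite cE big_distrr /= -sumrMnr.
rewrite exchange_big /=; apply: eq_bigr => i _.
under eq_bigr => U _ do rewrite big_distrr /= -sumrMnr big_mkcond.
rewrite exchange_big /=; apply: eq_bigr => t _.
have itB : (i + t < B + B)%N by have := ltn_ord i; have := ltn_ord t; lia.
rewrite -big_mkcond (big_pred1 (Ordinal itB)) /=; first by rewrite addnA.
by move=> U /=; rewrite eq_sym.
Qed.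

Lemma contr_right p1 p2 q2 q3 B Th : (q2 < B)%N -> (q3 < B)%N ->
  \sum_(T < B) \sum_(U < B + B) Th (T + U)%N *+ (contr p2 q3 T * contr p1 (q2 + q3 - T) U) =
  \sum_(s < B) \sum_(i < B) \sum_(t < B) Th (s + i + t)%N *+
    (contr p2 q3 i * ((s + t)`! * 'C(p1, s + t) * ('C(q2, s) * 'C(q3 - i, t)))).
Proof.
move=> h1 h2; rewrite [RHS]exchange_big; apply: eq_bigr => i _ /=.
have [sp|ps] := leqP i q3; last first.
  have c0 : contr p2 q3 i = 0%N by rewrite /contr (bin_small ps) muln0.
  rewrite big1 => [|U _]; last by rewrite c0 mul0n mulr0n.
  by rewrite big1 // => s _; rewrite big1 // => t _; rewrite c0 mul0n mulr0n.
have cE U : contr p1 (q2 + q3 - i) U =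
   (\sum_(s < B) \sum_(t < B | s + t == U) (s + t)`! * 'C(p1, s + t) * ('C(q2, s) * 'C(q3 - i, t)))%N.
  rewrite /contr (_ : q2 + q3 - i = q2 + (q3 - i))%N; last by lia.
  rewrite (@Vandermonde_conv q2 (q3 - i) B) //; last exact: leq_ltn_trans (leq_subr _ _) h2.
  rewrite big_distrr /=; apply: eq_bigr => s _; rewrite big_distrr /=.
  by apply: eq_bigr => t /eqP ->.
under eq_bigr => U _ do rewrite cE big_distrr /= -sumrMnr.
rewrite exchange_big /=; apply: eq_bigr => s _.
under eq_bigr => U _ do rewrite big_distrr /= -sumrMnr big_mkcond.
rewrite exchange_big /=; apply: eq_bigr => t _.
have itB : (s + t < B + B)%N by have := ltn_ord s; have := ltn_ord t; lia.
rewrite -big_mkcond (big_pred1 (Ordinal itB)) /=; first by congr (Th _ *+ _); lia.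
by move=> U /=; rewrite eq_sym.
Qed.

(* Associativity of normal ordering in the Weyl algebra with one generator. *)
Lemma contr_conv p1 p2 q2 q3 B Th :
  (p1 < B)%N -> (p2 < B)%N -> (q2 < B)%N -> (q3 < B)%N ->
  \sum_(T < B) \sum_(U < B + B) Th (T + U)%N *+ (contr p1 q2 T * contr (p1 + p2 - T) q3 U) =
  \sum_(T < B) \sum_(U < B + B) Th (T + U)%N *+ (contr p2 q3 T * contr p1 (q2 + q3 - T) U).
Proof.
move=> *; rewrite contr_left // contr_right //.
apply: eq_bigr => s _; apply: eq_bigr => i _; apply: eq_bigr => t _.
by rewrite contr_assoc.
Qed.

End Contractions.

(** * Wick products of monomials as products over coordinates *)

Section WickMonomials.
Variable R : realType.
Local Notation C := (R[i]).
Variable n : nat.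
Local Notation midx := ('I_n.+1 -> nat).
Implicit Types (P Q S : midx) (r : Zpt R n) (p q : {poly C}).

(** The linear functional on polynomials that sends X^j to [ph j]. In a Wick product the Pochhammer
    numerator depends on T only through |T| and everything else splits over the coordinates; letting
    X mark |T| turns the sum over T into this functional applied to a product. *)
Definition Lph (ph : nat -> C) (p : {poly C}) : C := \sum_(j < size p) p`_j * ph j.

Lemma Lph_widen ph p K : (size p <= K)%N -> Lph ph p = \sum_(j < K) p`_j * ph j.
Proof.
move=> pK; rewrite /Lph (big_ord_widen K (fun j => p`_j * ph j) pK) big_mkcond.
by apply: eq_bigr => j _; case: ltnP => // h; rewrite nth_default ?mul0r.
Qed.

Lemma LphD ph p q : Lph ph (p + q) = Lph ph p + Lph ph q.
Proof.
rewrite !(@Lph_widen _ _ (maxn (size p) (size q))) ?leq_maxl ?leq_maxr ?size_polyD //.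
by rewrite -big_split; apply: eq_bigr => j _; rewrite coefD mulrDl.
Qed.

Lemma LphZ ph c p : Lph ph (c *: p) = c * Lph ph p.
Proof.
rewrite (@Lph_widen _ (c *: p) (size p)) ?size_scale_leq // /Lph mulr_sumr.
by apply: eq_bigr => j _; rewrite coefZ mulrA.
Qed.

Lemma Lph0 ph : Lph ph 0 = 0.
Proof. by rewrite /Lph size_poly0 big_ord0. Qed.

Lemma Lph_sum ph (J : Type) (s : seq J) (pr : pred J) (F : J -> {poly C}) :
  Lph ph (\sum_(j <- s | pr j) F j) = \sum_(j <- s | pr j) Lph ph (F j).
Proof. exact: (big_morph _ (LphD ph) (Lph0 ph)). Qed.

Lemma Lph_XnM ph k p : Lph ph ('X^k * p) = Lph (fun j => ph (k + j)%N) p.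
Proof.
rewrite (@Lph_widen _ _ (k + size p)); last first.
  by apply: leq_trans (size_polyMleq _ _) _; rewrite size_polyXn.
rewrite big_split_ord /= big1 ?add0r => [|j _]; last by rewrite coefXnM ltn_ord mul0r.
by apply: eq_bigr => j _; rewrite coefXnM ltnNge leq_addr /= addKn.
Qed.

Lemma Lph_Xn ph k : Lph ph 'X^k = ph k.
Proof.
by rewrite -['X^k]mulr1 Lph_XnM /Lph size_poly1 big_ord1 coef1 mul1r addn0.
Qed.

Lemma Lph_ext ph ph' p : (forall j, (j < size p)%N -> ph j = ph' j) -> Lph ph p = Lph ph' p.
Proof. by move=> H; apply: eq_bigr => j _; rewrite H. Qed.

Definition eps (i : 'I_n.+1) : C := if i == ord0 then -1 else 1.

Lemma prod_eps (T : midx) : \prod_i eps i ^+ T i = (-1) ^+ T ord0.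
Proof.
rewrite (bigD1 ord0) //= big1 ?mulr1 /eps ?eqxx // => i /negPf ->.
by rewrite expr1n.
Qed.

Definition omc (i : 'I_n.+1) (a b : C) (p q T : nat) : C :=
  eps i ^+ T * (a ^+ (p - T) * b ^+ (q - T)) * (contr p q T)%:R.

(** The generating polynomial of the contractions in coordinate i, with the powers of r_i and its
    conjugate that remain uncontracted. Any B above p gives the same polynomial, so factors with
    different exponents can share one range. *)
Definition om B i a b (p q : nat) : {poly C} := \sum_(T < B) omc i a b p q T *: 'X^T.

Lemma omc0 i a b (p q T : nat) : ~~ (T <= minn p q)%N -> omc i a b p q T = 0.
Proof.
rewrite -ltnNge /omc /contr gtn_min => /orP [] h; rewrite (bin_small h) ?muln0 ?mulr0 ?mul0n ?mulr0 //.
Qed.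

Lemma om_widen i a b (p q B B' : nat) : (p < B)%N -> (p < B')%N -> om B i a b p q = om B' i a b p q.
Proof.
have H D : (p < D)%N -> om D i a b p q = om p.+1 i a b p q.
  move=> pD; rewrite /om (big_ord_widen D (fun T => omc i a b p q T *: 'X^T) pD) [RHS]big_mkcond.
  apply: eq_bigr => T _; case: ltnP => // pT; rewrite omc0 ?scale0r // -ltnNge.
  by apply: leq_ltn_trans (geq_minl _ _) pT.
by move=> h1 h2; rewrite (H B) // (H B').
Qed.

Lemma sum_prod_om (ph : nat -> C) B (F : 'I_n.+1 -> nat -> C) :
  \sum_(T : {ffun 'I_n.+1 -> 'I_B}) (\prod_i F i (T i)) * ph (\sum_i T i)%N =
  Lph ph (\prod_i \sum_(T < B) F i T *: 'X^T).
Proof.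
rewrite bigA_distr_bigA /= Lph_sum; apply: eq_bigr => T _.
rewrite scaler_prod LphZ; congr (_ * _).
have -> : \prod_i 'X^(T i) = 'X^(\sum_i T i)%N :> {poly C} by rewrite prodrXr.
by rewrite Lph_Xn.
Qed.

Lemma mabsB P T : (forall i, T i <= P i)%N -> mabs (fun i => P i - T i)%N = (mabs P - mabs T)%N.
Proof. by move=> TP; rewrite /mabs sumnB. Qed.

Lemma mabsD P Q : mabs (fun i => P i + Q i)%N = (mabs P + mabs Q)%N.
Proof. by rewrite /mabs big_split. Qed.

Lemma mabs_le P i : (P i <= mabs P)%N.
Proof. by rewrite /mabs (bigD1 i) //= leq_addr. Qed.

Variable hbar : R.
Let x : C := real_complex R ((2 * hbar)^-1).
Definition pochN N j : C := poch x (N - j).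

Lemma wick_prodE B P Q P' Q' r : (forall i, P i < B)%N ->
  wick_prod hbar P Q P' Q' r =
  (poch x (mabs P) * poch x (mabs Q'))^-1 *
  (Lph (pochN (mabs P + mabs Q'))
    (\prod_i om B i (val r 0 i) (Num.conj (val r 0 i)) (P i) (Q' i)) *
   \prod_i (val r 0 i ^+ P' i * Num.conj (val r 0 i) ^+ Q i)).
Proof.
move=> hB; pose B' := (mabs P).+1.
have -> : \prod_i om B i (val r 0 i) (Num.conj (val r 0 i)) (P i) (Q' i) =
   \prod_i \sum_(T < B') omc i (val r 0 i) (Num.conj (val r 0 i)) (P i) (Q' i) T *: 'X^T.
  by apply: eq_bigr => i _; rewrite (@om_widen _ _ _ _ _ B B') // ltnS mabs_le.
rewrite -(sum_prod_om _ _ (fun i T => omc i (val r 0 i) (Num.conj (val r 0 i)) (P i) (Q' i) T)).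
rewrite mulr_suml mulr_sumr /wick_prod big_mkcond /=.
apply: eq_bigr => T _; case: forallP => [H|H]; last first.
  have [i hi] : exists i, ~~ (T i <= minn (P i) (Q' i))%N.
    by apply/existsP; rewrite -negb_forall; apply/forallP.
  by rewrite (bigD1 i) //= omc0 // !mul0r mulr0.
have TP i : (T i <= P i)%N by apply: leq_trans (H i) (geq_minl _ _).
have TQ i : (T i <= Q' i)%N by apply: leq_trans (H i) (geq_minr _ _).
rewrite /wick_coef -/x /fPQ /pochN.
have -> : mabs (fun i => P i + Q' i - T i)%N = (mabs P + mabs Q' - \sum_i T i)%N.
  rewrite (@mabsB (fun i => P i + Q' i)%N (fun i => val (T i))) ?mabsD // => i.
  exact: leq_trans (TP i) (leq_addr _ _).
rewrite -(prod_eps (fun i => val (T i))) /omc.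
set p := poch x (mabs P + mabs Q' - _); set pp := poch x _ * _.
have -> : \prod_i (val r 0 i ^+ (P i + P' i - T i) * (Num.conj (val r 0 i)) ^+ (Q i + Q' i - T i)) =
   \prod_i (val r 0 i ^+ (P i - T i) * (Num.conj (val r 0 i)) ^+ (Q' i - T i)) *
   \prod_i (val r 0 i ^+ P' i * Num.conj (val r 0 i) ^+ Q i).
  rewrite -big_split; apply: eq_bigr => i _ /=.
  rewrite (_ : P i + P' i - T i = (P i - T i) + P' i)%N; last by have := TP i; lia.
  rewrite (_ : Q i + Q' i - T i = (Q' i - T i) + Q i)%N; last by have := TQ i; lia.
  by rewrite !exprD; ring.
have -> : \prod_i (eps i ^+ T i * (val r 0 i ^+ (P i - T i) * (Num.conj (val r 0 i)) ^+ (Q' i - T i)) *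
     (contr (P i) (Q' i) (T i))%:R) = \prod_i eps i ^+ T i *
   \prod_i (val r 0 i ^+ (P i - T i) * (Num.conj (val r 0 i)) ^+ (Q' i - T i)) *
   ((\prod_i ((T i)`!)%:R) * (\prod_i ('C(P i, T i))%:R) * (\prod_i ('C(Q' i, T i))%:R)).
  by rewrite -!big_split; apply: eq_bigr => i _ /=; rewrite /contr !natrM.
by ring.
Qed.

End WickMonomials.

(** * Associativity, unit and involution on monomials *)

Section WickAlgebra.
Variable R : realType.
Local Notation C := (R[i]).
Variable n : nat.
Local Notation midx := ('I_n.+1 -> nat).
Implicit Types (P Q S : midx) (r : Zpt R n).

(** [contr_conv], with [Th] carrying the monomial attached to k contractions in total. Wherever
    truncated subtraction would distort an exponent, the contraction number vanishes. *)
Lemma om_assoc B (i : 'I_n.+1) (a b : C) (p1 p2 p3 q1 q2 q3 : nat) :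
  (p1 < B)%N -> (p2 < B)%N -> (q2 < B)%N -> (q3 < B)%N ->
  \sum_(T < B) (eps R i ^+ T * (contr p1 q2 T)%:R * (a ^+ p3 * b ^+ (q1 + q2 - T))) *:
     ('X^T * om (B + B) i a b (p1 + p2 - T) q3) =
  \sum_(T < B) (eps R i ^+ T * (contr p2 q3 T)%:R * (a ^+ (p2 + p3 - T) * b ^+ q1)) *:
     ('X^T * om (B + B) i a b p1 (q2 + q3 - T)).
Proof.
move=> h1 h2 h3 h4.
pose Th k : {poly C} := (eps R i ^+ k * (a ^+ (p1 + p2 + p3 - k) * b ^+ (q1 + q2 + q3 - k))) *: 'X^k.
have := @contr_conv {poly C} p1 p2 q2 q3 B Th h1 h2 h3 h4.
have cz p q T : ~~ ((T <= p)%N && (T <= q)%N) -> contr p q T = 0%N.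
  by rewrite negb_and /contr -!ltnNge => /orP [] h; rewrite (bin_small h) ?muln0.
set L := (X in X = _ -> _); set L' := (X in _ = X -> _).
suff -> : L = \sum_(T < B) (eps R i ^+ T * (contr p1 q2 T)%:R * (a ^+ p3 * b ^+ (q1 + q2 - T))) *:
     ('X^T * om (B + B) i a b (p1 + p2 - T) q3).
  suff -> : L' = \sum_(T < B) (eps R i ^+ T * (contr p2 q3 T)%:R * (a ^+ (p2 + p3 - T) * b ^+ q1)) *:
     ('X^T * om (B + B) i a b p1 (q2 + q3 - T)) by [].
  apply: eq_bigr => T _; rewrite /om mulr_sumr scaler_sumr; apply: eq_bigr => U _.
  rewrite -scalerAr -exprD scalerA /Th -scaler_nat scalerA; congr (_ *: _).
  have [TT|/cz c0] := boolP ((T <= p2)%N && (T <= q3)%N); last first.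
    by rewrite /omc c0 ?mul0n ?mul0r ?mulr0 ?mul0r.
  have [UU|/cz c0] := boolP ((U <= p1)%N && (U <= q2 + q3 - T)%N); last first.
    by rewrite /omc c0 ?muln0 ?mul0r ?mulr0.
  case/andP: TT => T1 T2; case/andP: UU => U1 U2.
  rewrite /omc (_ : p1 + p2 + p3 - (T + U) = (p1 - U) + (p2 + p3 - T))%N; last by lia.
  rewrite (_ : q1 + q2 + q3 - (T + U) = q1 + (q2 + q3 - T - U))%N; last by lia.
  by rewrite !exprD natrM; ring.
apply: eq_bigr => T _; rewrite /om mulr_sumr scaler_sumr; apply: eq_bigr => U _.
rewrite -scalerAr -exprD scalerA /Th -scaler_nat scalerA; congr (_ *: _).
have [TT|/cz c0] := boolP ((T <= p1)%N && (T <= q2)%N); last first.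
  by rewrite /omc c0 ?mul0n ?mul0r ?mulr0 ?mul0r.
have [UU|/cz c0] := boolP ((U <= p1 + p2 - T)%N && (U <= q3)%N); last first.
  by rewrite /omc c0 ?muln0 ?mul0r ?mulr0.
case/andP: TT => T1 T2; case/andP: UU => U1 U2.
rewrite /omc (_ : p1 + p2 + p3 - (T + U) = (p1 + p2 - T - U) + p3)%N; last by lia.
rewrite (_ : q1 + q2 + q3 - (T + U) = (q1 + q2 - T) + (q3 - U))%N; last by lia.
by rewrite !exprD natrM; ring.
Qed.

Variable hbar : R.
Hypothesis hpos : 0 < hbar.
Let x : C := real_complex R ((2 * hbar)^-1).

Lemma poch_gt0 m : 0 < poch x m.
Proof.
rewrite /poch prodr_gt0 // => k _; rewrite -(rmorph_nat (real_complex R)) -rmorphD /= ltcR.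
by rewrite ltr_pwDl ?ler0n // invr_gt0 mulr_gt0.
Qed.

Lemma poch_neq0 m : poch x m != 0.
Proof. by rewrite gt_eqF // poch_gt0. Qed.

Lemma poch_conj m : Num.conj (poch x m) = poch x m.
Proof. by rewrite conj_Creal // ger0_real // ltW // poch_gt0. Qed.

Lemma Lph_conj (ph : nat -> C) (p : {poly C}) : Num.conj (Lph ph p) = Lph (fun j => Num.conj (ph j)) (map_poly Num.conj p).
Proof.
rewrite /Lph size_map_poly rmorph_sum; apply: eq_bigr => j _.
by rewrite rmorphM coef_map.
Qed.

Lemma eps_conj (i : 'I_n.+1) : Num.conj (eps R i) = eps R i.
Proof. by rewrite /eps; case: eqP => _; rewrite ?rmorphN rmorph1. Qed.

Lemma om_conj B (i : 'I_n.+1) (a b : C) (p q : nat) :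
  map_poly Num.conj (om B i a b p q) = om B i (Num.conj b) (Num.conj a) q p.
Proof.
rewrite /om rmorph_sum; apply: eq_bigr => T _; rewrite /= map_polyZ map_polyXn; congr (_ *: _).
rewrite /omc /contr !natrM !rmorphM !rmorphXn !rmorph_nat /= eps_conj.
by ring.
Qed.

(** The polynomial [om] is symmetric under exchange of the two contracted exponents together with
    r_i and its conjugate, and the Pochhammer symbols are real. *)
Lemma wick_conj P Q P' Q' r :
  Num.conj (wick_prod hbar P Q P' Q' r) = wick_prod hbar Q' P' Q P r.
Proof.
pose B := (mabs P + mabs Q').+1.
have hP i : (P i < B)%N by rewrite ltnS; apply: leq_trans (mabs_le P i) (leq_addr _ _).
have hQ i : (Q' i < B)%N by rewrite ltnS; apply: leq_trans (mabs_le Q' i) (leq_addl _ _).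
rewrite (@wick_prodE _ _ hbar B) // (@wick_prodE _ _ hbar B) //.
rewrite rmorphM fmorphV !rmorphM /= !poch_conj [poch x (mabs P) * _]mulrC; congr (_ * (_ * _)).
  rewrite Lph_conj rmorph_prod [(mabs Q' + _)%N]addnC; congr Lph.
    by apply/funext => j; rewrite /pochN poch_conj.
  by apply: eq_bigr => i _; rewrite /= om_conj conjCK.
rewrite rmorph_prod; apply: eq_bigr => i _.
by rewrite rmorphM !rmorphXn /= conjCK mulrC.
Qed.

Lemma fPQ_conj P Q r : Num.conj (fPQ P Q r) = fPQ Q P r.
Proof.
rewrite /fPQ rmorph_prod; apply: eq_bigr => i _.
by rewrite rmorphM !rmorphXn /= conjCK mulrC.
Qed.

Lemma wick_1l P Q r : mabs P = mabs Q -> wick_prod hbar (fun=> 0%N) (fun=> 0%N) P Q r = fPQ P Q r.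
Proof.
move=> PQ; rewrite (@wick_prodE _ _ hbar 1) //.
have -> : mabs (fun _ : 'I_n.+1 => 0%N) = 0%N by rewrite /mabs big1.
have -> : \prod_i om 1 i (val r 0 i) (Num.conj (val r 0 i)) 0 (Q i) =
   \prod_i ((Num.conj (val r 0 i)) ^+ Q i *: 1).
  apply: eq_bigr => i _; rewrite /om big_ord1 /omc /contr /= !bin0 !subn0 !expr0.
  by rewrite !mul1r !mulr1.
rewrite scaler_prod LphZ; set u := (X in Lph _ X).
have -> : u = 'X^0 by rewrite /u big1 // ?expr0.
rewrite Lph_Xn /pochN subn0 add0n -/x.
have -> : poch x 0 = 1 by rewrite /poch big_ord0.
have -> : \prod_i (val r 0 i ^+ P i * (Num.conj (val r 0 i)) ^+ 0) = \prod_i val r 0 i ^+ P i.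
  by apply: eq_bigr => i _; rewrite expr0 mulr1.
by rewrite /fPQ big_split /=; field; rewrite poch_neq0.
Qed.

Lemma sum_ord_widen (V : nmodType) (F : nat -> V) p B B' : (forall T, (p < T)%N -> F T = 0) ->
  (p < B)%N -> (p < B')%N -> \sum_(T < B) F T = \sum_(T < B') F T.
Proof.
move=> F0; have H D : (p < D)%N -> \sum_(T < D) F T = \sum_(T < p.+1) F T.
  move=> pD; rewrite (big_ord_widen D F pD) [RHS]big_mkcond.
  by apply: eq_bigr => T _; case: ltnP => // pT; rewrite F0.
by move=> h1 h2; rewrite (H B) // (H B').
Qed.

(** Because |P2| = |Q2|, the numerator of the inner product equals one of the normalising Pochhammer
    symbols of the outer product and cancels. On both sides the same functional
    [Lph (pochN hbar N)], with N = |P1| + |P2| + |Q3|, remains, applied to products over coordinates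
    that agree factor by factor. *)
Lemma wick_assoc P1 Q1 P2 Q2 P3 Q3 r : mabs P2 = mabs Q2 ->
  \sum_(T : {ffun 'I_n.+1 -> 'I_(mabs P1).+1} | [forall i, (val (T i) <= minn (P1 i) (Q2 i))%N])
    wick_coef hbar P1 Q2 (fun i => val (T i)) *
    wick_prod hbar (fun i => P1 i + P2 i - T i)%N (fun i => Q1 i + Q2 i - T i)%N P3 Q3 r =
  \sum_(T : {ffun 'I_n.+1 -> 'I_(mabs P2).+1} | [forall i, (val (T i) <= minn (P2 i) (Q3 i))%N])
    wick_coef hbar P2 Q3 (fun i => val (T i)) *
    wick_prod hbar P1 Q1 (fun i => P2 i + P3 i - T i)%N (fun i => Q2 i + Q3 i - T i)%N r.
Proof.
move=> PQ2; pose a i := val r 0 i; pose b i := Num.conj (a i).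
pose B := (mabs P1 + mabs P2 + mabs Q3).+1.
have bd P i m : (mabs P <= m)%N -> (P i < m.+1)%N by rewrite ltnS; apply: leq_trans; exact: mabs_le.
have P1B i : (P1 i < B)%N by apply: bd; rewrite -addnA leq_addr.
have P2B i : (P2 i < B)%N by apply: bd; rewrite addnAC leq_addl.
have Q2B i : (Q2 i < B)%N by apply: bd; rewrite -PQ2 addnAC leq_addl.
have Q3B i : (Q3 i < B)%N by apply: bd; rewrite leq_addl.
pose N := (mabs P1 + mabs P2 + mabs Q3)%N.
pose K := (poch x (mabs P1) * poch x (mabs P2) * poch x (mabs Q3))^-1.
pose FL B' i T := (eps R i ^+ T * (contr (P1 i) (Q2 i) T)%:R * (a i ^+ P3 i * b i ^+ (Q1 i + Q2 i - T))) *: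
     ('X^T * om B' i (a i) (b i) (P1 i + P2 i - T) (Q3 i)).
pose FR B' i T := (eps R i ^+ T * (contr (P2 i) (Q3 i) T)%:R * (a i ^+ (P2 i + P3 i - T) * b i ^+ Q1 i)) *:
     ('X^T * om B' i (a i) (b i) (P1 i) (Q2 i + Q3 i - T)).
have cz p q T : ~~ (T <= minn p q)%N -> contr p q T = 0%N.
  by rewrite leq_min negb_and /contr -!ltnNge => /orP [] h; rewrite (bin_small h) ?muln0.
have coefE (P S : midx) m (T : {ffun 'I_n.+1 -> 'I_m}) : wick_coef hbar P S (fun i => val (T i)) =
   (poch x (mabs P) * poch x (mabs S))^-1 * poch x (mabs (fun i => P i + S i - T i)%N) *
   \prod_i (eps R i ^+ T i * (contr (P i) (S i) (T i))%:R).
  rewrite /wick_coef -/x -(prod_eps R (fun i => val (T i))) big_split /=.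
  have -> : \prod_i (contr (P i) (S i) (T i))%:R = (\prod_i ((T i)`!)%:R) * (\prod_i ('C(P i, T i))%:R) * (\prod_i ('C(S i, T i))%:R) :> C.
    by rewrite -!big_split; apply: eq_bigr => i _ /=; rewrite /contr !natrM.
  by ring.
transitivity (K * Lph (pochN hbar N) (\prod_i \sum_(T < B) FL (B + B)%N i T)).
  rewrite (_ : \prod_i \sum_(T < B) FL (B + B)%N i T = \prod_i \sum_(T < (mabs P1).+1) FL (B + B)%N i T); last first.
    apply: eq_bigr => i _; apply: (@sum_ord_widen _ (FL (B + B)%N i) (P1 i)) => // [T h|].
      by rewrite /FL cz ?mulr0 ?mul0r ?scale0r // leq_min leqNgt h.
    by rewrite ltnS mabs_le.
  rewrite bigA_distr_bigA /= Lph_sum mulr_sumr big_mkcond; apply: eq_bigr => T _ /=.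
  case: forallP => [H|H]; last first.
    have [i hi] : exists i, ~~ (T i <= minn (P1 i) (Q2 i))%N.
      by apply/existsP; rewrite -negb_forall; apply/forallP.
    by rewrite (bigD1 i) //= /FL (cz _ _ _ hi) mulr0 mul0r scale0r mul0r Lph0 mulr0.
  have TP i : (T i <= P1 i)%N by apply: leq_trans (H i) (geq_minl _ _).
  have sT : (\sum_i T i <= mabs P1)%N by apply: leq_sum => i _; exact: TP.
  have m1 : mabs (fun i => P1 i + P2 i - T i)%N = (mabs P1 + mabs P2 - \sum_i T i)%N.
    rewrite (@mabsB _ (fun i => P1 i + P2 i)%N (fun i => val (T i))) ?mabsD // => i.
    exact: leq_trans (TP i) (leq_addr _ _).
  have m2 : mabs (fun i => P1 i + Q2 i - T i)%N = (mabs P1 + mabs P2 - \sum_i T i)%N.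
    rewrite (@mabsB _ (fun i => P1 i + Q2 i)%N (fun i => val (T i))) ?mabsD ?PQ2 // => i.
    exact: leq_trans (TP i) (leq_addr _ _).
  rewrite coefE (@wick_prodE _ _ hbar (B + B)%N); last first.
    by move=> i; have := P1B i; have := P2B i; lia.
  rewrite -/x m1 m2 -PQ2 /FL scaler_prod [X in X *: _]big_split [X in _ *: X]big_split /= LphZ prodrXr Lph_XnM.
  have -> : Lph (fun j => pochN hbar N (\sum_i T i + j)) (\prod_i om (B + B) i (a i) (b i) (P1 i + P2 i - T i) (Q3 i))
    = Lph (pochN hbar (mabs P1 + mabs P2 - \sum_i T i + mabs Q3)) (\prod_i om (B + B) i (a i) (b i) (P1 i + P2 i - T i) (Q3 i)).
    apply: Lph_ext => j _; rewrite /pochN /N; congr (poch _ _); lia.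
  have := poch_neq0; rewrite /K; set L := Lph _ _; set E := \prod_i (eps R i ^+ _ * _).
  set Z := \prod_i (_ ^+ P3 i * _) => pn; rewrite -/(Z); field.
  by rewrite !pn.
transitivity (K * Lph (pochN hbar N) (\prod_i \sum_(T < B) FR (B + B)%N i T)).
  congr (_ * Lph _ _); apply: eq_bigr => i _; exact: om_assoc.
rewrite (_ : \prod_i \sum_(T < B) FR (B + B)%N i T = \prod_i \sum_(T < (mabs P2).+1) FR (B + B)%N i T); last first.
  apply: eq_bigr => i _; apply: (@sum_ord_widen _ (FR (B + B)%N i) (P2 i)) => // [T h|].
    by rewrite /FR cz ?mulr0 ?mul0r ?scale0r // leq_min leqNgt h.
  by rewrite ltnS mabs_le.
rewrite bigA_distr_bigA /= Lph_sum mulr_sumr [RHS]big_mkcond; apply: eq_bigr => T _ /=.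
case: forallP => [H|H]; last first.
  have [i hi] : exists i, ~~ (T i <= minn (P2 i) (Q3 i))%N.
    by apply/existsP; rewrite -negb_forall; apply/forallP.
  by rewrite (bigD1 i) //= /FR (cz _ _ _ hi) mulr0 mul0r scale0r mul0r Lph0 mulr0.
have TP i : (T i <= P2 i)%N by apply: leq_trans (H i) (geq_minl _ _).
have TQ i : (T i <= Q3 i)%N by apply: leq_trans (H i) (geq_minr _ _).
have sT : (\sum_i T i <= mabs P2)%N by apply: leq_sum => i _; exact: TP.
have m1 : mabs (fun i => Q2 i + Q3 i - T i)%N = (mabs P2 + mabs Q3 - \sum_i T i)%N.
  rewrite (@mabsB _ (fun i => Q2 i + Q3 i)%N (fun i => val (T i))) ?mabsD -?PQ2 // => i.
  exact: leq_trans (TQ i) (leq_addl _ _).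
have m2 : mabs (fun i => P2 i + Q3 i - T i)%N = (mabs P2 + mabs Q3 - \sum_i T i)%N.
  rewrite (@mabsB _ (fun i => P2 i + Q3 i)%N (fun i => val (T i))) ?mabsD // => i.
  exact: leq_trans (TP i) (leq_addr _ _).
rewrite coefE (@wick_prodE _ _ hbar (B + B)%N); last by move=> i; have := P1B i; lia.
rewrite -/x m1 m2 /FR scaler_prod [X in X *: _]big_split [X in _ *: X]big_split /= LphZ prodrXr Lph_XnM.
have -> : Lph (fun j => pochN hbar N (\sum_i T i + j)) (\prod_i om (B + B) i (a i) (b i) (P1 i) (Q2 i + Q3 i - T i))
  = Lph (pochN hbar (mabs P1 + (mabs P2 + mabs Q3 - \sum_i T i))) (\prod_i om (B + B) i (a i) (b i) (P1 i) (Q2 i + Q3 i - T i)).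
  apply: Lph_ext => j _; rewrite /pochN /N; congr (poch _ _); lia.
have := poch_neq0; rewrite /K; set L := Lph _ _; set E := \prod_i (eps R i ^+ _ * _).
set Z := \prod_i (_ ^+ (P2 i + P3 i - _) * _) => pn; rewrite -/(Z); field.
by rewrite !pn.
Qed.

End WickAlgebra.

(** * Positivity *)

Section Positivity.
Variable R : realType.
Local Notation C := (R[i]).
Variable n : nat.
Local Notation midx := ('I_n.+1 -> nat).
Local Notation zt := (@zt R).
Local Notation AM := (@AM R).
Implicit Types (P Q S : midx).

Lemma fact_neq0 m : (m`!%:R : C) != 0.
Proof. by rewrite pnatr_eq0 -lt0n fact_gt0. Qed.

(** The truncated exponential series. Below degree K a product of such series is the exponential of
    the sum, which is the source of the multinomial formula. *)
Definition exps K (y : C) : {poly C} := \sum_(t < K) (y ^+ t / t`!%:R) *: 'X^t.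

Lemma coef_exps K y j : (j < K)%N -> (exps K y)`_j = y ^+ j / j`!%:R.
Proof.
move=> jK; rewrite /exps coef_sum (bigD1 (Ordinal jK)) //= coefZ coefXn eqxx mulr1.
rewrite big1 ?addr0 // => t tj; rewrite coefZ coefXn.
by rewrite -(inj_eq val_inj) /= in tj; rewrite eq_sym (negPf tj) mulr0.
Qed.

Lemma coef_prod_exps K (I : Type) (s : seq I) (y : I -> C) j : (j < K)%N ->
  (\prod_(i <- s) exps K (y i))`_j = (\sum_(i <- s) y i) ^+ j / j`!%:R.
Proof.
elim: s j => [|i s IH] j jK.
  by rewrite !big_nil coef1 expr0n; case: j jK => [|j] _; rewrite ?mul0r // divr1.
rewrite !big_cons coefM.
rewrite addrC exprDn mulr_suml; apply: eq_bigr => l _.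
have lj : (l <= j)%N by rewrite -ltnS.
rewrite coef_exps ?(leq_ltn_trans lj) // IH ?(leq_ltn_trans (leq_subr _ _)) //.
rewrite -mulr_natr -(bin_fact lj) !natrM.
by field; rewrite !fact_neq0 pnatr_eq0 -lt0n bin_gt0 lj.
Qed.

Lemma multinomial K (y : 'I_n.+1 -> C) j : (j < K)%N ->
  (\sum_i y i) ^+ j / j`!%:R =
  \sum_(T : {ffun 'I_n.+1 -> 'I_K} | (\sum_i T i == j)%N) \prod_i (y i ^+ T i / (T i)`!%:R).
Proof.
move=> jK; rewrite -(coef_prod_exps _ _ jK) bigA_distr_bigA coef_sum [RHS]big_mkcond.
apply: eq_bigr => T _; rewrite scaler_prod coefZ prodrXr coefXn eq_sym.
by case: eqP => _; rewrite ?mulr1 ?mulr0.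
Qed.

Section TorusAverages.
Variable K : nat.
Local Notation J := {ffun 'I_n.+1 -> 'I_K}.
Definition tor (tau : J) (i : 'I_n.+1) : C := zt K ^+ tau i.

Lemma conj_tor tau i : Num.conj (tor tau i) = (tor tau i)^-1.
Proof. by rewrite invC_norm nmE nm_zt expr1n invr1 mul1r. Qed.

(** Extracts the coefficient of v^S by Fourier inversion over K-th roots of unity in each variable;
    this is exact for exponents below K. *)
Definition extv S (g : ('I_n.+1 -> C) -> C) : C :=
  K%:R^-1 ^+ n.+1 * \sum_(tau : J) (\prod_i (tor tau i)^-1 ^+ S i) * g (tor tau).
(** Also a coefficient extraction, but sampling at the inverse, hence conjugate, roots: with this
    choice the coefficient of a conjugated function is literally the conjugate of the coefficient
    ([extu_conj]). *)
Definition extu Q (g : ('I_n.+1 -> C) -> C) : C :=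
  K%:R^-1 ^+ n.+1 * \sum_(tau : J) (\prod_i tor tau i ^+ Q i) * g (fun i => (tor tau i)^-1).

Lemma tor_avg (F : 'I_n.+1 -> C -> C) :
  K%:R^-1 ^+ n.+1 * \sum_(tau : J) \prod_i F i (tor tau i) = \prod_i AM K (F i).
Proof.
rewrite /AM big_split /= prodr_const card_ord; congr (_ * _).
by rewrite bigA_distr_bigA.
Qed.

Lemma extv_mon S T : (forall i, S i < K)%N -> (forall i, T i < K)%N ->
  extv S (fun v => \prod_i v i ^+ T i) = \prod_i (T i == S i)%:R.
Proof.
move=> hS hT; rewrite /extv (eq_bigr (fun tau : J => \prod_i ((tor tau i)^-1 ^+ S i * tor tau i ^+ T i))); last by move=> tau _; rewrite big_split.
rewrite (tor_avg (fun i t => t^-1 ^+ S i * t ^+ T i)); apply: eq_bigr => i _.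
by rewrite -(AM_orth R (hT i) (hS i)); apply: eq_AM => t _; rewrite mulrC.
Qed.

Lemma extu_mon Q T : (forall i, Q i < K)%N -> (forall i, T i < K)%N ->
  extu Q (fun v => \prod_i v i ^+ T i) = \prod_i (T i == Q i)%:R.
Proof.
move=> hS hT; rewrite /extu (eq_bigr (fun tau : J => \prod_i (tor tau i ^+ Q i * (tor tau i)^-1 ^+ T i))); last by move=> tau _; rewrite big_split.
rewrite (tor_avg (fun i t => t ^+ Q i * t^-1 ^+ T i)); apply: eq_bigr => i _.
by rewrite eq_sym -(AM_orth R (hS i) (hT i)); apply: eq_AM.
Qed.

Lemma extu_conj Q g gb : (forall tau, gb (fun i => (tor tau i)^-1) = Num.conj (g (tor tau))) ->
  extu Q gb = Num.conj (extv Q g).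
Proof.
move=> H; rewrite /extu /extv rmorphM rmorphXn fmorphV rmorph_nat rmorph_sum /=; congr (_ * _).
apply: eq_bigr => tau _; rewrite H rmorphM rmorph_prod; congr (_ * _).
by apply: eq_bigr => i _; rewrite rmorphXn fmorphV /= conj_tor invrK.
Qed.

Definition extuv Q S (F : ('I_n.+1 -> C) -> ('I_n.+1 -> C) -> C) : C :=
  extu Q (fun u => extv S (F u)).

Lemma extv_sum S (A : finType) (pr : pred A) (G : A -> ('I_n.+1 -> C) -> C) :
  extv S (fun v => \sum_(i | pr i) G i v) = \sum_(i | pr i) extv S (G i).
Proof.
rewrite /extv -mulr_sumr; congr (_ * _); rewrite exchange_big /=.
by apply: eq_bigr => t _; rewrite mulr_sumr.
Qed.

Lemma extu_sum S (A : finType) (pr : pred A) (G : A -> ('I_n.+1 -> C) -> C) :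
  extu S (fun v => \sum_(i | pr i) G i v) = \sum_(i | pr i) extu S (G i).
Proof.
rewrite /extu -mulr_sumr; congr (_ * _); rewrite exchange_big /=.
by apply: eq_bigr => t _; rewrite mulr_sumr.
Qed.

Lemma extvZ S c g : extv S (fun v => c * g v) = c * extv S g.
Proof. by rewrite /extv [RHS]mulrCA; congr (_ * _); rewrite mulr_sumr; apply: eq_bigr => t _; rewrite mulrCA. Qed.

Lemma extuZ S c g : extu S (fun v => c * g v) = c * extu S g.
Proof. by rewrite /extu [RHS]mulrCA; congr (_ * _); rewrite mulr_sumr; apply: eq_bigr => t _; rewrite mulrCA. Qed.

Lemma extuv_sum Q S (A : finType) (pr : pred A) (G : A -> ('I_n.+1 -> C) -> ('I_n.+1 -> C) -> C) :
  extuv Q S (fun u v => \sum_(i | pr i) G i u v) = \sum_(i | pr i) extuv Q S (G i).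
Proof.
rewrite /extuv -extu_sum; congr (extu _ _); apply/funext => u; exact: extv_sum.
Qed.

Lemma extuvZ Q S c G : extuv Q S (fun u v => c * G u v) = c * extuv Q S G.
Proof.
rewrite /extuv -extuZ; congr (extu _ _); apply/funext => u; exact: extvZ.
Qed.

Lemma extuvM Q S g h : extuv Q S (fun u v => g u * h v) = extu Q g * extv S h.
Proof.
rewrite /extuv mulrC -extuZ; congr (extu _ _); apply/funext => u.
by rewrite mulrC -extvZ.
Qed.

End TorusAverages.
End Positivity.

(** * The Pochhammer summation behind positivity *)

Section WickPositivity.
Variable R : realType.
Local Notation C := (R[i]).
Variable n : nat.
Local Notation midx := ('I_n.+1 -> nat).
Implicit Types (P Q S : midx).

Lemma pochS (y : C) m : poch y m.+1 = poch y m * (y + m%:R).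
Proof. by rewrite /poch big_ord_recr. Qed.

Lemma pochD (y : C) k m : poch y (k + m) = poch y k * poch (y + k%:R) m.
Proof.
elim: m => [|m IH]; first by rewrite addn0 [poch (_ + _) 0]big_ord0 mulr1.
by rewrite addnS !pochS IH natrD -!mulrA addrA.
Qed.

(** A form of the Chu-Vandermonde identity. In the induction on al, Pascal's rule splits the
    contraction number; after a shift of the index every term acquires the factor (y + al + be - t)
    - (be - t) = y + al, independent of t. *)
Lemma poch_contr (y : C) al be D : (al < D)%N ->
  \sum_(t < D) (-1) ^+ t * (contr al be t)%:R * poch y (al + be - t) = poch y al * poch y be.
Proof.
elim: al D => [|al IH] D aD.
  case: D aD => // D _; rewrite big_ord_recl big1 ?addr0 => [|t _]; last first.
    by rewrite /contr bin0n muln0 mulr0 mul0r.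
  by rewrite /contr !bin0 subn0 [poch y 0]big_ord0 !mul1r.
case: D aD => // D; rewrite ltnS => aD.
pose G t := (-1) ^+ t * (contr al be t)%:R * poch y (al + be - t).
have -> : \sum_(t < D.+1) (-1) ^+ t * (contr al.+1 be t)%:R * poch y (al.+1 + be - t) =
  \sum_(t < D.+1) ((-1) ^+ t * (contr al be t)%:R * poch y (al.+1 + be - t)) -
  \sum_(t < D) ((-1) ^+ t * ((t.+1)`! * 'C(al, t) * 'C(be, t.+1))%:R * poch y (al + be - t)).
  rewrite !big_ord_recl -addrA -sumrB; congr (_ + _).
    by rewrite /contr !bin0.
  apply: eq_bigr => t _; rewrite /= /bump /= add1n /contr binS mulnDr mulnDl natrD.
  by rewrite addSn subSS exprS; ring.
have -> : \sum_(t < D) ((-1) ^+ t * ((t.+1)`! * 'C(al, t) * 'C(be, t.+1))%:R * poch y (al + be - t)) =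
   \sum_(t < D.+1) G t * (be - t)%:R.
  rewrite big_ord_recr /= {2}/G /contr (bin_small aD) muln0 mul0n mulr0 mul0r mul0r addr0.
  apply: eq_bigr => t _; rewrite /G.
  have -> : ((t.+1)`! * 'C(al, t) * 'C(be, t.+1) = contr al be t * (be - t))%N.
    by rewrite /contr factS -[RHS]mulnA [('C(be, t) * _)%N]mulnC -mul_bin_left; lia.
  by rewrite natrM; ring.
rewrite -sumrB pochS [poch y al * _]mulrC -mulrA -(IH _ (leqW aD)) mulr_sumr.
apply: eq_bigr => t _; rewrite /G.
have [tt|tt] := boolP ((t <= al)%N && (t <= be)%N); last first.
  have -> : contr al be t = 0%N.
    by move: tt; rewrite negb_and /contr -!ltnNge => /orP [] h; rewrite (bin_small h) ?muln0.
  by rewrite !mulr0 !mul0r subrr mulr0.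
case/andP: tt => t1 t2.
rewrite (_ : al.+1 + be - t = (al + be - t).+1)%N; last by lia.
rewrite pochS (_ : al + be - t = al + (be - t))%N; last by lia.
by rewrite natrD; ring.
Qed.

Lemma sum_triangle (V : nmodType) (F : nat -> nat -> V) mu :
  \sum_(j < mu.+1) \sum_(l < j.+1) F j l = \sum_(l < mu.+1) \sum_(t < (mu - l).+1) F (l + t)%N l.
Proof.
under eq_bigr => j _ do rewrite (big_ord_widen mu.+1 (F j)) ?ltn_ord //.
rewrite (exchange_big_dep predT) //=; apply: eq_bigr => l _.
rewrite -(big_mkord (fun j => (l < j.+1)%N) (fun j => F j l)).
rewrite (@big_cat_nat _ _ _ l) //=; last by rewrite ltnW.
rewrite big_nat_cond big1 ?add0r; last by move=> j /andP [/andP [_ jl]]; rewrite ltnS leqNgt jl.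
rewrite big_nat_cond (eq_bigl (fun j => l <= j < mu.+1)%N); last first.
  by move=> j; apply/idP/idP; lia.
rewrite -big_nat -{1}[nat_of_ord l]add0n big_addn big_mkord subSn; last by rewrite -ltnS.
by apply: eq_bigr => t _; rewrite addnC.
Qed.

(* Coefficientwise form of
   (1 - al - be + al be - h)^(-x) = sum_l (x)_l / l! h^l ((1 - al) (1 - be))^(-x-l). *)
Lemma wick_kernel (x h al be : C) m k : (forall j, poch x j != 0) ->
  \sum_(j < (minn m k).+1) poch x (m + k - j) * ((h - al * be) ^+ j / j`!%:R) *
     (al ^+ (m - j) / (m - j)`!%:R) * (be ^+ (k - j) / (k - j)`!%:R) =
  \sum_(l < (minn m k).+1) poch x m * poch x k / (poch x l * l`!%:R) * h ^+ l *
     (al ^+ (m - l) / (m - l)`!%:R) * (be ^+ (k - l) / (k - l)`!%:R).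
Proof.
move=> px0; set mu := minn m k.
pose F j l := poch x (m + k - j) * ((h ^+ l * (- (al * be)) ^+ (j - l)) *+ 'C(j, l) / j`!%:R) *
     (al ^+ (m - j) / (m - j)`!%:R) * (be ^+ (k - j) / (k - j)`!%:R).
have -> : \sum_(j < mu.+1) poch x (m + k - j) * ((h - al * be) ^+ j / j`!%:R) *
     (al ^+ (m - j) / (m - j)`!%:R) * (be ^+ (k - j) / (k - j)`!%:R) =
   \sum_(j < mu.+1) \sum_(l < j.+1) F j l.
  apply: eq_bigr => j _; rewrite [h - _]addrC exprDn mulr_suml mulr_sumr !mulr_suml.
  by apply: eq_bigr => l _; rewrite /F [h ^+ l * _]mulrC.
rewrite sum_triangle; apply: eq_bigr => l _.
have lm : (l <= m)%N by have := ltn_ord l; rewrite /mu; lia.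
have lk : (l <= k)%N by have := ltn_ord l; rewrite /mu; lia.
pose al' := (m - l)%N; pose be' := (k - l)%N.
have mE : m = (l + al')%N by rewrite /al'; lia.
have kE : k = (l + be')%N by rewrite /be'; lia.
have muE : (mu - l = minn al' be')%N by rewrite /mu /al' /be'; move: (nat_of_ord l) => q; clear; lia.
rewrite muE.
have -> : poch x m * poch x k / (poch x l * l`!%:R) = poch x l / l`!%:R * (poch (x + l%:R) al' * poch (x + l%:R) be').
  by rewrite {1}mE {1}kE !pochD; field; rewrite px0 fact_neq0.
rewrite -(@poch_contr _ al' be' al'.+1) // mulr_sumr !mulr_suml.
have -> : \sum_(t < al'.+1) poch x l / l`!%:R * ((-1) ^+ t * (contr al' be' t)%:R * poch (x + l%:R) (al' + be' - t)) * h ^+ l *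
    (al ^+ (m - l) / (m - l)`!%:R) * (be ^+ (k - l) / (k - l)`!%:R) =
  \sum_(t < (minn al' be').+1) poch x l / l`!%:R * ((-1) ^+ t * (contr al' be' t)%:R * poch (x + l%:R) (al' + be' - t)) * h ^+ l *
    (al ^+ (m - l) / (m - l)`!%:R) * (be ^+ (k - l) / (k - l)`!%:R).
  apply: (@sum_ord_widen _ (fun t => poch x l / l`!%:R * ((-1) ^+ t * (contr al' be' t)%:R * poch (x + l%:R) (al' + be' - t)) * h ^+ l *
    (al ^+ (m - l) / (m - l)`!%:R) * (be ^+ (k - l) / (k - l)`!%:R)) (minn al' be')) => // [t|].
    rewrite gtn_min /contr => /orP [] H; rewrite (bin_small H) ?muln0 ?mul0n ?mulr0 ?mul0r ?mulr0 ?mul0r //.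
  by rewrite ltnS geq_minl.
apply: eq_bigr => t _.
have tm : (t <= al')%N by have := ltn_ord t; lia.
have tk : (t <= be')%N by have := ltn_ord t; lia.
rewrite /F -/al' -/be' addKn.
rewrite (_ : m + k - (l + t) = l + (al' + be' - t))%N; last by rewrite mE kE; lia.
rewrite (_ : m - (l + t) = al' - t)%N; last by rewrite mE; lia.
rewrite (_ : k - (l + t) = be' - t)%N; last by rewrite kE; lia.
have alE : al ^+ al' = al ^+ (al' - t) * al ^+ t by rewrite -exprD subnK.
have beE : be ^+ be' = be ^+ (be' - t) * be ^+ t by rewrite -exprD subnK.
rewrite alE beE pochD [(- (al * be)) ^+ _]exprNn exprMn /contr -[_ *+ (binomial (l + t) l)]mulr_natr.
have binE p q : (q <= p)%N -> ('C(p, q)%:R : C) = p`!%:R / (q`!%:R * (p - q)`!%:R).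
  by move=> qp; rewrite -(bin_fact qp) !natrM mulfK // mulf_neq0 ?fact_neq0.
rewrite !natrM (binE (l + t)%N l) ?leq_addr // (binE al') // (binE be') // addKn.
by field; rewrite !fact_neq0.
Qed.

End WickPositivity.

(** * Wick products as coefficients of a generating function *)

Section WickGenerating.
Variable R : realType.
Local Notation C := (R[i]).
Variable n : nat.
Local Notation midx := ('I_n.+1 -> nat).
Implicit Types (P Q S : midx).
Variable hbar : R.
Hypothesis hpos : 0 < hbar.
Let x : C := real_complex R ((2 * hbar)^-1).
Variable r : Zpt R n.
Let a i : C := val r 0 i.
Let b i : C := Num.conj (val r 0 i).

Definition axf (u : 'I_n.+1 -> C) : C := \sum_i a i * u i.
Definition bxf (v : 'I_n.+1 -> C) : C := \sum_i b i * v i.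
Definition etf (u v : 'I_n.+1 -> C) : C := \sum_i eps R i * (u i * v i).

Definition wker m k u v : C :=
  \sum_(j < (minn m k).+1) poch x (m + k - j) * (etf u v ^+ j / j`!%:R) *
     (axf u ^+ (m - j) / (m - j)`!%:R) * (bxf v ^+ (k - j) / (k - j)`!%:R).

Lemma inner_pick K (c : 'I_n.+1 -> C) Q (T : 'I_n.+1 -> nat) : (forall i, Q i < K)%N ->
  \sum_(A : {ffun 'I_n.+1 -> 'I_K} | (\sum_i A i == mabs Q - \sum_i T i)%N)
     ((\prod_i (c i ^+ A i / (A i)`!%:R)) * \prod_i ((T i + A i)%N == Q i)%:R) =
  \prod_i (if (T i <= Q i)%N then c i ^+ (Q i - T i) / (Q i - T i)`!%:R else 0).
Proof.
move=> QK.
pose g i (t : nat) : C := c i ^+ t / t`!%:R * ((T i + t)%N == Q i)%:R.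
transitivity (\prod_i \sum_(t < K) g i t).
  rewrite bigA_distr_bigA big_mkcond; apply: eq_bigr => A _ /=.
  rewrite -big_split /=; case: eqP => // sA.
  have [i hi] : exists i, (T i + A i)%N != Q i.
    apply/existsP; rewrite -negb_forall; apply/negP => /forallP H; apply: sA.
    rewrite /mabs; under [in RHS]eq_bigr => i _ do rewrite -(eqP (H i)).
    by rewrite big_split /= addKn.
  by rewrite (bigD1 i) //= /g (negPf hi) mulr0 mul0r.
apply: eq_bigr => i _; rewrite /g; case: leqP => TQ.
  have lt : (Q i - T i < K)%N by apply: leq_ltn_trans (leq_subr _ _) (QK i).
  rewrite (bigD1 (Ordinal lt)) //= subnKC // eqxx mulr1 big1 ?addr0 // => t.
  rewrite -(inj_eq val_inj) /= => tn; case: eqP => [E|]; last by rewrite mulr0.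
  by move: tn; rewrite -E addKn eqxx.
rewrite big1 // => t _; case: eqP => [E|]; last by rewrite mulr0.
by move: TQ; rewrite -E ltnNge leq_addr.
Qed.

(** The powers of eta, r.u and conj r.v are expanded by the multinomial formula with indices T, A,
    B. Extracting u^Q v^S leaves A = Q - T and B = S - T, and Q! S! / (T! (Q - T)! (S - T)!) is the
    product of the contraction numbers. *)
Lemma wick_extract K Q S : (mabs Q < K)%N -> (mabs S < K)%N ->
  Lph (pochN hbar (mabs Q + mabs S)) (\prod_i om K i (a i) (b i) (Q i) (S i)) =
  (\prod_i (Q i)`!%:R) * (\prod_i (S i)`!%:R) *
    extuv K Q S (wker (mabs Q) (mabs S)).
Proof.
move=> QK SK.
have Qi i : (Q i < K)%N := leq_ltn_trans (mabs_le Q i) QK.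
have Si i : (S i < K)%N := leq_ltn_trans (mabs_le S i) SK.
set m := mabs Q in QK *; set k := mabs S in SK *.
pose J := {ffun 'I_n.+1 -> 'I_K}.
pose mn := minn m k.
have mnK : (mn < K)%N by apply: leq_ltn_trans (geq_minl _ _) QK.
have wE : wker m k = fun u v => \sum_(T : J | (\sum_i T i <= mn)%N)
    \sum_(A : J | (\sum_i A i == m - \sum_i T i)%N) \sum_(B : J | (\sum_i B i == k - \sum_i T i)%N)
    (poch x (m + k - \sum_i T i) * (\prod_i (eps R i ^+ T i / (T i)`!%:R)) *
     (\prod_i (a i ^+ A i / (A i)`!%:R)) * (\prod_i (b i ^+ B i / (B i)`!%:R))) *
    ((\prod_i u i ^+ (T i + A i)) * (\prod_i v i ^+ (T i + B i))).
  apply/funext => u; apply/funext => v; rewrite /wker -/mn.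
  (* The terms are grouped by j = |T|; [inord] is faithful on them because the filter gives |T| <=
     mn. *)
  rewrite [RHS](partition_big (fun T : J => inord (\sum_i T i) : 'I_mn.+1) predT) //=.
  apply: eq_bigr => j _.
  have jm : (j <= mn)%N by rewrite -ltnS.
  have jK : (j < K)%N := leq_ltn_trans jm mnK.
  rewrite /etf (multinomial _ jK) /axf (multinomial _ (leq_ltn_trans (leq_subr j m) QK)) /bxf
    (multinomial _ (leq_ltn_trans (leq_subr j k) SK)).
  rewrite [X in X * _ * _]mulr_sumr !mulr_suml; apply: eq_big.
    move=> T; apply/eqP/andP => [sT|[sT /eqP <-]].
      by rewrite sT jm; split=> //; apply/eqP/val_inj; rewrite /= inordK.
    by rewrite inordK.
  move=> T /eqP sT; rewrite sT [X in X * _]mulr_sumr mulr_suml; apply: eq_bigr => A _.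
  rewrite mulr_sumr; apply: eq_bigr => B _.
  have -> : \prod_i ((eps R i * (u i * v i)) ^+ T i / (T i)`!%:R) =
     \prod_i (eps R i ^+ T i / (T i)`!%:R) * ((\prod_i u i ^+ T i) * \prod_i v i ^+ T i).
    by rewrite -!big_split; apply: eq_bigr => i _ /=; rewrite !exprMn; ring.
  have pE (c y : 'I_n.+1 -> C) (D : J) : \prod_i ((c i * y i) ^+ D i / (D i)`!%:R) =
     \prod_i (c i ^+ D i / (D i)`!%:R) * \prod_i y i ^+ D i.
    by rewrite -!big_split; apply: eq_bigr => i _ /=; rewrite !exprMn; ring.
  have qE (y : 'I_n.+1 -> C) (D : J) : \prod_i y i ^+ (T i + D i) =
     (\prod_i y i ^+ T i) * \prod_i y i ^+ D i.
    by rewrite -!big_split; apply: eq_bigr => i _ /=; rewrite exprD.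
  by rewrite !pE !qE; ring.
rewrite wE.
have -> : extuv K Q S (fun u v => \sum_(T : J | (\sum_i T i <= mn)%N)
    \sum_(A : J | (\sum_i A i == m - \sum_i T i)%N) \sum_(B : J | (\sum_i B i == k - \sum_i T i)%N)
    (poch x (m + k - \sum_i T i) * (\prod_i (eps R i ^+ T i / (T i)`!%:R)) *
     (\prod_i (a i ^+ A i / (A i)`!%:R)) * (\prod_i (b i ^+ B i / (B i)`!%:R))) *
    ((\prod_i u i ^+ (T i + A i)) * (\prod_i v i ^+ (T i + B i)))) =
  \sum_(T : J | (\sum_i T i <= mn)%N) poch x (m + k - \sum_i T i) * (\prod_i (eps R i ^+ T i / (T i)`!%:R)) *
     (\prod_i (if (T i <= Q i)%N then a i ^+ (Q i - T i) / (Q i - T i)`!%:R else 0)) *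
     (\prod_i (if (T i <= S i)%N then b i ^+ (S i - T i) / (S i - T i)`!%:R else 0)).
  rewrite extuv_sum; apply: eq_bigr => T sT; cbv beta.
  rewrite -(@inner_pick K a Q (fun i => val (T i)) Qi) -(@inner_pick K b S (fun i => val (T i)) Si).
  rewrite extuv_sum [X in _ = X * _]mulr_sumr mulr_suml; apply: eq_bigr => A sA; cbv beta.
  rewrite extuv_sum mulr_sumr; apply: eq_bigr => B sB; cbv beta.
  rewrite extuvZ (extuvM K Q S (fun u => \prod_i u i ^+ (T i + A i)) (fun v => \prod_i v i ^+ (T i + B i))).
  have hA i : (T i + A i < K)%N.
    apply: leq_ltn_trans QK; rewrite -(subnKC (leq_trans sT (geq_minl m k))) -(eqP sA).
    exact: leq_add (mabs_le (fun i => val (T i)) i) (mabs_le (fun i => val (A i)) i).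
  have hB i : (T i + B i < K)%N.
    apply: leq_ltn_trans SK; rewrite -(subnKC (leq_trans sT (geq_minr m k))) -(eqP sB).
    exact: leq_add (mabs_le (fun i => val (T i)) i) (mabs_le (fun i => val (B i)) i).
  by rewrite (@extu_mon _ _ K Q (fun i => T i + A i)%N) // (@extv_mon _ _ K S (fun i => T i + B i)%N) //; ring.
rewrite -(sum_prod_om _ _ (fun i T => omc i (a i) (b i) (Q i) (S i) T)) mulr_sumr [RHS]big_mkcond.
apply: eq_bigr => T _ /=; rewrite /pochN -/x -/m -/k.
have [H|H] := boolP [forall i, (T i <= minn (Q i) (S i))%N]; last first.
  have [i hi] : exists i, ~~ (T i <= minn (Q i) (S i))%N by apply/existsP; rewrite -negb_forall.
  rewrite (bigD1 i) //= omc0 // !mul0r; case: ifP => // _.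
  move: hi; rewrite leq_min negb_and => /orP [] /negPf hi.
    by rewrite [X in _ * (_ * X * _)](bigD1 i) //= hi mul0r !(mulr0, mul0r).
  by rewrite [X in _ * (_ * X)](bigD1 i) //= hi mul0r !mulr0.
have TQ i : (T i <= Q i)%N by apply: leq_trans (forallP H i) (geq_minl _ _).
have TS i : (T i <= S i)%N by apply: leq_trans (forallP H i) (geq_minr _ _).
have -> : (\sum_i T i <= mn)%N.
  by rewrite leq_min; apply/andP; split; apply: leq_sum => i _; [exact: TQ|exact: TS].
have -> : \prod_i (if (T i <= Q i)%N then a i ^+ (Q i - T i) / (Q i - T i)`!%:R else 0) =
   \prod_i (a i ^+ (Q i - T i) / (Q i - T i)`!%:R) by apply: eq_bigr => i _; rewrite TQ.
have -> : \prod_i (if (T i <= S i)%N then b i ^+ (S i - T i) / (S i - T i)`!%:R else 0) =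
   \prod_i (b i ^+ (S i - T i) / (S i - T i)`!%:R) by apply: eq_bigr => i _; rewrite TS.
rewrite [RHS](_ : _ = ((\prod_i (Q i)`!%:R) * (\prod_i (S i)`!%:R) *
   (\prod_i (eps R i ^+ T i / (T i)`!%:R)) * (\prod_i (a i ^+ (Q i - T i) / (Q i - T i)`!%:R)) *
   (\prod_i (b i ^+ (S i - T i) / (S i - T i)`!%:R))) * poch x (m + k - \sum_i T i)); last by ring.
congr (_ * _); rewrite -!big_split; apply: eq_bigr => i _ /=; rewrite /omc /contr.
have fN j : (j`!%:R : C) != 0 by exact: fact_neq0.
have bE p : (T i <= p)%N -> ('C(p, T i)%:R : C) = p`!%:R / ((T i)`!%:R * (p - T i)`!%:R).
  by move=> h; rewrite -(bin_fact h) -natrM !natrM mulfK // mulf_neq0.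
by rewrite !natrM (bE _ (TQ i)) (bE _ (TS i)); field; rewrite !fN.
Qed.

End WickGenerating.

(** [g] is |r_0| and [p] the phase of r_0; [uv], [cu], [cv] stand for the sums over i > 0 of u_i
    v_i, r_i u_i and conj r_i v_i. The factor g^2 - 1 will be replaced by the sum of |r_i|^2. *)
Lemma gram_algebra (F : fieldType) (g p u0 v0 cu cv uv : F) : p != 0 -> g + 1 != 0 ->
  - (u0 * v0) + uv + (g * p * u0 + cu) * (g / p * v0 + cv) =
  uv + cu * (p^-1 * v0 + cv / (g + 1)) + (p * u0 + cu / (g + 1)) * cv +
  (g ^+ 2 - 1) * ((p * u0 + cu / (g + 1)) * (p^-1 * v0 + cv / (g + 1))).
Proof. by move=> p0 g1; field; rewrite p0 g1. Qed.

(** * Wick products as a Gram matrix *)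

Section WickGram.
Variable R : realType.
Local Notation C := (R[i]).
Variable n : nat.
Local Notation midx := ('I_n.+1 -> nat).
Implicit Types (P Q S : midx).
Variable hbar : R.
Hypothesis hpos : 0 < hbar.
Let x : C := real_complex R ((2 * hbar)^-1).
Variable r : Zpt R n.
Let a i : C := val r 0 i.
Let b i : C := Num.conj (val r 0 i).
Let g : C := `|a ord0|.

Definition spc (y v : 'I_n.+1 -> C) : C := \sum_(i | i != ord0) y i * v i.
(** Up to a phase and the sign of the time coordinate, the spatial components of v after the boost
    that brings r to rest, with [g] as Lorentz factor. The component of index 0 is set to zero so
    that sums may run over all indices. *)
Definition Lv i (v : 'I_n.+1 -> C) : C :=
  if i == ord0 then 0 else v i + a i * (b ord0 / g * v ord0 + spc b v / (g + 1)).
Definition Lu i (u : 'I_n.+1 -> C) : C :=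
  if i == ord0 then 0 else u i + b i * (a ord0 / g * u ord0 + spc a u / (g + 1)).

Lemma ab_norm i : a i * b i = `|a i| ^+ 2.
Proof. by rewrite normCK. Qed.

Lemma spc_ab : spc a b = g ^+ 2 - 1.
Proof.
have := valP r; rewrite /in_Z => /eqP H; rewrite /spc (eq_bigr _ (fun i _ => ab_norm i)).
by rewrite -H addrA subrr add0r.
Qed.

Lemma g_gt0 : 0 < g.
Proof.
have h : 0 <= g ^+ 2 - 1 by rewrite -spc_ab; apply: sumr_ge0 => i _; rewrite ab_norm exprn_ge0.
rewrite lt_neqAle normr_ge0 andbT; apply/eqP => g0; move: h.
by rewrite -g0 expr0n /= sub0r oppr_ge0 ler10.
Qed.

Lemma gram u v : etf u v + axf r u * bxf r v = \sum_i Lu i u * Lv i v.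
Proof.
have g0 : g != 0 by rewrite gt_eqF ?g_gt0.
have g1 : g + 1 != 0 by rewrite gt_eqF // addr_gt0 ?g_gt0.
have a0 : a ord0 != 0 by move: g0; rewrite /g normr_eq0.
pose p := a ord0 / g.
have p0 : p != 0 by rewrite mulf_neq0 ?invr_eq0.
have aE : a ord0 = g * p by rewrite /p mulrC divfK.
have bE : b ord0 = g / p by rewrite /p invf_div mulrA -expr2 /g -ab_norm mulrAC mulfV ?mul1r.
have bgE : b ord0 / g = p^-1 by rewrite bE mulrAC mulfV ?mul1r.
rewrite /etf /axf /bxf -/a -/b (bigD1 ord0) //= /eps eqxx mulN1r.
rewrite [\sum_i a i * _](bigD1 ord0) //= [\sum_i b i * _](bigD1 ord0) //= -/(spc a u) -/(spc b v).
rewrite [RHS](bigD1 ord0) //= {1}/Lu eqxx mul0r add0r.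
rewrite -/a -/b {1}aE {1}bE gram_algebra // -spc_ab {1 3}/spc.
set V := p^-1 * _ + _; set U := p * u _ + _.
rewrite mulr_suml mulr_sumr !mulr_suml -!big_split /=; apply: eq_bigr => i /negPf i0.
by rewrite /Lu /Lv i0 bgE -/V -/p -/U; ring.
Qed.

Lemma conj_a i : Num.conj (a i) = b i. Proof. by []. Qed.
Lemma conj_b i : Num.conj (b i) = a i. Proof. by rewrite /b conjCK. Qed.

Lemma Lu_conj i v : Lu i (fun i => Num.conj (v i)) = Num.conj (Lv i v).
Proof.
rewrite /Lu /Lv; case: ifP => _; first by rewrite conjC0.
have gc : Num.conj g = g by apply: conj_Creal; apply: normr_real.
rewrite !(rmorphD, rmorphM, fmorphV, rmorph1) /= gc conj_a (conj_b ord0) rmorph_sum /=.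
congr (_ + _ * (_ + _ / _)); apply: eq_bigr => j _.
by rewrite rmorphM /= (conj_b j).
Qed.

Lemma axf_conj v : axf r (fun i => Num.conj (v i)) = Num.conj (bxf r v).
Proof.
rewrite /axf /bxf rmorph_sum; apply: eq_bigr => j _.
by rewrite rmorphM /= conjCK.
Qed.

(** The zero branch for l > k lets l range over one common interval for all degrees; Gram vectors of
    different monomials thus have the same index set. *)
Definition Gv k l (I : {ffun 'I_l -> 'I_n.+1}) (v : 'I_n.+1 -> C) : C :=
  if (l <= k)%N then (\prod_s Lv (I s) v) * (bxf r v ^+ (k - l) / (k - l)`!%:R) else 0.
Definition Gu m l (I : {ffun 'I_l -> 'I_n.+1}) (u : 'I_n.+1 -> C) : C :=
  if (l <= m)%N then (\prod_s Lu (I s) u) * (axf r u ^+ (m - l) / (m - l)`!%:R) else 0.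

Lemma Gu_conj m l (I : {ffun 'I_l -> 'I_n.+1}) v :
  Gu m I (fun i => Num.conj (v i)) = Num.conj (Gv m I v).
Proof.
rewrite /Gu /Gv; case: ifP => _; last by rewrite conjC0.
rewrite axf_conj !rmorphM rmorphXn fmorphV rmorph_nat rmorph_prod; congr (_ * _).
by apply: eq_bigr => s _; rewrite Lu_conj.
Qed.

(** The power (sum_i Lu_i Lv_i)^l is expanded over l-tuples I of indices, which separates the
    dependence on u from that on v. *)
Lemma wkerE m k D u v : (minn m k < D)%N ->
  wker hbar r m k u v =
  poch x m * poch x k * \sum_(l < D) \sum_(I : {ffun 'I_l -> 'I_n.+1})
    (poch x l * l`!%:R)^-1 * (Gu m I u * Gv k I v).
Proof.
move=> mkD; rewrite /wker -/x.
have -> : etf u v = \sum_i Lu i u * Lv i v - axf r u * bxf r v by rewrite -gram addrK.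
rewrite wick_kernel => [|j]; last exact: poch_neq0.
rewrite mulr_sumr (big_ord_widen D (fun l => poch x m * poch x k / (poch x l * l`!%:R) *
  (\sum_i Lu i u * Lv i v) ^+ l *
  (axf r u ^+ (m - l) / (m - l)`!%:R) * (bxf r v ^+ (k - l) / (k - l)`!%:R))) // big_mkcond.
apply: eq_bigr => l _; rewrite ltnS leq_min /Gu /Gv.
case: (l <= m)%N; last by rewrite [X in _ = _ * X]big1 ?mulr0 ?andbF // => I _; rewrite !(mul0r, mulr0).
case: (l <= k)%N; last by rewrite [X in _ = _ * X]big1 ?mulr0 ?andbF // => I _; rewrite !(mul0r, mulr0).
have -> : (\sum_i Lu i u * Lv i v) ^+ l = \prod_(s < l) \sum_i Lu i u * Lv i v.
  by rewrite prodr_const card_ord.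
rewrite bigA_distr_bigA /= mulr_sumr !mulr_suml mulr_sumr; apply: eq_bigr => I _.
by rewrite big_split /=; ring.
Qed.

(** The component (l, I) of the Gram vector of f_{P,Q}; the positive weight of this component stays
    outside, which avoids square roots. *)
Definition Zf K P Q l (I : {ffun 'I_l -> 'I_n.+1}) : C :=
  (\prod_i a i ^+ P i) * (\prod_i (Q i)`!%:R) * extv K Q (Gv (mabs Q) I).

(** The left factor is the conjugate of f_{P,Q}. The normalisation of the Wick product cancels the
    prefactor (x)_m (x)_k in [wkerE], and coefficient extraction splits into one factor for (P, Q)
    and one for (P', Q'). *)
Lemma wick_gram K P Q P' Q' : (mabs Q < K)%N -> (mabs Q' < K)%N ->
  wick_prod hbar Q P P' Q' r =
  \sum_(l < K) \sum_(I : {ffun 'I_l -> 'I_n.+1})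
    (poch x l * l`!%:R)^-1 * (Num.conj (Zf K P Q I) * Zf K P' Q' I).
Proof.
move=> QK QK'.
rewrite (wick_prodE hbar (B := K)) => [|i]; last exact: leq_ltn_trans (mabs_le Q i) QK.
rewrite wick_extract // -/x.
have -> : wker hbar r (mabs Q) (mabs Q') = fun u v =>
  poch x (mabs Q) * poch x (mabs Q') * \sum_(l < K) \sum_(I : {ffun 'I_l -> 'I_n.+1})
    (poch x l * l`!%:R)^-1 * (Gu (mabs Q) I u * Gv (mabs Q') I v).
  apply/funext => u; apply/funext => v; rewrite (@wkerE _ _ K) //.
  exact: leq_ltn_trans (geq_minl _ _) QK.
rewrite extuvZ extuv_sum.
set X := poch x (mabs Q) * poch x (mabs Q').
have X0 : X != 0 by rewrite mulf_neq0 // poch_neq0.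
transitivity ((\prod_i (Q i)`!%:R * \prod_i (Q' i)`!%:R *
   \sum_(l < K) extuv K Q Q' (fun u v => \sum_(I : {ffun 'I_l -> 'I_n.+1})
    (poch x l * l`!%:R)^-1 * (Gu (mabs Q) I u * Gv (mabs Q') I v)))
   * \prod_i (a i ^+ P' i * b i ^+ P i)).
  by rewrite -/a -/b; set s := \sum_(l < K) _; field.
rewrite mulrAC mulr_sumr; apply: eq_bigr => l _; rewrite extuv_sum mulr_sumr.
apply: eq_bigr => I _; cbv beta.
rewrite (extuvZ K Q Q' _ (fun u v => Gu (mabs Q) I u * Gv (mabs Q') I v)).
rewrite (extuvM K Q Q' (Gu (mabs Q) I) (Gv (mabs Q') I)).
rewrite (@extu_conj _ _ K Q (Gv (mabs Q) I)); last first.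
  move=> tau; rewrite -Gu_conj; congr (Gu _ _ _); apply/funext => i.
  by rewrite conj_tor.
rewrite /Zf !rmorphM !rmorph_prod big_split /=.
under [\prod_i Num.conj (a i ^+ _)]eq_bigr => i _ do rewrite rmorphXn /= conj_a.
under [\prod_i Num.conj _]eq_bigr => i _ do rewrite rmorph_nat.
by ring.
Qed.

Lemma wick_pos (s : seq (mono R n)) :
  0 <= \sum_(m1 <- s) \sum_(m2 <- s)
     Num.conj m1.1.1 * m2.1.1 * wick_prod hbar m1.2 m1.1.2 m2.1.2 m2.2 r.
Proof.
pose z0 : mono R n := (0, fun=> 0%N, fun=> 0%N).
(* A single K above all degrees gives one common index set for the Gram vectors. *)
have [K sK] : exists K, forall i, (mabs (nth z0 s i).2 < K)%N.
  elim: s => [|m s [K IH]].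
    by exists 1%N => i; rewrite nth_nil /mabs big1.
  exists (maxn K (mabs m.2).+1) => -[|i] /=; rewrite leq_max ?leqnn ?orbT //.
  by rewrite IH.
pose W l (I : {ffun 'I_l -> 'I_n.+1}) := \sum_(m <- s) m.1.1 * Zf K m.1.2 m.2 I.
rewrite (_ : \sum_(m1 <- s) _ = \sum_(l < K) \sum_(I : {ffun 'I_l -> 'I_n.+1})
    (poch x l * l`!%:R)^-1 * (Num.conj (W l I) * W l I)).
  apply: sumr_ge0 => l _; apply: sumr_ge0 => I _.
  rewrite [Num.conj _ * _]mulrC mulr_ge0 ?mul_conjC_ge0 //.
  by rewrite invr_ge0 mulr_ge0 ?ler0n // ltW // poch_gt0.
under [RHS]eq_bigr => l _ do under eq_bigr => I _ do
  rewrite /W rmorph_sum big_distrlr /= mulr_sumr.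
under [RHS]eq_bigr => l _ do rewrite exchange_big /=.
rewrite [RHS]exchange_big /= (big_nth z0) [RHS](big_nth z0); apply: eq_bigr => i _.
under [RHS]eq_bigr => l _ do under eq_bigr => I _ do rewrite mulr_sumr.
under [RHS]eq_bigr => l _ do rewrite exchange_big /=.
rewrite [RHS]exchange_big /= (big_nth z0) [RHS](big_nth z0); apply: eq_bigr => j _.
rewrite (@wick_gram K) ?sK // mulr_sumr; apply: eq_bigr => l _.
rewrite mulr_sumr; apply: eq_bigr => I _.
by rewrite [in RHS](rmorphM Num.conj (nth z0 s i).1.1) /=; ring.
Qed.

End WickGram.

(** * Passage to the completed algebra *)

Section FunctionAlgebra.
Variable R : realType.
Local Notation C := (R[i]).
Variable n : nat.
Local Notation vec := 'rV[C]_n.+1.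
Local Notation F := (Fn R n).
Implicit Types (z w : vec * vec) (f g : vec * vec -> C) (a b : F) (r : Zpt R n).

Lemma holo_global f : (forall z, cdiff f z) -> holo_on_Zhat f.
Proof. by move=> H z _; exists 1; split; [exact: ltr01|exists f]. Qed.

Lemma holo_op (op : C -> C -> C) f g :
  (forall u v z, cdiff u z -> cdiff v z -> cdiff (fun w => op (u w) (v w)) z) ->
  holo_on_Zhat f -> holo_on_Zhat g -> holo_on_Zhat (fun w => op (f w) (g w)).
Proof.
move=> H hf hg z zz; have [d [/gt0c [d' d'0 ->] [u [ud fu]]]] := hf _ zz.
have [e [/gt0c [e' e'0 ->] [v [vd gv]]]] := hg _ zz.
exists (Num.min d' e')%:C; rewrite ltcR lt_min d'0 e'0; split=> //.
exists (fun w => op (u w) (v w)); split=> [w|w ww]; rewrite nrmE ltcR lt_min => /andP [h1 h2].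
  by apply: H; [apply: ud|apply: vd]; rewrite nrmE ltcR.
by rewrite fu ?gv // nrmE ltcR.
Qed.

Lemma Ohat_lin (l : C) f g : Ohat f -> Ohat g -> Ohat (fun w => l * f w + g w).
Proof.
move=> [hf cf] [hg cg]; split; last by move=> m z m0 zz; rewrite cf ?cg.
apply: (holo_op (op := fun x y => l * x + y)) => // u v z du dv.
by apply: cdiffD => //; apply: cdiffM => //; exact: cdiff_cst.
Qed.

Lemma Ohat_mul f g : Ohat f -> Ohat g -> Ohat (fun w => f w * g w).
Proof.
move=> [hf cf] [hg cg]; split; last by move=> m z m0 zz; rewrite cf ?cg.
by apply: (holo_op (op := fun x y => x * y)) => // u v z; exact: cdiffM.
Qed.

Lemma Ohat_cst (l : C) : Ohat (fun _ : vec * vec => l).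
Proof. by split=> //; apply: holo_global => z; exact: cdiff_cst. Qed.

Lemma Ohat_fhat (P Q : 'I_n.+1 -> nat) : mabs P = mabs Q -> Ohat (fhat P Q : vec * vec -> C).
Proof.
move=> PQ; split; last first.
  move=> l [p q] l0 zz; rewrite (fhat_scale P Q (p, q)) PQ -exprMn mulfV //.
  by rewrite expr1n mul1r.
apply: holo_global => z; apply: cdiff_prod => i.
by apply: cdiffM; apply: cdiffX; [exact: cdiff_coord1|exact: cdiff_coord2].
Qed.

Lemma in_Zhat_swapc z : in_Zhat z -> in_Zhat (swapc z).
Proof.
rewrite /in_Zhat /swapc /= => H; apply: (can_inj conjCK).
rewrite rmorphD rmorphN rmorphM rmorph_sum rmorphN1 -[RHS]H /= !mxE !conjCK mulrC.
by congr (_ + _); apply: eq_bigr => i _; rewrite !mxE rmorphM /= !conjCK mulrC.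
Qed.

Lemma Ohat_swapc f : Ohat f -> Ohat (fun w => Num.conj (f (swapc w))).
Proof.
move=> [hf cf]; split=> [z zz|l z l0 zz]; last first.
  rewrite -(cf (Num.conj l^-1) (swapc z)) ?in_Zhat_swapc ?conjC_eq0 ?invr_eq0 //.
  rewrite /swapc /conjv /= !map_mxZ /= -fmorphV invrK; first by [].
  exact: in_Zhat_swapc.
have [d [/gt0c [d' d'0 ->] [g [gd fg]]]] := hf _ (in_Zhat_swapc zz).
have E w : nmz (swapc w - swapc z) = nmz (w - z).
  rewrite -(nmz_swapc (w - z)) swapcD; congr nmz; congr (_ + _).
  by rewrite /swapc /conjv /= !raddfN.
exists d'%:C; rewrite ltcR; split=> //.
exists (fun w => Num.conj (g (swapc w))); split=> [w|w ww]; rewrite nrmE ltcR subpE => h.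
  by apply: cdiff_swapc; apply: gd; rewrite nrmE ltcR subpE E.
by rewrite fg ?nrmE ?ltcR ?subpE ?E //; exact: in_Zhat_swapc.
Qed.

Definition star_inv a : F := fun r => Num.conj (a r).

Definition diag_pt r : vec * vec := (val r, conjv (val r)).

Lemma swapc_diag r : swapc (diag_pt r) = diag_pt r.
Proof. by rewrite /swapc /diag_pt /=; congr (_, _); apply/rowP => i; rewrite !mxE conjCK. Qed.

Lemma in_Zhat_diag r : in_Zhat (diag_pt r).
Proof.
have /eqP := valP r; rewrite /in_Zhat /= mxE normCK => H; rewrite -[RHS]H.
by congr (_ + _); apply: eq_bigr => i _; rewrite mxE normCK.
Qed.

Lemma rep_star_inv a f : represents a f -> represents (star_inv a) (fun w => Num.conj (f (swapc w))).
Proof.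
move=> [hf af]; split; first exact: Ohat_swapc.
by move=> r; rewrite /star_inv af -/(diag_pt r) swapc_diag.
Qed.

Lemma rep_lin l a b f g : represents a f -> represents b g ->
  represents (fun r => l * a r + b r) (fun w => l * f w + g w).
Proof. by move=> [hf af] [hg bg]; split=> [|r]; [exact: Ohat_lin|rewrite af bg]. Qed.

Lemma rep_mul a b f g : represents a f -> represents b g ->
  represents (fun r => a r * b r) (fun w => f w * g w).
Proof. by move=> [hf af] [hg bg]; split=> [|r]; [exact: Ohat_mul|rewrite af bg]. Qed.

Lemma rep_cst l : represents (fun _ : Zpt R n => l) (fun=> l).
Proof. by split=> //; exact: Ohat_cst. Qed.

Lemma rep_fPQ P Q : mabs P = mabs Q -> represents (fPQ P Q : F) (fhat P Q).
Proof.
move=> PQ; split=> [|r]; first exact: Ohat_fhat.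
by rewrite /fPQ /fhat; apply: eq_bigr => i _; rewrite /= mxE.
Qed.

Lemma inA_star_inv a : inA a -> inA (star_inv a).
Proof. by move=> [f] /rep_star_inv ?; eexists; eassumption. Qed.

#[local] Hint Extern 0 (inA (star_inv _)) => exact: inA_star_inv : core.

Lemma star_invK a : star_inv (star_inv a) = a.
Proof. by apply/funext => r; rewrite /star_inv conjCK. Qed.

Lemma inA_lin l a b : inA a -> inA b -> inA (fun r => l * a r + b r).
Proof. by move=> [f hf] [g hg]; exists (fun w => l * f w + g w); exact: rep_lin. Qed.

Lemma inA_fPQ P Q : mabs P = mabs Q -> inA (fPQ P Q : F).
Proof. by move=> PQ; exists (fhat P Q); exact: rep_fPQ. Qed.

Lemma inA_cst l : inA (fun _ : Zpt R n => l).
Proof. by exists (fun=> l); exact: rep_cst. Qed.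

Lemma inA_sum (J : Type) (s : seq J) (pr : pred J) (c : J -> C) (G : J -> F) :
  (forall j, pr j -> inA (G j)) -> inA (fun r => \sum_(j <- s | pr j) c j * G j r).
Proof.
move=> H; elim: s => [|j s IH].
  have -> : (fun r => \sum_(j <- [::] | pr j) c j * G j r) = (fun=> 0).
    by apply/funext => r; rewrite big_nil.
  exact: inA_cst.
case pj : (pr j).
  have -> : (fun r => \sum_(j <- j :: s | pr j) c j * G j r) =
     fun r => c j * G j r + \sum_(j <- s | pr j) c j * G j r.
    by apply/funext => r; rewrite big_cons pj.
  by apply: inA_lin => //; exact: H.
have -> // : (fun r => \sum_(j <- j :: s | pr j) c j * G j r) =
   fun r => \sum_(j <- s | pr j) c j * G j r.
by apply/funext => r; rewrite big_cons pj.
Qed.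

(** The seminorms over polydiscs intersected with the quadric; by [box_compact] and [compact_box]
    they are cofinal among those over compact sets. *)
Definition hbnd (rho : R) f (M : R) := forall w, in_Zhat w -> box rho w -> nm (f w) <= M.

Lemma box_swapc rho z : box rho z -> box rho (swapc z).
Proof. by move=> [h1 h2]; split=> i; rewrite /= mxE nm_conj. Qed.

Lemma hbnd_swapc rho f M : hbnd rho f M -> hbnd rho (fun w => Num.conj (f (swapc w))) M.
Proof. by move=> H w ww bw; rewrite nm_conj; apply: H; [exact: in_Zhat_swapc|exact: box_swapc]. Qed.

Lemma box_le rho rho' z : rho <= rho' -> box rho z -> box rho' z.
Proof. by move=> h [h1 h2]; split=> i; apply: le_trans h. Qed.

Lemma hbnd_le rho rho' f M : rho <= rho' -> hbnd rho' f M -> hbnd rho f M.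
Proof. by move=> h H w ww bw; apply: H => //; exact: box_le bw. Qed.

Lemma rep_hbnd a f rho : represents a f -> exists2 M : R, 0 <= M & hbnd rho f M.
Proof. by move=> [[hf _] _]; exact: holo_box_bounded. Qed.

Lemma box_compact rho : compactZhat (fun z : vec * vec => in_Zhat z /\ box rho z).
Proof.
split; [by move=> z []|split].
  exists (rho *+ n.+1 *+ 2)%:C => z [_ [h1 h2]].
  rewrite nrmE lecR /nmz mulr2n.
  have -> : rho *+ n.+1 = \sum_(i < n.+1) rho by rewrite sumr_const card_ord.
  by apply: lerD; apply: ler_sum => i _.
move=> z H.
have H' (e : R) : 0 < e -> exists w, (in_Zhat w /\ box rho w) /\ nmz (w - z) < e.
  by move=> e0; have [|w [Kw]] := H e%:C; rewrite ?ltcR // nrmE ltcR subpE; exists w.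
split.
  apply: contrapT => /notin_Zhat_near [d d0 Hd]; have [w [[ww _] /Hd]] := H' d d0.
  exact.
split=> i; apply/ler_addgt0Pl => e /H' [w [[_ [h1 h2]] we]].
  rewrite -(subrK (w.1 0 i) (z.1 0 i)); apply: le_trans (nmD _ _) _; apply: lerD (h1 i).
  rewrite nm_sym; apply: ltW; apply: le_lt_trans we.
  by have := nmz_le1 (w - z) i; rewrite /= !mxE.
rewrite -(subrK (w.2 0 i) (z.2 0 i)); apply: le_trans (nmD _ _) _; apply: lerD (h2 i).
rewrite nm_sym; apply: ltW; apply: le_lt_trans we.
by have := nmz_le2 (w - z) i; rewrite /= !mxE.
Qed.

Lemma compact_box (K : vec * vec -> Prop) : compactZhat K ->
  exists rho, forall z, K z -> in_Zhat z /\ box rho z.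
Proof.
move=> [KZ [[M KM] _]]; exists (complex.Re M) => z Kz; split; first exact: KZ.
have : nmz z <= complex.Re M by have := KM z Kz; rewrite nrmE lecE => /andP [].
by move=> h; split=> i; apply: le_trans h; [exact: nmz_le1|exact: nmz_le2].
Qed.

Definition contbox (L : F -> C) := exists rho, exists2 k : R, 0 <= k &
  forall a f M, represents a f -> 0 <= M -> hbnd rho f M -> nm (L a) <= k * M.

Lemma contbox_contA L : contbox L -> contA L.
Proof.
move=> [rho [k k0 H]]; exists (fun z => in_Zhat z /\ box rho z); split; first exact: box_compact.
exists k%:C; rewrite lecR; split=> // a f M af /ge0c [M' M'0 ->] bM.
rewrite -rmorphM nm_lec; apply: (H a f) => // w ww bw.
by rewrite -nm_lec; exact: bM.
Qed.

Lemma contbox_eval r : contbox (fun a => a r).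
Proof.
exists (nmz (diag_pt r)), 1 => // a f M [_ af] M0 H; rewrite af mul1r.
apply: H; first exact: in_Zhat_diag.
by split=> i; [exact: nmz_le1|exact: nmz_le2].
Qed.

Lemma contbox_conj L : contbox L -> contbox (fun a => Num.conj (L (star_inv a))).
Proof.
move=> [rho [k k0 H]]; exists rho, k => // a f M af M0 hM; rewrite nm_conj.
by apply: H (rep_star_inv af) _ _ => //; exact: hbnd_swapc.
Qed.

Definition linA (L : F -> C) := forall l a b, inA a -> inA b ->
  L (fun r => l * a r + b r) = l * L a + L b.

Lemma linA0 L : linA L -> L (fun=> 0) = 0.
Proof.
move=> H; have := H (-1) (fun=> 0) (fun=> 0) (inA_cst 0) (inA_cst 0).
have -> : (fun _ : Zpt R n => -1 * 0 + 0 : C) = (fun=> 0) by apply/funext => r; rewrite mulr0 addr0.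
by rewrite mulN1r addNr.
Qed.

Lemma linA_sum L (J : Type) (s : seq J) (pr : pred J) (c : J -> C) (G : J -> F) : linA L ->
  (forall j, pr j -> inA (G j)) ->
  L (fun r => \sum_(j <- s | pr j) c j * G j r) = \sum_(j <- s | pr j) c j * L (G j).
Proof.
move=> LL H; elim: s => [|j s IH].
  rewrite big_nil -[RHS](linA0 LL); congr L; apply/funext => r; exact: big_nil.
rewrite big_cons -IH; case: ifP => pj.
  rewrite -LL; [|exact: H|exact: inA_sum].
  by congr L; apply/funext => r; rewrite big_cons pj.
by congr L; apply/funext => r; rewrite big_cons pj.
Qed.

Lemma linA_conj L : linA L -> linA (fun a => Num.conj (L (star_inv a))).
Proof.
move=> LL l a b aA bA.
have -> : star_inv (fun r => l * a r + b r) = fun r => Num.conj l * star_inv a r + star_inv b r.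
  have cl (x y z : C) : Num.conj (x * y + z) = Num.conj x * Num.conj y + Num.conj z by rewrite rmorphD rmorphM.
  by apply/funext => r; exact: cl.
by rewrite LL // rmorphD rmorphM /= conjCK.
Qed.

Definition bmono := {m : mono R n | balanced m}.

Definition polyfun (s : seq bmono) : F :=
  fun r => \sum_(m <- s) (val m).1.1 * fPQ (val m).1.2 (val m).2 r.

Lemma rep_poly (s : seq bmono) : represents (polyfun s)
    (polyhat [seq val m | m <- s]).
Proof.
split=> [|r].
  elim: s => [|m s IH].
    by have -> : polyhat [seq val m | m <- [::] : seq bmono] = (fun=> 0); [
      apply/funext => w; rewrite /polyhat big_nil|exact: Ohat_cst].
  have -> : polyhat [seq val m | m <- m :: s] = (fun w => (val m).1.1 * fhat (val m).1.2 (val m).2 w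
     + polyhat [seq val m | m <- s] w) by apply/funext => w; rewrite /polyhat big_cons.
  by apply: Ohat_lin => //; apply: Ohat_fhat; apply/eqP; exact: (valP m).
rewrite /polyfun /polyhat big_map; apply: eq_bigr => m _.
by have [_ ->] := rep_fPQ (eqP (valP m)).
Qed.

(** The difference is written as -1 * p + f because [rep_lin] and [linA] speak of combinations of
    the form l * a + b. *)
Lemma poly_dense' f rho (e : R) : Ohat f -> 0 < e -> exists s : seq bmono,
  hbnd rho (fun w => -1 * polyhat [seq val m | m <- s] w + f w) e.
Proof.
move=> hf e0; have [s sb H] := poly_dense hf rho e0.
exists (pmap (insub : mono R n -> option bmono) s) => w ww bw; rewrite mulN1r addrC.
rewrite (pmap_filter (insubK _)) (eq_filter (isSome_insub _)) (all_filterP sb).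
exact: H.
Qed.

(** With p a polynomial close to a, the difference L1 a - L2 a equals (L1 - L2)(a - p), which is
    arbitrarily small. *)
Lemma ext_poly L1 L2 : contbox L1 -> contbox L2 -> linA L1 -> linA L2 ->
  (forall P Q, mabs P = mabs Q -> L1 (fPQ P Q) = L2 (fPQ P Q)) ->
  forall a, inA a -> L1 a = L2 a.
Proof.
move=> [rho1 [k1 k10 H1]] [rho2 [k2 k20 H2]] l1 l2 H a [f af].
apply/eqP; rewrite -subr_eq0; apply/eqP; apply: nm_le_eps0 => e e0.
have k0 : 0 < k1 + k2 + 1 by rewrite ltr_wpDl // addr_ge0.
have e'0 : 0 < e / (k1 + k2 + 1) by rewrite divr_gt0.
have [s hs] := poly_dense' (Num.max rho1 rho2) af.1 e'0.
set p := polyfun s.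
have rp := rep_poly s; rewrite -/p in rp.
have pA : inA p by eexists; exact: rp.
have aA : inA a by exists f.
have ra := rep_lin (-1) rp af.
have E : L1 p = L2 p.
  rewrite /p /polyfun !linA_sum // => [|m _|m _]; last 2 first.
  - by apply: inA_fPQ; apply/eqP; exact: (valP m).
  - by apply: inA_fPQ; apply/eqP; exact: (valP m).
  by apply: eq_bigr => m _; rewrite H //; apply/eqP; exact: (valP m).
have -> : L1 a - L2 a = L1 (fun r => -1 * p r + a r) - L2 (fun r => -1 * p r + a r).
  by rewrite l1 // l2 // E; ring.
apply: le_trans (nmB _ _) _.
have m1 : rho1 <= Num.max rho1 rho2 by rewrite le_max lexx.
have m2 : rho2 <= Num.max rho1 rho2 by rewrite le_max lexx orbT.
have h1 := H1 _ _ _ ra (ltW e'0) (hbnd_le m1 hs).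
have h2 := H2 _ _ _ ra (ltW e'0) (hbnd_le m2 hs).
apply: le_trans (lerD h1 h2) _; rewrite -mulrDl mulrCA ger_pMr // ler_pdivrMr // mul1r.
by rewrite lerDl.
Qed.

End FunctionAlgebra.

(** * Associativity, involution and positivity on the completed algebra *)

Section StarProduct.
Variable R : realType.
Local Notation C := (R[i]).
Variable n : nat.
Local Notation F := (Fn R n).
Implicit Types (a b c : F) (r : Zpt R n).

Definition linop (G : F -> F) := forall (l : C) a b, inA a -> inA b ->
  G (fun r => l * a r + b r) = (fun r => l * G a r + G b r).
Definition contop (G : F -> F) := forall rho, exists rho', exists2 k : R, 0 <= k &
  forall a f h M, represents a f -> represents (G a) h -> 0 <= M -> hbnd rho' f M ->
    hbnd rho h (k * M).

Lemma linA_eval r (G : F -> F) : linop G -> linA (fun a => G a r).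
Proof. by move=> GL l a b aA bA; rewrite GL. Qed.

Lemma contbox_comp L (G : F -> F) : contbox L -> contop G -> (forall a, inA a -> inA (G a)) ->
  contbox (fun a => L (G a)).
Proof.
move=> [rho [k k0 H]] GC GA; have [rho' [k' k'0 H']] := GC rho.
exists rho', (k * k'); first exact: mulr_ge0.
move=> a f M af M0 hf; have [|h hG] := GA a; first by exists f.
rewrite -mulrA; apply: (H _ _ _ hG); first exact: mulr_ge0.
exact: H' af hG M0 hf.
Qed.

#[local] Hint Extern 0 (inA (star_inv _)) => exact: inA_star_inv : core.

(** What the GNS construction takes from the product, so that the pointwise and the Wick product are
    treated alike from here on. [gs_cont] has the shape of the matrix coefficients of the
    representation. *)
Record good_star (star : F -> F -> F) : Prop := GoodStar {
  gs_A : forall a b, inA a -> inA b -> inA (star a b);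
  gs_linl : forall c, inA c -> linop (star^~ c);
  gs_linr : forall c, inA c -> linop (star c);
  gs_assoc : forall a b c, inA a -> inA b -> inA c -> star (star a b) c = star a (star b c);
  gs_inv : forall a b, inA a -> inA b -> star_inv (star a b) = star (star_inv b) (star_inv a);
  gs_unit : forall a, inA a -> star (fun=> 1) a = a;
  gs_pos : forall a r, inA a -> 0 <= star (star_inv a) a r;
  gs_cont : forall b c r, inA b -> inA c -> contbox (fun a => star c (star a b) r) }.

Lemma pointwise_good (star : F -> F -> F) :
  (forall a b, inA a -> inA b -> star a b = (fun r => a r * b r)) -> good_star star.
Proof.
move=> H; have A a b : inA a -> inA b -> inA (star a b).
  move=> aA bA; rewrite H //; case: aA bA => f af [g bg].
  by exists (fun w => f w * g w); exact: rep_mul.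
split=> //.
- move=> c cA l a b aA bA; rewrite !H //; last exact: inA_lin.
  by apply/funext => r; rewrite mulrDl mulrA.
- move=> c cA l a b aA bA; rewrite !H //; last exact: inA_lin.
  by apply/funext => r; rewrite mulrDr mulrCA.
- move=> a b c aA bA cA; have abA := A a b aA bA; have bcA := A b c bA cA.
  by rewrite (H (star a b) c) // (H a (star b c)) // (H a b) // (H b c) //; apply/funext => r; rewrite mulrA.
- move=> a b aA bA; rewrite !H //; apply/funext => r.
  by rewrite /star_inv rmorphM mulrC.
- by move=> a aA; rewrite H //; [apply/funext => r; rewrite mul1r|exact: inA_cst].
- by move=> a r aA; rewrite H // /star_inv mulrC mul_conjC_ge0.
move=> b c r bA cA; have [rho [k k0 Hk]] := contbox_eval r.
exists rho, (nm (c r) * nm (b r) * k); first by rewrite !mulr_ge0 ?nm_ge0.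
move=> a f M af M0 hf; have aA : inA a by exists f.
have abA := A a b aA bA; rewrite (H c (star a b)) // (H a b) // !nmM -!mulrA ler_wpM2l ?nm_ge0 // mulrC ler_wpM2l ?nm_ge0 //.
exact: Hk af M0 hf.
Qed.

(** In the partial order of [R[i]], nonnegativity means Im v = 0 and Re v >= 0; both conditions are
    closed. *)
Lemma ge0_closed (v : C) : (forall e : R, 0 < e -> exists2 w : C, 0 <= w & nm (v - w) <= e) -> 0 <= v.
Proof.
move=> H; have HR (e : R) : 0 < e -> `|complex.Im v| <= e /\ - e <= complex.Re v.
  move=> /H [w]; rewrite lecE => /andP [/eqP /= w0 w1] h.
  have h1 := le_trans (nm_Im (v - w)) h; have h2 := le_trans (nm_Re (v - w)) h.
  case: v w w0 w1 h1 h2 {h H} => [v1 v2] [w1 w2] /= -> w0; rewrite subr0 => -> h2; split=> //.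
  by move: h2; rewrite ler_norml => /andP [h2 _]; apply: le_trans h2 _; rewrite lerBlDr lerDl.
rewrite lecE; apply/andP; split; rewrite /=.
  rewrite -normr_eq0 eq_le normr_ge0 andbT; apply/ler_addgt0Pl => e e0; rewrite addr0.
  by have [] := HR e e0.
by apply/ler_addgt0Pl => e e0; rewrite -lerBlDl sub0r; have [] := HR e e0.
Qed.

Section Wick.
Variables (hbar : R) (star : F -> F -> F).
Hypothesis hpos : 0 < hbar.
Hypothesis starA : forall a b, inA a -> inA b -> inA (star a b).
Hypothesis star_lin : forall (l : C) a b c, inA a -> inA b -> inA c ->
  star (fun r => l * a r + b r) c = (fun r => l * star a c r + star b c r) /\
  star c (fun r => l * a r + b r) = (fun r => l * star c a r + star c b r).
Hypothesis star_bnd : forall K, compactZhat K -> exists K', compactZhat K' /\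
  exists Cc : C, 0 <= Cc /\
    forall a b fa fb fab Ma Mb,
      represents a fa -> represents b fb -> represents (star a b) fab ->
      0 <= Ma -> 0 <= Mb -> bnd fa K' Ma -> bnd fb K' Mb -> bnd fab K (Cc * Ma * Mb).
Hypothesis star_mono : forall P Q P' Q' : 'I_n.+1 -> nat, mabs P = mabs Q -> mabs P' = mabs Q' ->
  star (fPQ P Q) (fPQ P' Q') = wick_prod hbar P Q P' Q'.

Lemma star_box rho : exists rho', exists2 k : R, 0 <= k &
  forall a b f g h Ma Mb, represents a f -> represents b g -> represents (star a b) h ->
    0 <= Ma -> 0 <= Mb -> hbnd rho' f Ma -> hbnd rho' g Mb -> hbnd rho h (k * Ma * Mb).
Proof.
have [K' [KK' [Cc [/ge0c [k k0 ->] H]]]] := star_bnd (box_compact _ rho).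
have [rho' Hrho] := compact_box KK'.
exists rho', k => // a b f g h Ma Mb af bg abh Ma0 Mb0 hf hg w ww bw.
rewrite -nm_lec !rmorphM; apply: (H _ _ _ _ _ _ _ af bg abh); rewrite ?lecR //.
- by move=> z /Hrho [zz bz]; rewrite nm_lec; exact: hf.
by move=> z /Hrho [zz bz]; rewrite nm_lec; exact: hg.
Qed.

Lemma contop_l b : inA b -> contop (star^~ b).
Proof.
move=> [g bg] rho; have [rho' [k k0 H]] := star_box rho.
have [M M0 hM] := rep_hbnd rho' bg.
exists rho', (k * M); first exact: mulr_ge0.
move=> a f h N af abh N0 hN; rewrite mulrAC; exact: H af bg abh N0 M0 hN hM.
Qed.

Lemma contop_r b : inA b -> contop (star b).
Proof.
move=> [g bg] rho; have [rho' [k k0 H]] := star_box rho.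
have [M M0 hM] := rep_hbnd rho' bg.
exists rho', (k * M); first exact: mulr_ge0.
move=> a f h N af abh N0 hN; exact: H bg af abh M0 N0 hM hN.
Qed.

Lemma linop_l b : inA b -> linop (star^~ b).
Proof. by move=> bA l a c aA cA; have [-> _] := star_lin l aA cA bA. Qed.

Lemma linop_r b : inA b -> linop (star b).
Proof. by move=> bA l a c aA cA; have [_ ->] := star_lin l aA cA bA. Qed.

Lemma A_l b : inA b -> forall a, inA a -> inA (star a b). Proof. by move=> *; exact: starA. Qed.
Lemma A_r b : inA b -> forall a, inA a -> inA (star b a). Proof. by move=> *; exact: starA. Qed.

Lemma ext_op (G1 G2 : F -> F) : contop G1 -> contop G2 -> linop G1 -> linop G2 ->
  (forall a, inA a -> inA (G1 a)) -> (forall a, inA a -> inA (G2 a)) ->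
  (forall P Q, mabs P = mabs Q -> G1 (fPQ P Q) = G2 (fPQ P Q)) ->
  forall a, inA a -> G1 a = G2 a.
Proof.
move=> c1 c2 l1 l2 A1 A2 H a aA; apply/funext => r.
apply: (ext_poly (L1 := fun a => G1 a r) (L2 := fun a => G2 a r)) => //.
- exact: (contbox_comp (contbox_eval r)).
- exact: (contbox_comp (contbox_eval r)).
- exact: linA_eval.
- exact: linA_eval.
by move=> P Q PQ; rewrite H.
Qed.

Lemma contop_comp (G1 G2 : F -> F) : contop G1 -> contop G2 -> (forall a, inA a -> inA (G2 a)) ->
  contop (fun a => G1 (G2 a)).
Proof.
move=> c1 c2 A2 rho; have [rho1 [k1 k10 H1]] := c1 rho.
have [rho2 [k2 k20 H2]] := c2 rho1; exists rho2, (k1 * k2); first exact: mulr_ge0.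
move=> a f h M af gh M0 hM; have [|h2 a2] := A2 a; first by exists f.
rewrite -mulrA; apply: (H1 _ _ _ _ a2 gh); first exact: mulr_ge0.
exact: H2 af a2 M0 hM.
Qed.

Lemma linop_comp (G1 G2 : F -> F) : linop G1 -> linop G2 -> (forall a, inA a -> inA (G2 a)) ->
  linop (fun a => G1 (G2 a)).
Proof. by move=> l1 l2 A2 l a b aA bA; rewrite l2 // l1 //; exact: A2. Qed.

Lemma balancedB (P1 Q1 P2 Q2 T : 'I_n.+1 -> nat) : mabs P1 = mabs Q1 -> mabs P2 = mabs Q2 ->
  (forall i, T i <= minn (P1 i) (Q2 i))%N ->
  mabs (fun i => P1 i + P2 i - T i)%N = mabs (fun i => Q1 i + Q2 i - T i)%N.
Proof.
move=> e1 e2 H.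
have T1 i : (T i <= P1 i)%N := leq_trans (H i) (geq_minl _ _).
have T2 i : (T i <= Q2 i)%N := leq_trans (H i) (geq_minr _ _).
rewrite (@mabsB _ (fun i => P1 i + P2 i)%N T) ?(@mabsB _ (fun i => Q1 i + Q2 i)%N T) ?mabsD ?e1 ?e2 // => i.
  exact: leq_trans (T2 i) (leq_addl _ _).
exact: leq_trans (T1 i) (leq_addr _ _).
Qed.

Lemma assoc_mono P1 Q1 P2 Q2 P3 Q3 : mabs P1 = mabs Q1 -> mabs P2 = mabs Q2 -> mabs P3 = mabs Q3 ->
  star (star (fPQ P1 Q1) (fPQ P2 Q2)) (fPQ P3 Q3) = star (fPQ P1 Q1) (star (fPQ P2 Q2) (fPQ P3 Q3)).
Proof.
move=> e1 e2 e3; apply/funext => r; rewrite !star_mono //.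
have A1 : inA (fPQ P1 Q1 : F) by exact: inA_fPQ.
have A3 : inA (fPQ P3 Q3 : F) by exact: inA_fPQ.
rewrite (linA_sum (L := fun a => star a (fPQ P3 Q3) r)); last 2 first.
- exact: (linA_eval _ (linop_l A3)).
- by move=> T /forallP H; apply: inA_fPQ; apply: balancedB.
rewrite (linA_sum (L := fun a => star (fPQ P1 Q1) a r)); last 2 first.
- exact: (linA_eval _ (linop_r A1)).
- by move=> T /forallP H; apply: inA_fPQ; apply: balancedB.
transitivity (\sum_(T : {ffun 'I_n.+1 -> 'I_(mabs P1).+1} | [forall i, (val (T i) <= minn (P1 i) (Q2 i))%N])
    wick_coef hbar P1 Q2 (fun i => val (T i)) *
    wick_prod hbar (fun i => P1 i + P2 i - T i)%N (fun i => Q1 i + Q2 i - T i)%N P3 Q3 r).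
  by apply: eq_bigr => T /forallP H; rewrite star_mono //; exact: balancedB.
rewrite wick_assoc //; apply: eq_bigr => T /forallP H; rewrite star_mono //; exact: balancedB.
Qed.

(** Extended from monomials one argument at a time, so that in every step two continuous linear maps
    of a single variable are compared. *)
Lemma star_assoc a b c : inA a -> inA b -> inA c -> star (star a b) c = star a (star b c).
Proof.
have H1 P2 Q2 P3 Q3 a' : mabs P2 = mabs Q2 -> mabs P3 = mabs Q3 -> inA a' ->
    star (star a' (fPQ P2 Q2)) (fPQ P3 Q3) = star a' (star (fPQ P2 Q2) (fPQ P3 Q3)).
  move=> e2 e3; have A2 : inA (fPQ P2 Q2 : F) by exact: inA_fPQ.
  have A3 : inA (fPQ P3 Q3 : F) by exact: inA_fPQ.
  have A23 := starA A2 A3.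
  apply: (ext_op (G1 := fun a => star (star a _) _) (G2 := fun a => star a _)).
  - exact: (contop_comp (contop_l A3) (contop_l A2) (A_l A2)).
  - exact: contop_l.
  - exact: (linop_comp (linop_l A3) (linop_l A2) (A_l A2)).
  - exact: linop_l.
  - by move=> x xA; apply: A_l => //; exact: A_l.
  - exact: A_l.
  by move=> P Q PQ; exact: assoc_mono.
have H2 P3 Q3 a' b' : mabs P3 = mabs Q3 -> inA a' -> inA b' ->
    star (star a' b') (fPQ P3 Q3) = star a' (star b' (fPQ P3 Q3)).
  move=> e3 a'A; have A3 : inA (fPQ P3 Q3 : F) by exact: inA_fPQ.
  apply: (ext_op (G1 := fun b => star (star _ b) _) (G2 := fun b => star _ (star b _))).
  - exact: (contop_comp (contop_l A3) (contop_r a'A) (A_r a'A)).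
  - exact: (contop_comp (contop_r a'A) (contop_l A3) (A_l A3)).
  - exact: (linop_comp (linop_l A3) (linop_r a'A) (A_r a'A)).
  - exact: (linop_comp (linop_r a'A) (linop_l A3) (A_l A3)).
  - by move=> x xA; apply: A_l => //; exact: A_r.
  - by move=> x xA; apply: A_r => //; exact: A_l.
  by move=> P Q PQ; exact: H1.
move=> aA bA; have abA := starA aA bA.
apply: (ext_op (G1 := fun c => star _ c) (G2 := fun c => star _ (star _ c))).
- exact: contop_r.
- exact: (contop_comp (contop_r aA) (contop_r bA) (A_r bA)).
- exact: linop_r.
- exact: (linop_comp (linop_r aA) (linop_r bA) (A_r bA)).
- exact: A_r.
- by move=> x xA; apply: A_r => //; exact: A_r.
by move=> P Q PQ; exact: H2.
Qed.

Lemma star_inv_fPQ (P Q : 'I_n.+1 -> nat) : star_inv (fPQ P Q : F) = fPQ Q P.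
Proof. by apply/funext => r; exact: fPQ_conj. Qed.

(** The same extension, one argument at a time. To remain among linear functionals, the left side is
    compared with the conjugate of the right side evaluated at the adjoint, where the two
    conjugations compensate. *)
Lemma star_inv_star a b : inA a -> inA b -> star_inv (star a b) = star (star_inv b) (star_inv a).
Proof.
move=> aA bA; apply/funext => r.
have ext2 (G1 G2 : F -> F) : contop G1 -> contop G2 -> linop G1 -> linop G2 ->
    (forall a, inA a -> inA (G1 a)) -> (forall a, inA a -> inA (G2 a)) ->
    (forall P Q, mabs P = mabs Q -> G1 (fPQ P Q) r = Num.conj (G2 (fPQ Q P) r)) ->
    forall x, inA x -> G1 x r = Num.conj (G2 (star_inv x) r).
  move=> c1 c2 l1 l2 A1 A2 H x xA.
  apply: (ext_poly (L1 := fun a => G1 a r) (L2 := fun a => Num.conj (G2 (star_inv a) r))) => //.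
  - exact: (contbox_comp (contbox_eval r)).
  - exact: (contbox_conj (contbox_comp (contbox_eval r) c2 A2)).
  - exact: linA_eval.
  - exact: (linA_conj (linA_eval r l2)).
  by move=> P Q PQ; rewrite star_inv_fPQ H.
have aA' := inA_star_inv aA.
rewrite /star_inv -/(star_inv _); apply: (can_inj conjCK); rewrite conjCK.
have H1 P Q x : mabs P = mabs Q -> inA x ->
    star x (fPQ P Q) r = Num.conj (star (fPQ Q P) (star_inv x) r).
  move=> PQ; have A1 : inA (fPQ P Q : F) by exact: inA_fPQ.
  have A2 : inA (fPQ Q P : F) by exact: inA_fPQ.
  apply: (ext2 (star^~ (fPQ P Q)) (star (fPQ Q P))).
  - exact: contop_l.
  - exact: contop_r.
  - exact: linop_l.
  - exact: linop_r.
  - exact: A_l.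
  - exact: A_r.
  by move=> P' Q' e; rewrite !star_mono // wick_conj.
apply: (ext2 (star a) (star^~ (star_inv a))) => //.
- exact: contop_r.
- exact: contop_l.
- exact: linop_r.
- exact: linop_l.
- exact: A_r.
- exact: A_l.
by move=> P Q PQ; exact: H1.
Qed.

Lemma star_unit a : inA a -> star (fun=> 1) a = a.
Proof.
have -> : (fun=> 1) = fPQ (fun=> 0%N) (fun=> 0%N) :> F.
  by apply/funext => r; rewrite /fPQ big1 // => i _; rewrite !expr0 mulr1.
have A1 : inA (fPQ (fun=> 0%N) (fun=> 0%N) : F) by exact: inA_fPQ.
move=> aA; apply/funext => r.
apply: (ext_poly (L1 := fun a => star _ a r) (L2 := fun a => a r)) => //.
- exact: (contbox_comp (contbox_eval r) (contop_r A1) (A_r A1)).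
- exact: contbox_eval.
- exact: linA_eval _ (linop_r A1).
by move=> P Q PQ; rewrite star_mono //; exact: wick_1l.
Qed.

Lemma star_pos_poly (s : seq (bmono R n)) r :
  0 <= star (star_inv (polyfun s)) (polyfun s) r.
Proof.
set p := polyfun s; have mA (m : bmono R n) : inA (fPQ (val m).1.2 (val m).2 : F).
  by apply: inA_fPQ; apply/eqP; exact: (valP m).
have mA' (m : bmono R n) : inA (fPQ (val m).2 (val m).1.2 : F).
  by apply: inA_fPQ; apply/esym/eqP; exact: (valP m).
have pA : inA p by apply: inA_sum => m _; exact: mA.
have -> : star_inv p = fun r => \sum_(m <- s) Num.conj (val m).1.1 * fPQ (val m).2 (val m).1.2 r.
  apply/funext => t; rewrite /star_inv /p /polyfun rmorph_sum; apply: eq_bigr => m _.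
  by rewrite rmorphM /= fPQ_conj.
rewrite (linA_sum (L := fun a => star a p r)); last 2 first.
- exact: linA_eval _ (linop_l pA).
- by move=> m _; exact: mA'.
have := wick_pos hpos r [seq val m | m <- s]; rewrite big_map.
set X := \sum_(m <- s) _; set Y := \sum_(m <- s) _; suff -> : X = Y by [].
apply: eq_bigr => m _; rewrite big_map.
rewrite /p /polyfun (linA_sum (L := fun a => star _ a r)); last 2 first.
- exact: linA_eval _ (linop_r (mA' m)).
- by move=> m' _; exact: mA.
rewrite mulr_sumr; apply: eq_bigr => m' _; rewrite mulrA star_mono //.
  by apply/esym/eqP; exact: (valP m).
by apply/eqP; exact: (valP m').
Qed.

Lemma star_pos a r : inA a -> 0 <= star (star_inv a) a r.
Proof.
move=> [f af]; have aA : inA a by exists f.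
have [rho [k k0 Hk]] : exists rho, exists2 k : R, 0 <= k &
  forall a b f g Ma Mb, represents a f -> represents b g ->
    0 <= Ma -> 0 <= Mb -> hbnd rho f Ma -> hbnd rho g Mb -> nm (star a b r) <= k * Ma * Mb.
  have [rho' [k' k'0 H']] := contbox_eval (R := R) r.
  have [rho [k k0 H]] := star_box rho'; exists rho, (k' * k); first exact: mulr_ge0.
  move=> x y u v Ma Mb xu yv Ma0 Mb0 hu hv.
  have [|| h xyh] := @starA x y; [by exists u|by exists v|].
  rewrite -!mulrA; apply: (H' _ _ _ xyh); first by rewrite !mulr_ge0.
  by rewrite mulrA; exact: H xu yv xyh Ma0 Mb0 hu hv.
have [B B0 HB] := rep_hbnd rho af.
(* With d = a - p, the identity a* a - p* p = d* a + p* d bounds the error by k e' B + k (B + e')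
   e', and e' <= 1 turns this into at most e' k (2 B + 1). *)
apply: ge0_closed => e e0; pose e' := Num.min 1 (e / (k * (2 * B + 1) + 1)).
have d0 : 0 < k * (2 * B + 1) + 1 by rewrite ltr_wpDl // mulr_ge0 // addr_ge0 // mulr_ge0.
have e'0 : 0 < e' by rewrite lt_min ltr01 divr_gt0.
have [s hs] := poly_dense' rho af.1 e'0.
set p := polyfun s.
have rp := rep_poly s; rewrite -/p in rp.
have pA : inA p by eexists; exact: rp.
have rd := rep_lin (-1) rp af; set d : F := fun r => _ in rd.
have dA : inA d by eexists; exact: rd.
exists (star (star_inv p) p r); first exact: star_pos_poly.
have hp : hbnd rho (polyhat [seq val m | m <- s]) (B + e').
  move=> w ww bw; rewrite (_ : polyhat _ w = f w - (-1 * polyhat [seq val m | m <- s] w + f w)); last by ring.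
  by apply: le_trans (nmB _ _) _; apply: lerD; [exact: HB|exact: hs].
have E : star (star_inv a) a r - star (star_inv p) p r =
    star (star_inv d) a r + star (star_inv p) d r.
  have ae : a = fun r => 1 * d r + p r by apply/funext => t; rewrite /d; ring.
  have ai : star_inv a = fun r => 1 * star_inv d r + star_inv p r.
    by apply/funext => t; rewrite /star_inv {1}ae /= rmorphD rmorphM rmorph1.
  have -> : star (star_inv a) a r = 1 * star (star_inv d) a r + star (star_inv p) a r.
    by rewrite {1}ai linop_l.
  have -> : star (star_inv p) a r = 1 * star (star_inv p) d r + star (star_inv p) p r.
    by rewrite {1}ae linop_r.
  by ring.
rewrite E; apply: le_trans (nmD _ _) _.
have Be0 : 0 <= B + e' by rewrite addr_ge0 // ltW.
have h1 := Hk _ _ _ _ _ _ (rep_star_inv rd) af (ltW e'0) B0 (hbnd_swapc hs) HB.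
have h2 := Hk _ _ _ _ _ _ (rep_star_inv rp) rd Be0 (ltW e'0) (hbnd_swapc hp) hs.
apply: le_trans (lerD h1 h2) _.
have e1 : e' <= 1 by rewrite ge_min lexx.
have e2 : e' * (k * (2 * B + 1) + 1) <= e by rewrite -ler_pdivlMr // ge_min lexx orbT.
apply: le_trans e2; rewrite -subr_ge0.
rewrite [X in 0 <= X](_ : _ = k * e' * (1 - e') + e'); last by ring.
by rewrite addr_ge0 ?mulr_ge0 ?subr_ge0 // ltW.
Qed.

Lemma wick_good : good_star star.
Proof.
split.
- exact: starA.
- exact: linop_l.
- exact: linop_r.
- exact: star_assoc.
- exact: star_inv_star.
- exact: star_unit.
- exact: star_pos.
move=> b c r bA cA; apply: (contbox_comp (G := fun a => star c (star a b)) (contbox_eval r)).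
  exact: (contop_comp (contop_r cA) (contop_l bA) (A_l bA)).
by move=> x xA; apply: (A_r cA); exact: A_l.
Qed.

End Wick.
End StarProduct.

(** * Reproducing kernel spaces *)

Section KernelSpace.
Variable R : realType.
Local Notation C := (R[i]).
Variables (X : Type) (K : X -> X -> C).
Implicit Types (s t : seq (C * X)).

Definition kcomb s : X -> C^o := fun x => \sum_(q <- s) q.1 * K x q.2.

Definition kspan : {pred (X -> C^o)} := fun psi => `[< exists s, psi = kcomb s >].

Lemma kcomb_in s : kcomb s \in kspan.
Proof. by apply/asboolP; exists s. Qed.

Lemma kspan_closed : submod_closed kspan.
Proof.
split=> [|l u v /asboolP [s ->] /asboolP [t ->]].
  by apply/asboolP; exists [::]; apply/funext => x; rewrite /kcomb big_nil.
apply/asboolP; exists ([seq (l * q.1, q.2) | q <- s] ++ t); apply/funext => x.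
rewrite /kcomb big_cat big_map /=; congr (_ + _).
by rewrite -[LHS]/(l * _) mulr_sumr; apply: eq_bigr => q _; rewrite mulrA.
Qed.

HB.instance Definition _ := GRing.isSubmodClosed.Build C (X -> C^o) kspan kspan_closed.

Record kspace := KSpace { kval : X -> C^o; _ : kval \in kspan }.
HB.instance Definition _ := [isSub for kval].
HB.instance Definition _ := [Choice of kspace by <:].
HB.instance Definition _ := [SubChoice_isSubLmodule of kspace by <:].

Implicit Types (phi psi : kspace).

Lemma kspaceP psi : exists s, kval psi = kcomb s.
Proof. exact/asboolP/(valP psi). Qed.

Definition krep psi : seq (C * X) := projT1 (cid (kspaceP psi)).
Lemma krepE psi : kval psi = kcomb (krep psi).
Proof. exact: (projT2 (cid (kspaceP psi))). Qed.

(** Uses a chosen expansion of [phi] in kernel sections; [kipEl] shows that any expansion gives the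
    same value. *)
Definition kip phi psi : C := \sum_(p <- krep phi) Num.conj p.1 * kval psi p.2.

Hypothesis Kherm : forall x y, K y x = Num.conj (K x y).
Hypothesis Kpos : forall s, 0 <= \sum_(p <- s) \sum_(q <- s) Num.conj p.1 * q.1 * K p.2 q.2.

Lemma kipEr phi psi t : kval psi = kcomb t ->
  kip phi psi = \sum_(q <- t) q.1 * Num.conj (kval phi q.2).
Proof.
move=> E; rewrite /kip E krepE /kcomb.
under eq_bigr do rewrite mulr_sumr; rewrite exchange_big; apply: eq_bigr => q _ /=.
rewrite rmorph_sum mulr_sumr; apply: eq_bigr => p _.
by rewrite rmorphM /= -Kherm mulrCA.
Qed.

Lemma kipEl phi psi s : kval phi = kcomb s ->
  kip phi psi = \sum_(p <- s) Num.conj p.1 * kval psi p.2.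
Proof.
move=> E; rewrite (kipEr phi (krepE psi)) E [in RHS]krepE /kcomb.
under [RHS]eq_bigr do rewrite mulr_sumr; rewrite [RHS]exchange_big; apply: eq_bigr => q _ /=.
rewrite rmorph_sum mulr_sumr; apply: eq_bigr => p _.
by rewrite rmorphM /= -Kherm mulrCA.
Qed.

Lemma kvalD l psi1 psi2 x : kval (l *: psi1 + psi2) x = l * kval psi1 x + kval psi2 x.
Proof. by []. Qed.

(** For definiteness, phi(x) = <w, phi> with w the kernel section at x. If c = <w, phi> were nonzero
    while <phi, phi> = 0, the vector w - k conj(c) phi would have square norm <w, w> - 2 k |c|^2,
    and the choice of k makes this -1. *)
Lemma kip_inner : inner_product kip.
Proof.
have lin l phi psi1 psi2 : kip phi (l *: psi1 + psi2) = l * kip phi psi1 + kip phi psi2.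
  rewrite /kip mulr_sumr -big_split; apply: eq_bigr => p _.
  by rewrite kvalD mulrDr mulrCA.
have herm phi psi : kip psi phi = Num.conj (kip phi psi).
  rewrite (kipEr psi (krepE phi)) /kip rmorph_sum; apply: eq_bigr => p _.
  by rewrite rmorphM /= conjCK.
have pos phi : 0 <= kip phi phi.
  rewrite /kip; under eq_bigr do rewrite krepE /kcomb mulr_sumr.
  have := Kpos (krep phi); congr (0 <= _); apply: eq_bigr => p _; apply: eq_bigr => q _.
  by rewrite mulrA.
split; [exact: lin|split; [exact: herm|split; [exact: pos|]]].
move=> phi p0; apply: val_inj; apply/funext => x; rewrite -[LHS]/(kval phi x) -[RHS]/(0 : C).
have [w wE] : exists w, kval w = kcomb [:: (1, x)] by exists (KSpace (kcomb_in [:: (1, x)])).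
have -> : kval phi x = kip w phi by rewrite (kipEl phi wE) big_seq1 conjC1 mul1r.
apply/eqP/negPn/negP => c0; set c := kip w phi in c0.
pose k := (kip w w + 1) / (2 * (c * Num.conj c)).
have cc : c * Num.conj c != 0 by rewrite mulf_neq0 ?conjC_eq0.
have ww : Num.conj (kip w w) = kip w w by rewrite -herm.
have kk : Num.conj k = k.
  by rewrite /k rmorphM fmorphV rmorphD !rmorphM /= conjCK ww rmorph1 rmorph_nat [Num.conj c * c]mulrC.
have linl l u v y : kip (l *: u + v) y = Num.conj l * kip u y + kip v y.
  by rewrite herm lin rmorphD rmorphM /= -!herm.
have := pos ((- k * Num.conj c) *: phi + w).
rewrite lin !linl p0 -/c (herm w phi) -/c mulr0 add0r.
rewrite rmorphM rmorphN /= conjCK kk.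
have -> : - k * Num.conj c * c + (- k * c * Num.conj c + kip w w) = -1.
  transitivity (kip w w - k * (2 * (c * Num.conj c))); first by ring.
  rewrite /k divfK; first by ring.
  by rewrite mulf_neq0 // pnatr_eq0.
by rewrite oppr_ge0 ler10.
Qed.

Definition kadj (T' T : X -> X) := forall x y, K (T' x) y = K x (T y).

(** Precomposition with T is only known to preserve the span of the sections when T has an adjoint
    for the kernel; [psi] itself is the default value. By [kop_comb], precomposition with T' moves
    the section at y to the section at T y. *)
Definition kop (T : X -> X) psi : kspace := insubd psi (kval psi \o T : X -> C^o).

Lemma kop_comb T' T s : kadj T' T -> kcomb s \o T' = kcomb [seq (q.1, T q.2) | q <- s].
Proof.
by move=> H; apply/funext => x; rewrite /kcomb big_map; apply: eq_bigr => q _; rewrite H.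
Qed.

Lemma kopE T' T psi : kadj T' T -> kval (kop T' psi) = kval psi \o T'.
Proof.
move=> H; rewrite -[LHS]/(val _) insubdK // krepE (kop_comb _ H); exact: kcomb_in.
Qed.

Lemma kadj_sym T' T : kadj T' T -> kadj T T'.
Proof. by move=> H x y; rewrite Kherm -H -Kherm. Qed.

Lemma kop_adj T' T phi psi : kadj T' T -> kip phi (kop T' psi) = kip (kop T phi) psi.
Proof.
move=> H; have H' := kadj_sym H.
rewrite (@kipEl (kop T phi) psi [seq (q.1, T' q.2) | q <- krep phi]); last first.
  by rewrite (kopE _ H') -(kop_comb _ H') -krepE.
by rewrite big_map /kip (kopE _ H).
Qed.

Lemma kop_lin T' T : kadj T' T -> lin_map (kop T').
Proof.
move=> H l u v; apply: val_inj; apply/funext => x.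
by rewrite -[LHS]/(kval _ x) -[RHS]/(kval _ x) kvalD !(kopE _ H).
Qed.

End KernelSpace.

(** Splits a quadratic form that couples only equal labels into diagonal blocks; the labels will be
    the points r. *)
Lemma fiber_sum (V : nmodType) (T : eqType) N (t : 'I_N -> T) (G : 'I_N -> 'I_N -> V) :
  \sum_i \sum_(j | t i == t j) G i j =
  \sum_(u <- undup (codom t)) \sum_(i | u == t i) \sum_(j | u == t j) G i j.
Proof.
rewrite [RHS](exchange_big_dep xpredT) //=; apply: eq_bigr => i _.
rewrite [RHS]big_mkcond (bigD1_seq (t i)) ?mem_undup ?codom_f ?undup_uniq //= eqxx.
by rewrite [X in _ + X]big1 ?addr0 // => u /negPf ->.
Qed.

(** * The GNS representation and its faithfulness *)

Section Representation.
Variable R : realType.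
Local Notation C := (R[i]).
Variable n : nat.
Local Notation F := (Fn R n).
Implicit Types (a b c : F) (r : Zpt R n).

Lemma contbox_lin l L1 L2 : contbox L1 -> contbox L2 -> contbox (fun a : F => l * L1 a + L2 a).
Proof.
move=> [rho1 [k1 k10 H1]] [rho2 [k2 k20 H2]].
exists (Num.max rho1 rho2), (nm l * k1 + k2); first by rewrite addr_ge0 ?mulr_ge0 ?nm_ge0.
move=> a f M af M0 hM.
have m1 : rho1 <= Num.max rho1 rho2 by rewrite le_max lexx.
have m2 : rho2 <= Num.max rho1 rho2 by rewrite le_max lexx orbT.
apply: le_trans (nmD _ _) _; rewrite mulrDl; apply: lerD; last exact: H2 af M0 (hbnd_le m2 hM).
by rewrite nmM -mulrA ler_wpM2l ?nm_ge0 //; exact: H1 af M0 (hbnd_le m1 hM).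
Qed.

Lemma contbox_sum (J : Type) (s : seq J) (l : J -> C) (L : J -> F -> C) :
  (forall j, contbox (L j)) -> contbox (fun a => \sum_(j <- s) l j * L j a).
Proof.
move=> H; elim: s => [|j s IH].
  exists 0, 0 => // a f M _ _ _; rewrite big_nil nm0 mul0r //.
have -> : (fun a => \sum_(j <- j :: s) l j * L j a) =
   fun a => l j * L j a + \sum_(j <- s) l j * L j a by apply/funext => a; rewrite big_cons.
exact: contbox_lin.
Qed.

Lemma contbox_ext L1 L2 : (forall a : F, inA a -> L1 a = L2 a) -> contbox L1 -> contbox L2.
Proof.
move=> E [rho [k k0 H]]; exists rho, k => // a f M af M0 hM.
by rewrite -E; [exact: H af M0 hM|exists f].
Qed.

Variable star : F -> F -> F.
Hypothesis G : good_star star.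

#[local] Hint Extern 0 (inA (star_inv _)) => exact: inA_star_inv : core.

Record algA := AlgA { aval : F; _ : `[< inA aval >] }.
HB.instance Definition _ := [isSub for aval].

Lemma avalP (c : algA) : inA (aval c).
Proof. exact/asboolP/(valP c). Qed.
#[local] Hint Resolve avalP : core.

Lemma gs_unitr a : inA a -> star a (fun=> 1) = a.
Proof.
move=> aA; rewrite -[RHS]star_invK -(gs_unit G (a := star_inv a)) // (gs_inv G) //; last exact: inA_cst.
rewrite star_invK; congr star; apply/funext => r; by rewrite /star_inv conjC1.
Qed.

Lemma gs_psd N (l : 'I_N -> C) (c : 'I_N -> F) (p : pred 'I_N) r : (forall i, inA (c i)) ->
  0 <= \sum_(i | p i) \sum_(j | p j) Num.conj (l i) * l j * star (star_inv (c i)) (c j) r.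
Proof.
move=> cA; pose v : F := fun r => \sum_(i | p i) l i * c i r.
have vA : inA v by rewrite /v; apply: inA_sum => i _; exact: cA.
have := gs_pos G r vA; congr (0 <= _).
have -> : star_inv v = fun r => \sum_(i | p i) Num.conj (l i) * star_inv (c i) r.
  by apply/funext => t; rewrite /star_inv /v rmorph_sum; apply: eq_bigr => i _; rewrite rmorphM.
rewrite (linA_sum (L := fun a => star a v r)); last 2 first.
- exact: linA_eval _ (gs_linl G vA).
- by move=> i _; apply: inA_star_inv; exact: cA.
apply: eq_bigr => i _; rewrite /v (linA_sum (L := fun a => star _ a r)); last 2 first.
- by apply: linA_eval; apply: (gs_linr G); apply: inA_star_inv; exact: cA.
- by move=> j _; exact: cA.
by rewrite mulr_sumr; apply: eq_bigr => j _; rewrite mulrA.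
Qed.

Local Notation X := (Zpt R n * algA)%type.

(* The kernel space of gker is the direct sum over r of the GNS spaces of the
   states a |-> a r; the kernel function at (r, b) is the class of b. *)
Definition gker (x y : X) : C :=
  if x.1 == y.1 then star (star_inv (aval x.2)) (aval y.2) x.1 else 0.

Lemma gker_herm x y : gker y x = Num.conj (gker x y).
Proof.
rewrite /gker eq_sym; case: eqP => [->|_]; last by rewrite conjC0.
rewrite -[RHS]/(star_inv (star _ _) _) (gs_inv G) ?star_invK //.
Qed.

Lemma gker_pos (s : seq (C * X)) :
  0 <= \sum_(p <- s) \sum_(q <- s) Num.conj p.1 * q.1 * gker p.2 q.2.
Proof.
rewrite big_tnth; under eq_bigr do rewrite big_tnth.
set e := tnth (in_tuple s).
rewrite (eq_bigr (fun i => \sum_(j | (e i).2.1 == (e j).2.1) Num.conj (e i).1 * (e j).1 *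
   star (star_inv (aval (e i).2.2)) (aval (e j).2.2) (e i).2.1)); last first.
  move=> i _; rewrite [RHS]big_mkcond; apply: eq_bigr => j _.
  by rewrite /gker; case: ifP; rewrite ?mulr0.
rewrite (fiber_sum (fun i => (e i).2.1)); apply: sumr_ge0 => u _.
rewrite (eq_bigr (fun i => \sum_(j | u == (e j).2.1) Num.conj (e i).1 * (e j).1 *
   star (star_inv (aval (e i).2.2)) (aval (e j).2.2) u)); last first.
  by move=> i /eqP <-.
exact: (gs_psd (fun i => (e i).1) (c := fun i => aval (e i).2.2)).
Qed.

(** The default [x.2] of [insubd] is returned only when the product leaves the algebra, which
    [lactE] excludes for a in it. *)
Definition lact (a : F) (x : X) : X := (x.1, insubd x.2 (star a (aval x.2))).

Lemma lactE a x : inA a -> aval (lact a x).2 = star a (aval x.2).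
Proof.
move=> aA; rewrite -[LHS]/(val _) insubdK // unfold_in; apply/asboolP.
by apply: (gs_A G).
Qed.

(** This is (a* b)* c = b* (a c), evaluated at the common point of x and y. *)
Lemma lact_adj a : inA a -> kadj gker (lact (star_inv a)) (lact a).
Proof.
move=> aA x y; rewrite /gker /= -!/((lact _ _).2) !lactE //.
by rewrite (gs_inv G) ?star_invK // (gs_assoc G).
Qed.

(** Precomposing with left multiplication by the adjoint of a sends the section at (r, b) to the
    section at (r, a b): this is left multiplication by a on the GNS classes. *)
Definition rep (a : F) : kspace gker -> kspace gker := kop (lact (star_inv a)).

Lemma repE a (psi : kspace gker) x : inA a -> kval (rep a psi) x = kval psi (lact (star_inv a) x).
Proof. by move=> aA; rewrite /rep (kopE _ (lact_adj aA)). Qed.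

Lemma kspace_eq (phi psi : kspace gker) : (forall x, kval phi x = kval psi x) -> phi = psi.
Proof. by move=> H; apply: val_inj; apply/funext. Qed.

Lemma lact_eq a b (x y : X) : inA a -> inA b -> x.1 = y.1 ->
  star a (aval x.2) = star b (aval y.2) -> lact a x = lact b y.
Proof.
move=> aA bA E1 E2; rewrite /lact E1; congr (_, _); apply: val_inj.
by rewrite -!/(aval _) -(lactE x aA) -(lactE y bA) in E2.
Qed.

Lemma gker_lact a x y : inA a ->
  gker (lact (star_inv a) x) y =
  if x.1 == y.1 then star (star_inv (aval x.2)) (star a (aval y.2)) x.1 else 0.
Proof. by move=> aA; rewrite lact_adj // /gker lactE. Qed.

Lemma rep_cont : cont_rep star (@kip _ _ gker) rep.
Proof.
split; [|split; [|split; [|split; [|split]]]].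
- move=> a aA; have H := lact_adj aA; split; first exact: kop_lin H.
  exists (kop (lact a)); split; first exact: (kop_lin (kadj_sym gker_herm H)).
  by move=> phi psi; exact: (kop_adj gker_herm _ _ H).
- move=> l a b aA bA; apply/funext => psi; apply: kspace_eq => x.
  have cA := inA_lin l aA bA.
  rewrite repE // kvalD !repE // !krepE /kcomb mulr_sumr -big_split /=; apply: eq_bigr => q _.
  rewrite !gker_lact //; case: ifP => _; last by rewrite !mulr0 addr0.
  have h c : inA c -> inA (star c (aval q.2.2)) by move=> cA'; apply: (gs_A G).
  by rewrite (gs_linl G (avalP q.2.2) l aA bA) (gs_linr G _ l (h _ aA) (h _ bA)) //; ring.
- move=> a b aA bA; have abA := gs_A G aA bA.
  apply/funext => psi; apply: kspace_eq => x; rewrite !repE //.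
  congr (kval psi _); rewrite (gs_inv G) //; apply: lact_eq; [by apply: (gs_A G)|by []|by []|].
  by rewrite lactE // (gs_assoc G).
- apply/funext => psi; apply: kspace_eq => x; rewrite repE; last exact: inA_cst.
  congr (kval psi _); case: x => r c; rewrite /lact /=; congr (_, _); apply: val_inj.
  have -> : star_inv (fun _ : Zpt R n => 1) = (fun=> 1) by apply/funext => t; rewrite /star_inv conjC1.
  by rewrite (gs_unit G) // insubdK // unfold_in; apply/asboolP.
- move=> a aA phi psi; rewrite (kop_adj gker_herm _ _ (lact_adj aA)).
  by rewrite -/(star_inv a) /rep star_invK.
move=> phi psi; apply: contbox_contA.
(* A matrix coefficient is a finite combination of values (c* (a b))(r), and these are continuous in
   a by [gs_cont]. *)
apply: (@contbox_ext (fun a => \sum_(p <- krep phi) Num.conj p.1 * \sum_(q <- krep psi) q.1 *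
   (if p.2.1 == q.2.1 then star (star_inv (aval p.2.2)) (star a (aval q.2.2)) p.2.1 else 0))).
  move=> a aA; rewrite /kip; apply: eq_bigr => p _; congr (_ * _).
  rewrite repE // krepE /kcomb; apply: eq_bigr => q _; by rewrite gker_lact.
apply: contbox_sum => p; apply: contbox_sum => q; case: (p.2.1 == q.2.1).
  exact: (gs_cont G).
by exists 0, 0 => // a f M _ _ _; rewrite nm0 mul0r.
Qed.

Lemma rep_faithful a b : inA a -> inA b -> rep a = rep b -> a = b.
Proof.
move=> aA bA E; apply/funext => r.
have oneA : `[< inA (fun _ : Zpt R n => 1) >] by apply/asboolP; exact: inA_cst.
pose o : X := (r, AlgA oneA).
have H c : inA c -> kval (rep c (KSpace (kcomb_in gker [:: (1, o)]))) o = c r.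
  move=> cA; rewrite repE //= /kcomb big_seq1 mul1r gker_lact //= eqxx.
  have -> : star_inv (fun _ : Zpt R n => 1) = (fun=> 1) by apply/funext => t; rewrite /star_inv conjC1.
  by rewrite gs_unitr // (gs_unit G).
by rewrite -H // -[RHS]H // E.
Qed.

End Representation.

Theorem theorem4p14 (R : realType) (n : nat) (hn : (0 < n)%N) (hbar : R)
    (hhbar : 0 <= hbar) (star : Fn R n -> Fn R n -> Fn R n)
    (hstar : is_star_hbar hbar star) :
  exists (H : lmodType R[i]) (ip : H -> H -> R[i]) (pi : Fn R n -> H -> H),
    inner_product ip /\ cont_rep star ip pi /\
    (forall a b : Fn R n, inA a -> inA b -> pi a = pi b -> a = b).
Proof.
have G : good_star star.
  case: hstar => h0 h1; move: hhbar; rewrite le_eqVlt => /orP [/eqP e|e].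
    by apply: pointwise_good; apply: h0.
  by have [A [B [D E]]] := h1 e; exact: (wick_good e A B D E).
exists (kspace (gker star)), (@kip _ _ (gker star)), (@rep R n star); split; [|split].
- by apply: kip_inner; [exact: gker_herm|exact: gker_pos].
- exact: rep_cont.
exact: rep_faithful.
Qed.
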